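(* (1) Let $\mathfrak g^*=\sum_{p=-3}^{3}\mathfrak g^*_p$ be a graded simple Lie algebra of the third kind (with $\mathfrak g^*$ noncompact and $\mathfrak g^*_{\mathbb C}$ simple) with a grade-reversing Cartan involution $\tau$, corresponding to a partition $\{\Pi_0,\Pi_1\}$ of the simple restricted root system $\Pi=\{\lambda_1,\dots,\lambda_l\}$ such that $\Pi_1=\{\lambda_i\}$ with $n_i=3$. Put $\sigma=\mathrm{Ad}(\exp(\pi/2)\sqrt{-1}h_i)$. Then $\sigma$ is an automorphism of order $4$ of the compact dual $\mathfrak g$ of $\mathfrak g^*$ such that the center $\mathfrak z$ of $\mathfrak g^\sigma$ has dimension $1$ and $\tau\circ\sigma=\sigma^{-1}\circ\tau$. (2) Let $\mathfrak g$ be a compact simple Lie algebra and $\sigma=\mathrm{Ad}(\exp(\pi/2)\sqrt{-1}K_i)$ for some simple root $\alpha_i$ of $(\mathfrak g_{\mathbb C},\mathfrak t_{\mathbb C})$ with $m_i=3$. Then for each involution $\tau$ of $\mathfrak g$ satisfying $\tau\circ\sigma=\sigma^{-1}\circ\tau$, there exists $\theta\in\mathrm{Aut}(\mathfrak g)$ such that $\theta\circ\sigma\circ\theta^{-1}$ and $\theta\circ\tau\circ\theta^{-1}$ are obtained from a graded Lie algebra by the method described in (1).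
   Context: For (1): $\mathfrak g^*$ is a noncompact simple real Lie algebra with Cartan involution $\tau$, Cartan decomposition $\mathfrak g^*=\mathfrak k+\mathfrak p^*$ ($\tau=\mathrm{Id}$ on $\mathfrak k$, $-\mathrm{Id}$ on $\mathfrak p^*$), $\mathfrak a\subset\mathfrak p^*$ a maximal abelian subspace, $\Pi=\{\lambda_1,\dots,\lambda_l\}$ the simple roots of the restricted root system of $(\mathfrak g^*,\mathfrak a)$ for a lexicographic ordering, $n_j$ the coefficient of $\lambda_j$ in the highest restricted root, $h_i\in\mathfrak a$ defined by $\lambda_j(h_i)=\delta_{ij}$. The gradation corresponding to the partition $\Pi=\Pi_0\cup\Pi_1$ with $\Pi_1=\{\lambda_i\}$ is $\mathfrak g^*_p=\{X\in\mathfrak g^*: [h_i,X]=pX\}$; its characteristic element is $h_i$, and $\tau(\mathfrak g^*_p)=\mathfrak g^*_{-p}$. A gradation is of $\nu$-th kind if it has the form $\sum_{p=-\nu}^{\nu}\mathfrak g^*_p$ with $[\mathfrak g^*_p,\mathfrak g^*_q]\subset\mathfrak g^*_{p+q}$ and $\mathfrak g_1^*\neq\{0\}$. The compact dual is $\mathfrak g=\mathfrak k+\sqrt{-1}\mathfrak p^*\subset\mathfrak g^*_{\mathbb C}$; $\tau$ is regarded as an involution of $\mathfrak g$ by complex linear extension and restriction. For (2): $\mathfrak t$ is a maximal abelian subalgebra of $\mathfrak g$, $\{\alpha_1,\dots,\alpha_n\}$ simple roots of $(\mathfrak g_{\mathbb C},\mathfrak t_{\mathbb C})$, $\delta=\sum_jm_j\alpha_j$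 the highest root, and $K_j\in\mathfrak t_{\mathbb C}$ is defined by $\alpha_i(K_j)=\delta_{ij}$. An involution is an automorphism of order 2. *)

(* Defs.v *)
From HB Require Import structures.
From mathcomp Require Import all_boot all_order all_algebra.
From mathcomp Require Import complex ring lra.
From mathcomp Require Import all_classical all_reals all_analysis.

Set Implicit Arguments.
Unset Strict Implicit.
Unset Printing Implicit Defensive.

Import Order.TTheory GRing.Theory Num.Theory.
Import numFieldNormedType.Exports.
Import passmx VectorInternalTheory.

Local Open Scope ring_scope.
Local Open Scope complex_scope.

HB.mixin Record Vector_isLieAlgebra (F : fieldType) V of Vector F V := {
  lie : V -> V -> V;
  lie_linearl : forall y, linear (lie^~ y);
  lie_linearr : forall x, linear (lie x);
  liexx : forall x, lie x x = 0;
  lie_jacobi : forall x y z,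
    lie x (lie y z) + lie y (lie z x) + lie z (lie x y) = 0
}.

#[short(type="lieAlgType")]
HB.structure Definition LieAlgebra (F : fieldType) :=
  { V of Vector_isLieAlgebra F V & Vector F V }.

HB.instance Definition _ (F : fieldType) (g : lieAlgType F) (x : g) :=
  GRing.isLinear.Build F g g _ (lie x) (lie_linearr x).

Lemma lieDl (F : fieldType) (g : lieAlgType F) (x y z : g) :
  lie (x + y) z = lie x z + lie y z.
Proof. by have := lie_linearl z 1 x y; rewrite /= !scale1r. Qed.

Lemma lieZl (F : fieldType) (g : lieAlgType F) c (x z : g) :
  lie (c *: x) z = c *: lie x z.
Proof.
have lie0 : lie 0 z = 0 by apply: (addrI (lie 0 z)); rewrite -lieDl !addr0.
by have := lie_linearl z c x 0; rewrite /= addr0 lie0 addr0.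
Qed.

Lemma lieNl (F : fieldType) (g : lieAlgType F) (x z : g) :
  lie (- x) z = - lie x z.
Proof. by rewrite -scaleN1r lieZl scaleN1r. Qed.

Lemma lieC (F : fieldType) (g : lieAlgType F) (x y : g) : lie x y = - lie y x.
Proof.
apply/eqP; rewrite -addr_eq0; have := liexx (x + y).
by rewrite lieDl !linearD /= !liexx add0r addr0 => ->.
Qed.

Definition ad (F : fieldType) (g : lieAlgType F) (x : g) : 'End(g) :=
  linfun (lie x).

Lemma adE (F : fieldType) (g : lieAlgType F) (x y : g) : ad x y = lie x y.
Proof. exact: lfunE. Qed.

Definition lfun_trace (F : fieldType) (V : vectType F) (f : 'End(V)) : F :=
  \tr (mxof (vbasis {:V}) (vbasis {:V}) f).

Definition killing (F : fieldType) (g : lieAlgType F) (x y : g) : F :=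
  lfun_trace (ad x \o ad y)%VF.

Definition abelian_vs (F : fieldType) (g : lieAlgType F) (U : {vspace g}) :=
  forall x y, x \in U -> y \in U -> lie x y = 0.

Definition maximal_abelian_in (F : fieldType) (g : lieAlgType F)
    (P U : {vspace g}) :=
  [/\ (U <= P)%VS, abelian_vs U &
      forall W, (U <= W)%VS -> (W <= P)%VS -> abelian_vs W -> W = U].

Definition lie_ideal (F : fieldType) (g : lieAlgType F) (U : {vspace g}) :=
  forall x y, y \in U -> lie x y \in U.

Definition lie_simple (F : fieldType) (g : lieAlgType F) :=
  ~ abelian_vs {:g} /\
  forall U : {vspace g}, lie_ideal U -> U = 0%VS \/ U = fullv.

Definition lie_center (F : fieldType) (g : lieAlgType F) (U : {vspace g}) :
  {vspace g} := (U :&: \bigcap_(i < \dim U) lker (ad (vbasis U)`_i))%VS.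

Definition lie_hom (F : fieldType) (g h : lieAlgType F) (f : 'Hom(g, h)) :=
  forall x y, f (lie x y) = lie (f x) (f y).

(** Automorphisms, and their order, are stated for the restriction of an
    endomorphism [f] of [g] to a subalgebra [U]. *)
Definition lie_aut_on (F : fieldType) (g : lieAlgType F) (U : {vspace g})
    (f : 'End(g)) :=
  (f @: U)%VS = U /\ {in U &, forall x y, f (lie x y) = lie (f x) (f y)}.

Definition order_on (F : fieldType) (V : vectType F) (U : {vspace V})
    (f : 'End(V)) (n : nat) :=
  [/\ (0 < n)%N, {in U, forall x, iter n f x = x} &
      forall m, (0 < m < n)%N -> ~ {in U, forall x, iter m f x = x}].

Definition lie_aut (F : fieldType) (g : lieAlgType F) (f : 'End(g)) :=
  lie_aut_on {:g} f.

Definition lie_involution (F : fieldType) (g : lieAlgType F) (f : 'End(g)) :=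
  lie_aut f /\ order_on {:g} f 2.

Definition vdual (F : fieldType) (V : vectType F) (a : {vspace V}) :=
  'Hom(subvs_of a, F^o).

Definition lie_root (F : fieldType) (g : lieAlgType F) (a : {vspace g})
    (mu : vdual a) :=
  mu <> 0 /\
  exists2 X : g, X <> 0 & forall H : subvs_of a, lie (vsval H) X = (mu H : F) *: X.

(** [delta] dominates every root [mu] for the partial order defined by the
    simple roots [lam]. *)
Definition highest_root (F : fieldType) (g : lieAlgType F) (a : {vspace g})
    (l : nat) (lam : 'I_l -> vdual a) (delta : vdual a) :=
  lie_root delta /\
  forall mu : vdual a, lie_root mu ->
    exists k : 'I_l -> nat, delta - mu = \sum_j (k j)%:R *: lam j.

(** Simple roots in the sense of a base: a linearly independent family of roots
    such that every root is, up to sign, a combination of it with natural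
    coefficients. *)
Definition root_base (F : fieldType) (g : lieAlgType F) (a : {vspace g})
    (n : nat) (alpha : 'I_n -> vdual a) :=
  [/\ forall j, lie_root (alpha j),
      free [seq alpha j | j <- enum 'I_n] &
      forall mu : vdual a, lie_root mu -> exists k : 'I_n -> nat,
        mu = \sum_j (k j)%:R *: alpha j \/ mu = - \sum_j (k j)%:R *: alpha j].

(** The lexicographic ordering of the dual of [a] given by an ordered basis [b]
    of [a]. *)
Definition lex_pos (R : realType) (V : vectType R) (a : {vspace V})
    (b : seq (subvs_of a)) (mu : vdual a) :=
  exists j : nat, [/\ (j < size b)%N, 0 < (mu b`_j : R) &
    forall i, (i < j)%N -> mu b`_i = 0].

Definition lex_simple_root (R : realType) (g : lieAlgType R) (a : {vspace g})
    (b : seq (subvs_of a)) (mu : vdual a) :=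
  [/\ lie_root mu, lex_pos b mu &
      ~ exists mu1 mu2 : vdual a,
          [/\ lie_root mu1, lex_pos b mu1, lie_root mu2, lex_pos b mu2 &
              mu = mu1 + mu2]].

(** Compactness, in the sense used for semisimple real Lie algebras. *)
Definition lie_compact (R : realType) (g : lieAlgType R) :=
  forall x : g, x <> 0 -> killing x x < 0.

Definition cartan_involution (R : realType) (g : lieAlgType R)
    (tau : 'End(g)) :=
  [/\ lie_aut tau, forall x, tau (tau x) = x &
      forall x : g, x <> 0 -> 0 < - killing x (tau x)].

Definition cartan_k (R : realType) (g : lieAlgType R) (tau : 'End(g)) :
  {vspace g} := fixedSpace tau.

Definition cartan_p (R : realType) (g : lieAlgType R) (tau : 'End(g)) :
  {vspace g} := leigenspace tau (-1).

(** The limit of the exponential series is taken coordinatewise. *)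
Definition exp_psum (R : realType) (V : vectType R) (f : 'End(V)) (v : V)
    (n : nat) : V := \sum_(k < n) (k`!%:R)^-1 *: iter k f v.

Definition exp_fun (R : realType) (V : vectType R) (f : 'End(V)) (v : V) : V :=
  \sum_(i < \dim {:V})
    lim ((coord (vbasis {:V}) i (exp_psum f v n) : R) @[n --> \oo])%classic
      *: (vbasis {:V})`_i.

Definition exp_lfun (R : realType) (V : vectType R) (f : 'End(V)) : 'End(V) :=
  linfun (exp_fun f).

(** The pair [(x, y)] stands for [x + sqrt(-1) y]. *)
Definition complexify (R : rcfType) (g : lieAlgType R) : Type := (g * g)%type.

Section Complexify.
Variables (R : rcfType) (g : lieAlgType R).
Local Notation gC := (complexify g).

HB.instance Definition _ := GRing.Zmodule.copy gC (g * g)%type.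

Definition cscale (c : R[i]) (z : gC) : gC :=
  (complex.Re c *: z.1 - complex.Im c *: z.2,
   complex.Re c *: z.2 + complex.Im c *: z.1).

Fact cscaleA a b z : cscale a (cscale b z) = cscale (a * b) z.
Proof.
case: a b z => [a1 a2] [b1 b2] [x y].
rewrite /cscale /= !scalerDr !scalerN !scalerA !scalerDl !scaleNr.
by congr (_, _); rewrite ?opprD [LHS](AC (2*2) ((1*4)*(2*3))).
Qed.

Fact cscale1 : left_id 1 cscale.
Proof.
by case=> x y; rewrite /cscale /= !scale1r !scale0r subr0 addr0.
Qed.

Fact cscaleDr : right_distributive cscale +%R.
Proof.
by move=> a [x y] [z t]; congr (_, _); rewrite /= !scalerDr ?opprD addrACA.
Qed.

Fact cscaleDl z : {morph cscale^~ z : a b / a + b}.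
Proof.
case: z => x y [a1 a2] [b1 b2]; congr (_, _);
  by rewrite /= !scalerDl ?opprD addrACA.
Qed.

HB.instance Definition _ := GRing.Zmodule_isLmodule.Build R[i] gC
  cscaleA cscale1 cscaleDr cscaleDl.

Fact complexify_vect_iso : Vector.axiom (dim g) gC.
Proof.
pose f (z : gC) : 'rV[R[i]]_(dim g) :=
  \row_j (v2r z.1 0 j +i* v2r z.2 0 j).
pose f' (u : 'rV[R[i]]_(dim g)) : gC :=
  (r2v (map_mx (@complex.Re R) u), r2v (map_mx (@complex.Im R) u)).
exists f.
  move=> [a1 a2] [x y] [z t]; apply/rowP=> j; rewrite !mxE /=.
  apply/eqP; rewrite eq_complex /=.
  by rewrite !(linearD, linearN, linearZ) /= !mxE !eqxx.
exists f' => [[x y]|u]; rewrite /f' /f.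
  by congr (_, _); rewrite -[RHS]v2rK; congr r2v; apply/rowP=> j; rewrite !mxE.
by apply/rowP=> j; rewrite !mxE !r2vK !mxE; case: (u 0 j).
Qed.

HB.instance Definition _ := Lmodule_hasFinDim.Build R[i] gC complexify_vect_iso.

End Complexify.

Section ComplexifyLie.
Variables (R : rcfType) (g : lieAlgType R).
Local Notation gC := (complexify g).

Definition clie (z w : gC) : gC :=
  (lie z.1 w.1 - lie z.2 w.2, lie z.1 w.2 + lie z.2 w.1).

Fact clie_linearl w : linear (clie^~ w).
Proof.
case: w => u v [a b] [x y] [z t]; congr (_, _) => /=;
  rewrite !(lieDl, lieZl, lieNl) !(scalerDr, scalerN, opprD, opprK);
  by rewrite [LHS](AC (3*3) (((1*4)*(5*2))*(3*6))).
Qed.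

Fact clie_linearr w : linear (clie w).
Proof.
case: w => u v [a b] [x y] [z t]; congr (_, _) => /=;
  rewrite !(linearD, linearN, linearZ) /= !(scalerDr, scalerN, opprD, opprK);
  by rewrite [LHS](AC (3*3) (((1*4)*(2*5))*(3*6))).
Qed.

Fact cliexx z : clie z z = 0.
Proof.
case: z => x y; congr (_, _) => /=; first by rewrite !liexx subrr.
by rewrite (lieC x) addNr.
Qed.

Fact clie_jacobi x y z :
  clie x (clie y z) + clie y (clie z x) + clie z (clie x y) = 0.
Proof.
have lin (u : g) : u = 0 -> forall i, v2r u 0 i = 0.
  by move=> -> i; rewrite linear0 mxE.
case: x y z => [a b] [c d] [e f].
congr (_, _) => /=; rewrite !(linearD, linearN) /=;
  apply: (can_inj v2rK); apply/rowP=> i; rewrite !(linearD, linearN, mxE) /=.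
  have := lin _ (lie_jacobi a c e) i; have := lin _ (lie_jacobi a d f) i.
  have := lin _ (lie_jacobi b c f) i; have := lin _ (lie_jacobi b d e) i.
  by rewrite !(linearD, mxE) linear0 mxE; lra.
have := lin _ (lie_jacobi a c f) i; have := lin _ (lie_jacobi a d e) i.
have := lin _ (lie_jacobi b c e) i; have := lin _ (lie_jacobi b d f) i.
by rewrite !(linearD, mxE) linear0 mxE; lra.
Qed.

HB.instance Definition _ := Vector_isLieAlgebra.Build R[i] gC
  clie_linearl clie_linearr cliexx clie_jacobi.

End ComplexifyLie.

Definition creal (R : rcfType) (g : lieAlgType R) (x : g) :
  complexify g := (x, 0).
Definition cimag (R : rcfType) (g : lieAlgType R) (x : g) :
  complexify g := (0, x).

Definition complexify_vs (R : rcfType) (g : lieAlgType R) (U : {vspace g}) :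
  {vspace complexify g} := <<[seq creal x | x <- vbasis U]>>%VS.

(** Restriction of scalars of [W] to [R]. *)
Definition realify (R : rcfType) (W : lieAlgType R[i]) : Type := W.

Section Realify.
Variables (R : rcfType) (W : lieAlgType R[i]).
Local Notation WR := (realify W).

HB.instance Definition _ := GRing.Zmodule.copy WR W.

Definition rscale (c : R) (x : WR) : WR := c%:C *: (x : W).

Fact rscaleA a b x : rscale a (rscale b x) = rscale (a * b) x.
Proof. by rewrite /rscale scalerA rmorphM. Qed.

Fact rscale1 : left_id 1 rscale.
Proof. by move=> x; rewrite /rscale rmorph1 scale1r. Qed.

Fact rscaleDr : right_distributive rscale +%R.
Proof. by move=> a x y; rewrite /rscale scalerDr. Qed.

Fact rscaleDl x : {morph rscale^~ x : a b / a + b}.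
Proof. by move=> a b; rewrite /rscale rmorphD scalerDl. Qed.

HB.instance Definition _ := GRing.Zmodule_isLmodule.Build R WR
  rscaleA rscale1 rscaleDr rscaleDl.

Fact realify_vect_iso : Vector.axiom (dim W + dim W) WR.
Proof.
pose f (x : WR) : 'rV[R]_(dim W + dim W) :=
  row_mx (map_mx (@complex.Re R) (v2r (x : W)))
         (map_mx (@complex.Im R) (v2r (x : W))).
pose f' (u : 'rV[R]_(dim W + dim W)) : WR :=
  r2v (\row_j (lsubmx u 0 j +i* rsubmx u 0 j)) : W.
exists f.
  move=> a x y; rewrite /f scale_row_mx add_row_mx.
  have -> : v2r ((a *: x + y : WR) : W) = a%:C *: v2r (x : W) + v2r (y : W).
    by rewrite -linearZ -linearD.
  congr row_mx; apply/rowP=> j; rewrite !mxE;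
    case: (v2r (x : W) 0 j) (v2r (y : W) 0 j) => [x1 x2] [y1 y2] /=.
    by rewrite mul0r subr0.
  by rewrite mul0r addr0.
exists f' => [x|u]; rewrite /f' /f.
  rewrite -[RHS](v2rK (x : W)); congr r2v; apply/rowP=> j.
  by rewrite row_mxKl row_mxKr !mxE; case: (v2r _ _ _).
rewrite -[RHS]hsubmxK r2vK; congr row_mx; apply/rowP=> j; by rewrite !mxE.
Qed.

HB.instance Definition _ := Lmodule_hasFinDim.Build R WR realify_vect_iso.

End Realify.

Section RealifyLie.
Variables (R : rcfType) (W : lieAlgType R[i]).
Local Notation WR := (realify W).

Definition rlie (x y : WR) : WR := lie (x : W) (y : W).

Fact rlie_linearl y : linear (rlie^~ y).
Proof. by move=> a x z; rewrite /rlie /= lieDl lieZl. Qed.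

Fact rlie_linearr x : linear (rlie x).
Proof. by move=> a y z; rewrite /rlie linearD linearZ. Qed.

Fact rliexx x : rlie x x = 0. Proof. exact: liexx. Qed.

Fact rlie_jacobi x y z :
  rlie x (rlie y z) + rlie y (rlie z x) + rlie z (rlie x y) = 0.
Proof. exact: lie_jacobi. Qed.

HB.instance Definition _ := Vector_isLieAlgebra.Build R WR
  rlie_linearl rlie_linearr rliexx rlie_jacobi.

End RealifyLie.

(** The compact dual [k + sqrt(-1) p], as a real subspace of the
    complexification. *)
Definition compact_dual (R : realType) (g : lieAlgType R) (tau : 'End(g)) :
    {vspace realify (complexify g)} :=
  ((linfun (@creal R g : g -> realify (complexify g)) @: cartan_k tau) +
   (linfun (@cimag R g : g -> realify (complexify g)) @: cartan_p tau))%VS.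

Definition complexify_lfun (R : realType) (g : lieAlgType R) (f : 'End(g)) :
    'End(realify (complexify g)) :=
  linfun (fun z : realify (complexify g) =>
            (f z.1, f z.2) : realify (complexify g)).

(** [Ad (exp X)] is rendered as [exp (ad X)], without reference to a group. *)
Definition Ad_exp (R : realType) (g : lieAlgType R) (X : g) : 'End(g) :=
  exp_lfun (ad X).

Definition half_pi_i (R : realType) (g : lieAlgType R) (Z : complexify g) :
    realify (complexify g) :=
  ((pi / 2 : R)%:C * 'i%C) *: Z.

Definition gradation_of_kind (R : realType) (g : lieAlgType R) (nu : nat)
    (G : int -> {vspace g}) :=
  [/\ directv (\sum_(k < nu.*2.+1) G (k%:Z - nu%:Z)%R)%VS,
      (\sum_(k < nu.*2.+1) G (k%:Z - nu%:Z)%R)%VS = fullv,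
      forall p : int, (nu < `|p|)%N -> G p = 0%VS,
      forall p q x y, x \in G p -> y \in G q -> lie x y \in G (p + q) &
      G 1 <> 0%VS].

Definition characteristic_gradation (R : realType) (g : lieAlgType R) (h : g)
    (p : int) : {vspace g} := leigenspace (ad h) p%:~R.

Definition grade_reversing (R : realType) (g : lieAlgType R)
    (G : int -> {vspace g}) (tau : 'End(g)) :=
  forall p, (tau @: G p)%VS = G (- p).

Section ThirdKind.
Variables (R : realType) (gs : lieAlgType R) (tau : 'End(gs)).
Variables (a : {vspace gs}) (b : seq (subvs_of a)) (l : nat).
Variables (lam : 'I_l -> vdual a) (n : 'I_l -> nat) (h : 'I_l -> subvs_of a).
Variable (i : 'I_l).

(** [lam] lists the simple restricted roots for the lexicographic ordering
    given by [b], [n] the coefficients of the highest restricted root, and [h]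
    is the basis dual to [lam]. *)
Record third_kind_graded : Prop := ThirdKindGraded {
  tkg_simple : lie_simple gs;
  tkg_noncompact : ~ lie_compact gs;
  tkg_complexify_simple : lie_simple (complexify gs);
  tkg_cartan : cartan_involution tau;
  tkg_maximal_abelian : maximal_abelian_in (cartan_p tau) a;
  tkg_basis : basis_of {:subvs_of a} b;
  tkg_lam_inj : injective lam;
  tkg_lam : forall mu : vdual a,
    lex_simple_root b mu <-> exists j, mu = lam j;
  tkg_highest : highest_root lam (\sum_j (n j)%:R *: lam j);
  tkg_dual : forall j k, lam j (h k) = (j == k)%:R;
  tkg_kind : gradation_of_kind 3 (characteristic_gradation (vsval (h i)));
  tkg_reversing :
    grade_reversing (characteristic_gradation (vsval (h i))) tau;
  tkg_coef : n i = 3%N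
}.

Definition graded_sigma : 'End(realify (complexify gs)) :=
  Ad_exp (half_pi_i (creal (vsval (h i)))).

End ThirdKind.

(** [s] and [t], endomorphisms of [g], are those of the method up to an
    isomorphism [phi] of [g] onto the compact dual. *)
Definition obtained_from_graded (R : realType) (g : lieAlgType R)
    (s t : 'End(g)) :=
  exists (gs : lieAlgType R) (tau : 'End(gs)) (a : {vspace gs})
    (b : seq (subvs_of a)) (l : nat) (lam : 'I_l -> vdual a) (n : 'I_l -> nat)
    (h : 'I_l -> subvs_of a) (i : 'I_l),
  third_kind_graded tau b lam n h i /\
  exists phi : 'Hom(g, realify (complexify gs)),
    [/\ lker phi = 0%VS, limg phi = compact_dual tau, lie_hom phi,
        forall x, phi (s x) = graded_sigma h i (phi x) &
        forall x, phi (t x) = complexify_lfun tau (phi x)].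

(* Main.v *)
Require Import Defs.
From HB Require Import structures.
From mathcomp Require Import all_boot all_order all_algebra.
From mathcomp Require Import complex ring lra zify.
From mathcomp Require Import all_classical all_reals all_analysis.

Set Implicit Arguments.
Unset Strict Implicit.
Unset Printing Implicit Defensive.

Import Order.TTheory GRing.Theory Num.Theory.
Import passmx.
Import numFieldNormedType.Exports.
Local Open Scope ring_scope.

(** The proposition compares the gradations of the third kind with the inner
    automorphisms of order 4 of a compact Lie algebra that come from a simple
    root of coefficient 3.

    Part (1). Write [h] for the characteristic element and [E p] for the part of
    degree [p]. On the part of degree [p] of the complexification, [sigma] acts
    by [i ^ p] (lemma [quarter_turnE]). As the degrees lie between -3 and 3, this
    shows that [sigma] is an automorphism of order 4 whose fixed points have
    degree 0, and that [tau], which exchanges the degrees [p] and [- p],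
    conjugates it to its inverse. It remains to see that the center of [E 0] is
    the line of [h] (lemma [third_kind_center]). This center is stable under
    [tau]. Its part in [p] lies in [a] and is killed by all simple roots but
    one, so it is the line of [h]. Let [z] be in its part in [k].
    - A nonzero subspace of positive degree stable under [E 0] is never
      annihilated by lowering with the simple root of degree 1 (lemma
      [lowered_by_simple_root_eq0]): a weight of minimal height would have a
      nonpositive product with every simple root. Hence [E 1] is irreducible and
      [(ad z) ^ 2] is a scalar [c] on it.
    - [ad z] vanishes on [E 3]: the complexification is simple, so its top degree
      is a simple module over degree 0 on which [z] acts by a scalar, and that
      scalar is both real and imaginary.
    - These two facts are incompatible with [c <> 0], because 3 is odd: lowering
      [E 3] twice reaches degree 1 with a square of [ad z] equal to 0 or [4 c].
      Thus [ad z = 0].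

    Part (2) holds with [theta] the identity. The roots of the compact algebra
    [g] are real on [i t], so [Z = i K_i] lies in [g] and [ad K_i] has the
    eigenvalues -3, ..., 3 (lemmas [characteristic_element] and
    [characteristic_graded]). The line of [Z] is the center of the fixed algebra
    of [sigma], so [tau Z] is [Z] or [- Z], and [tau sigma = sigma^-1 tau] leaves
    only [- Z] (lemma [involution_reverses]). Let [g = k + p] be the
    decomposition for [tau], and let [k + i p] be its noncompact dual, realized
    on the space [g] with a modified bracket (definition [noncompact_dual]). Its
    complexification is that of [g], which is simple since [g] is compact and
    simple, and [Z] defines a gradation of it that [tau] reverses. The center of
    the part of degree 0 is again the line of [Z], which forces exactly one
    simple restricted root to be nonzero on [Z], for an ordering that begins
    with [Z]; it is 1 there and has coefficient 3 in the highest root (lemma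
    [dual_third_kind]). The compact dual of [k + i p] is [g].

    Two tools serve throughout. Restricted root theory is done with the inner
    product [- B(x, tau y)] instead of representations of [sl2]: if
    [[tau x, y] = 0] then the identity [|[x, y]|^2 = - <y, [[tau x, x], y]>] gives
    the sign of a weight on a coroot (lemma [lowest_weight_le0]). And a simple
    Lie algebra is generated by any part of its top degree under nonpositive
    degrees (lemma [simple_top_generates]). *)

(** * Stable subspaces, eigenvectors and inner products *)

Section LinearAlgebra.
Variables (F : fieldType) (V : vectType F).
Implicit Types (f g : 'End(V)) (U W : {vspace V}).

Definition stable_under f U := forall x, x \in U -> f x \in U.

Lemma leigenspaceP f c x : reflect (f x = c *: x) (x \in leigenspace f c).
Proof. by rewrite memv_ker !lfun_simp subr_eq0; apply: eqP. Qed.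

Lemma vspace_neq0P U : U <> 0%VS <-> exists2 x, x \in U & x <> 0.
Proof.
split=> [/eqP U0|[x xU x0] U0]; last by move: xU; rewrite U0 memv0 => /eqP.
by exists (vpick U); [exact: memv_pick | move/eqP; rewrite vpick0 (negbTE U0)].
Qed.

Lemma memv_sum_at (I : finType) (U : I -> {vspace V}) (k : I) (x : V) :
  x \in U k -> x \in (\sum_j U j)%VS.
Proof. by apply/subvP; apply: (sumv_sup k). Qed.

(** Subtracting [d k] times the relation from its image under [f] removes the
    term [k], so one may induct on the number of eigenvectors. *)
Lemma eigenvectors_separate f (I : Type) (r : seq I) (P : pred I) (d : I -> F)
    (v : I -> V) c :
  (forall k, P k -> d k != c) -> (forall k, P k -> f (v k) = d k *: v k) ->
  f (\sum_(k <- r | P k) v k) = c *: \sum_(k <- r | P k) v k ->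
  \sum_(k <- r | P k) v k = 0.
Proof.
move=> dc; elim: r v => [|k r IH] v fv fs; first by rewrite big_nil.
move: fs; rewrite big_cons; case: (boolP (P k)) => Pk; last exact: IH.
set s := (v k + _) => fs.
have ck : c - d k != 0 by rewrite subr_eq0 eq_sym dc.
pose v' j := ((d j - d k) / (c - d k)) *: v j.
have sE : s = \sum_(j <- r | P j) v' j.
  apply: (scalerI ck); rewrite scalerBl -fs /s linearD /= fv // scalerDr opprD.
  rewrite addrACA subrr add0r linear_sum scaler_sumr -sumrB scaler_sumr.
  apply: eq_bigr => j Pj; rewrite /v' scalerA mulrC divfK // scalerBl.
  by rewrite /= fv.
rewrite sE; apply: IH => [j Pj|]; last by rewrite -sE.
by rewrite /v' linearZ /= fv // !scalerA mulrC.
Qed.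

(** A subspace of maximal dimension among those contained in [P] is all of [P].
    Centralizers, preimages and spans are built with this lemma. *)
Lemma vspace_of_pred (P : V -> Prop) : P 0 ->
  (forall c x y, P x -> P y -> P (c *: x + y)) ->
  exists U : {vspace V}, forall x, x \in U <-> P x.
Proof.
move=> P0 PD.
suff H k : forall U : {vspace V}, (\dim {:V} - \dim U <= k)%N ->
    (forall x, x \in U -> P x) -> exists W : {vspace V}, forall x, x \in W <-> P x.
  by apply: (H _ 0%VS) => // x; rewrite memv0 => /eqP ->.
elim: k => [|k IH] U dU UP.
  exists U => x; split; first exact: UP.
  suff -> : U = fullv by rewrite memvf.
  by apply/eqP; rewrite eqEdim subvf /= -subn_eq0 -leqn0.
case: (pselect (forall x, P x -> x \in U)) => [PU|]; first by exists U; split; auto.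
move=> /existsNP[x /not_implyP[Px /negP xU]].
apply: (IH (<[x]> + U)%VS) => [|_ /memv_addP[_ /vlineP[c ->] [u uU ->]]]; last first.
  by apply: PD => //; apply: UP.
have ltU : (\dim U < \dim (<[x]> + U))%N.
  rewrite ltn_neqAle dimvS ?addvSr // andbT.
  apply: contra xU => /eqP dE.
  have /eqP -> : U == (<[x]> + U)%VS by rewrite eqEdim addvSr -dE leqnn.
  by rewrite (subvP (addvSl _ _)) ?memv_line.
by rewrite -ltnS (leq_trans _ dU) // ltn_sub2l // (leq_trans ltU) // dimvS // subvf.
Qed.

Lemma dual_vector (x : V) : x <> 0 -> exists phi : 'Hom(V, F^o), phi x = 1.
Proof.
move=> /eqP x0; exists (linfun (coord [tuple x] ord0 : V -> F^o)).
by have := coord_free ord0 ord0 (etrans (seq1_free x) x0); rewrite lfunE.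
Qed.

Lemma stable_mx f U : stable_under f U -> exists A : 'M[F]_(\dim U),
  forall w : 'rV_(\dim U), f (\sum_i w 0 i *: (vbasis U)`_i)
    = \sum_i (w *m A) 0 i *: (vbasis U)`_i.
Proof.
move=> fU; exists (\matrix_(i, j) coord (vbasis U) j (f (vbasis U)`_i)) => w.
rewrite linear_sum /=.
under eq_bigr => i _.
  rewrite linearZ /= (coord_vbasis (fU (vbasis U)`_i _)); last first.
    by rewrite vbasis_mem // mem_nth // size_tuple.
  rewrite scaler_sumr; over.
rewrite exchange_big; apply: eq_bigr => j _ /=.
rewrite mxE scaler_suml; apply: eq_bigr => i _.
by rewrite mxE scalerA.
Qed.

Lemma vbasis_comb_eq0 U (w : 'rV[F]_(\dim U)) :
  \sum_i w 0 i *: (vbasis U)`_i = 0 -> w = 0.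
Proof.
have /freeP fr := basis_free (vbasisP U).
by move=> /fr w0; apply/rowP=> i; rewrite mxE w0.
Qed.

(** Each eigenspace of the first operator is stable under the others, and one
    continues inside it. The existence of eigenvectors is a hypothesis because
    it has different reasons over the complex numbers and for symmetric real
    operators. *)
Lemma common_eigenvector_seq (s : seq 'End(V)) U :
    U <> 0%VS -> (forall f, f \in s -> stable_under f U) ->
    (forall f g, f \in s -> g \in s -> forall x, f (g x) = g (f x)) ->
    (forall f, f \in s -> forall W, (W <= U)%VS -> W <> 0%VS -> stable_under f W ->
      exists c x, [/\ x \in W, x <> 0 & f x = c *: x]) ->
  exists x, [/\ x \in U, x <> 0 & forall f, f \in s -> exists c, f x = c *: x].
Proof.
elim: s U => [|f s IH] U U0 stU com eig.
  by have /vspace_neq0P[x xU x0] := U0; exists x.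
have [|||c [x [xU x0 fx]]] := eig f _ U _ U0; rewrite ?mem_head ?subvv //.
  by apply: stU; rewrite mem_head.
have [||g h gs hs|g gs W WU|y [yU y0 ys]] := IH (U :&: leigenspace f c)%VS.
- by apply/vspace_neq0P; exists x; rewrite ?memv_cap ?xU //; apply/leigenspaceP.
- move=> g gs y; rewrite !memv_cap => /andP[yU /leigenspaceP fy].
  rewrite stU ?inE ?gs ?orbT //=; apply/leigenspaceP.
  by rewrite com ?inE ?gs ?eqxx ?orbT // fy linearZ.
- by apply: com; rewrite inE ?gs ?hs orbT.
- by apply: eig; [rewrite inE gs orbT | apply: subv_trans WU (capvSl _ _)].
move: yU; rewrite memv_cap => /andP[yU /leigenspaceP fy].
exists y; split=> // g; rewrite inE => /predU1P[->|/ys //].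
by exists c.
Qed.

End LinearAlgebra.

Lemma closed_eigenvector (C : numClosedFieldType) (V : vectType C)
    (f : 'End(V)) (U : {vspace V}) : U <> 0%VS -> stable_under f U ->
  exists c x, [/\ x \in U, x <> 0 & f x = c *: x].
Proof.
move=> /eqP U0 /stable_mx[A fA].
have dU : (0 < \dim U)%N by rewrite lt0n dimv_eq0.
have [c /eigenvalueP[w wA w0]] := eigenvalue_closed A dU.
exists c, (\sum_i w 0 i *: (vbasis U)`_i); split.
- by rewrite rpred_sum // => i _; rewrite rpredZ // vbasis_mem // mem_nth // size_tuple.
- by move=> /vbasis_comb_eq0 /eqP; rewrite (negbTE w0).
rewrite fA wA scaler_sumr; apply: eq_bigr => i _.
by rewrite mxE scalerA.
Qed.

Section InnerProduct.
Variables (R : realType) (V : vectType R).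

Record inner_product (q : V -> V -> R) : Prop := InnerProduct {
  innerDl : forall x y z, q (x + y) z = q x z + q y z;
  innerZl : forall c x z, q (c *: x) z = c * q x z;
  innerC : forall x y, q x y = q y x;
  inner_gt0 : forall x, x <> 0 -> 0 < q x x
}.

Variable q : V -> V -> R.
Hypothesis qP : inner_product q.

Definition symmetric_for (f : 'End(V)) := forall x y, q (f x) y = q x (f y).

Lemma innerDr x y z : q x (y + z) = q x y + q x z.
Proof. by rewrite !(innerC qP x) (innerDl qP). Qed.
Lemma innerZr c x z : q x (c *: z) = c * q x z.
Proof. by rewrite !(innerC qP x) (innerZl qP). Qed.
Lemma inner0l x : q 0 x = 0.
Proof. by rewrite -(scale0r (0 : V)) (innerZl qP) mul0r. Qed.
Lemma inner0r x : q x 0 = 0.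
Proof. by rewrite (innerC qP) inner0l. Qed.
Lemma innerNl x z : q (- x) z = - q x z.
Proof. by rewrite -scaleN1r (innerZl qP) mulN1r. Qed.
Lemma innerBl x y z : q (x - y) z = q x z - q y z.
Proof. by rewrite (innerDl qP) innerNl. Qed.
Lemma inner_suml (I : Type) (r : seq I) (P : pred I) (G : I -> V) y :
  q (\sum_(i <- r | P i) G i) y = \sum_(i <- r | P i) q (G i) y.
Proof.
elim/big_rec2: _ => [|i a b _ <-]; first exact: inner0l.
by rewrite (innerDl qP).
Qed.
Lemma inner_ge0 x : 0 <= q x x.
Proof.
by case: (eqVneq x 0) => [->|/eqP/(inner_gt0 qP)/ltW //]; rewrite inner0l.
Qed.
Lemma inner_eq0 x : q x x = 0 -> x = 0.
Proof.
move=> x0; apply/eqP; apply/negPn/negP => /eqP/(inner_gt0 qP).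
by rewrite x0 ltxx.
Qed.

(** The matrix of [f] on [U] has a complex eigenvalue [a + ib]; the real and
    imaginary parts [u], [v] of an eigenvector satisfy
    [b (<u, u> + <v, v>) = 0] because [f] is symmetric. *)
Lemma symmetric_eigenvector f (U : {vspace V}) :
  symmetric_for f -> U <> 0%VS -> stable_under f U ->
  exists c x, [/\ x \in U, x <> 0 & f x = c *: x].
Proof.
move=> fS /eqP U0 /stable_mx[A fA].
have dU : (0 < \dim U)%N by rewrite lt0n dimv_eq0.
have [[a b] /eigenvalueP[w wA w0]] :=
  eigenvalue_closed (map_mx (real_complex R) A) dU.
pose ur := map_mx (@complex.Re R) w; pose vr := map_mx (@complex.Im R) w.
have wE i : w 0 i = (ur 0 i +i* vr 0 i)%C by rewrite !mxE; case: (w 0 i).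
have eA i : (((ur *m A) 0 i) +i* ((vr *m A) 0 i))%C
          = ((a +i* b) * (ur 0 i +i* vr 0 i))%C.
  rewrite -wE; have := congr1 (fun M : 'rV_(\dim U) => M 0 i) wA.
  rewrite /= [in RHS]mxE => <-; rewrite [RHS]mxE (mxE _ _ 0 i) [X in (_ +i* X)%C]mxE.
  rewrite (eq_bigr (fun j => (ur 0 j * A j i)%:C%C + 'i%C * (vr 0 j * A j i)%:C%C)).
    rewrite big_split /= -mulr_sumr -!rmorph_sum /=.
    by apply/eqP; rewrite eq_complex /= !(mul0r, mul1r, addr0, add0r, subr0) !eqxx.
  move=> j _; rewrite wE !mxE; apply/eqP; rewrite eq_complex /=.
  by rewrite !(mul0r, mulr0, mul1r, addr0, add0r, subr0) !eqxx.
pose u := \sum_i ur 0 i *: (vbasis U)`_i.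
pose v := \sum_i vr 0 i *: (vbasis U)`_i.
have memb (z : 'rV[R]_(\dim U)) : \sum_i z 0 i *: (vbasis U)`_i \in U.
  by rewrite rpred_sum // => i _; rewrite rpredZ // vbasis_mem // mem_nth // size_tuple.
have fu : f u = a *: u - b *: v.
  rewrite fA /u /v !scaler_sumr -sumrB; apply: eq_bigr => i _.
  by case: (eA i) => -> _; rewrite scalerBl !scalerA.
have fv : f v = a *: v + b *: u.
  rewrite fA /u /v !scaler_sumr -big_split; apply: eq_bigr => i _ /=.
  by case: (eA i) => _ ->; rewrite scalerDl !scalerA.
have uv0 : ~ (u = 0 /\ v = 0).
  case=> /vbasis_comb_eq0 u0 /vbasis_comb_eq0 v0.
  case/eqP: w0; apply/rowP => i; rewrite wE u0 v0 !mxE.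
  by apply/eqP; rewrite eq_complex /= !eqxx.
have b0 : b = 0.
  have := fS u v; rewrite fu fv (innerDl qP) innerDr innerNl !(innerZl qP) !innerZr.
  have := inner_ge0 u; have := inner_ge0 v => v_ge0 u_ge0 e.
  have /eqP : b * (q u u + q v v) = 0 by lra.
  rewrite mulf_eq0 => /orP[/eqP //|/eqP s0].
  by case: uv0; split; apply: inner_eq0; lra.
rewrite b0 !scale0r subr0 addr0 in fu fv.
case: (pselect (u = 0)) => [u0|u0]; last by exists a, u; split=> //; apply: memb.
by exists a, v; split=> // [|v0]; [apply: memb | apply: uv0].
Qed.

(** The image [f @: W] is stable. If it is not zero it contains an eigenvector
    [f y], whose eigenvalue is zero, and then [<f y, f y> = <y, f (f y)> = 0]. *)
Lemma symmetric_eq0 f (W : {vspace V}) :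
    symmetric_for f -> stable_under f W ->
    (forall c x, x \in W -> x <> 0 -> f x = c *: x -> c = 0) ->
  forall x, x \in W -> f x = 0.
Proof.
move=> fS fW noeig x xW; apply/eqP/negPn/negP=> /eqP fx0.
have [||c [_ [/memv_imgP[y yW ->] fy0 ffy]]] :=
    symmetric_eigenvector (U := (f @: W)%VS) fS.
- by apply/vspace_neq0P; exists (f x) => //; apply: memv_img.
- by move=> _ /memv_imgP[y yW ->]; apply: memv_img; apply: fW.
case: (fy0); apply: inner_eq0.
have -> : q (f y) (f y) = q y (f (f y)) by apply: fS.
by rewrite ffy (noeig c (f y)) ?scale0r ?inner0r //; exact: fW.
Qed.

(** Gram-Schmidt on a list of generators. *)
Lemma orthogonal_projection (E : {vspace V}) x :
  exists2 e, e \in E & forall e', e' \in E -> q (x - e) e' = 0.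
Proof.
suff H (X : seq V) y : exists2 e, e \in <<X>>%VS &
    forall e', e' \in <<X>>%VS -> q (y - e) e' = 0.
  have := H (vbasis E) x; rewrite -[X in <<X>>%VS]/(val (vbasis E)).
  by have /andP[/eqP-> _] := vbasisP E.
elim: X y => [|v X IH] y.
  exists 0; rewrite ?mem0v // => e'; rewrite span_nil memv0 => /eqP ->.
  exact: inner0r.
have [e1 e1X e1P] := IH y; have [e2 e2X e2P] := IH v.
pose v1 := v - e2.
have v1X : v1 \in (<[v]> + <<X>>)%VS.
  by rewrite memv_add ?memv_line ?memvN.
have spanE e' : e' \in (<[v]> + <<X>>)%VS ->
    exists a, exists2 w, w \in <<X>>%VS & e' = a *: v1 + w.
  move=> /memv_addP[_ /vlineP[a ->] [w wX ->]].
  exists a, (a *: e2 + w); first by rewrite memvD ?memvZ.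
  by rewrite scalerBr addrA subrK.
have v1P w : w \in <<X>>%VS -> q v1 w = 0 by apply: e2P.
clearbody v1; rewrite span_cons.
exists (e1 + (q (y - e1) v1 / q v1 v1) *: v1).
  by rewrite memvD ?memvZ //; apply: (subvP (addvSr _ _)).
move=> _ /spanE[a [w wX ->]].
rewrite opprD addrA innerBl !innerDr !innerZr !(innerZl qP).
rewrite (e1P w wX) (v1P w wX).
case: (eqVneq v1 0) => [->|v10]; first by rewrite !inner0l !inner0r; lra.
have: q v1 v1 != 0 by apply: contra_neq v10; exact: inner_eq0.
by move=> h; field.
Qed.

(** The orthogonal complement of [E] is stable, so it would contain an
    eigenvector if it were not zero. *)
Lemma symmetric_eigenvectors_span f (E : {vspace V}) :
    symmetric_for f -> stable_under f E ->
    (forall c x, f x = c *: x -> x \in E) -> E = fullv.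
Proof.
move=> fS fE eigE.
have [P PE] : exists P : {vspace V},
    forall x, x \in P <-> (forall e, e \in E -> q x e = 0).
  apply: vspace_of_pred => [e _|c x y xP yP e eE]; first exact: inner0l.
  by rewrite (innerDl qP) (innerZl qP) xP // yP // mulr0 addr0.
have P0 : P = 0%VS.
  apply/eqP/negPn/negP => /eqP P0.
  have [|c [x [xP x0 fx]]] := symmetric_eigenvector fS P0.
    by move=> x /PE xP; apply/PE => e eE; rewrite fS; apply: xP; apply: fE.
  by apply: x0; apply: inner_eq0; apply: (PE x).1 => //; apply: eigE fx.
apply/vspaceP=> x; rewrite memvf.
have [e eE eP] := orthogonal_projection E x.
have : x - e \in P by apply/PE.
by rewrite P0 memv0 subr_eq0 => /eqP ->.
Qed.

End InnerProduct.

(** * Killing form, ideals and weights *)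

Definition lfunSE :=
  (comp_lfunE, scale_lfunE, opp_lfunE, add_lfunE, sum_lfunE, id_lfunE).

Section LieBasics.
Variables (F : fieldType) (g : lieAlgType F).
Implicit Types (x y z : g) (U V W : {vspace g}).

Lemma lieDr x y z : lie x (y + z) = lie x y + lie x z.
Proof. exact: linearD. Qed.
Lemma lieZr c x y : lie x (c *: y) = c *: lie x y.
Proof. exact: linearZ. Qed.
Lemma lieNr x y : lie x (- y) = - lie x y.
Proof. exact: linearN. Qed.
Lemma lieBr x y z : lie x (y - z) = lie x y - lie x z.
Proof. exact: linearB. Qed.
Lemma lie0r x : lie x 0 = 0. Proof. exact: linear0. Qed.
Lemma lie0l x : lie 0 x = 0. Proof. by rewrite lieC lie0r oppr0. Qed.

(** The Jacobi identity, as a derivation rule. *)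
Lemma lie_der x y z : lie x (lie y z) = lie (lie x y) z + lie y (lie x z).
Proof.
have := lie_jacobi x y z; rewrite (lieC z x) lieNr (lieC z (lie x y)).
by move=> /eqP; rewrite subr_eq0 subr_eq => /eqP.
Qed.

Lemma ad_lie x y : ad (lie x y) = ((ad x \o ad y) - (ad y \o ad x))%VF.
Proof.
apply/lfunP=> z; rewrite !lfunSE !adE.
rewrite (lie_der x y z).
by rewrite addrK.
Qed.

Lemma adD x y : ad (x + y) = ad x + ad y.
Proof. by apply/lfunP=> z; rewrite !lfunSE !adE lieDl. Qed.
Lemma adZ c x : ad (c *: x) = c *: ad x.
Proof. by apply/lfunP=> z; rewrite !lfunSE !adE lieZl. Qed.

End LieBasics.

Section Trace.
Variables (F : fieldType) (V : vectType F).
Implicit Types f h : 'End(V).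

Lemma lfun_traceD f h : lfun_trace (f + h) = lfun_trace f + lfun_trace h.
Proof. by rewrite /lfun_trace linearD /= mxtraceD. Qed.
Lemma lfun_traceZ c f : lfun_trace (c *: f) = c * lfun_trace f.
Proof. by rewrite /lfun_trace linearZ /= mxtraceZ. Qed.
Lemma lfun_traceN f : lfun_trace (- f) = - lfun_trace f.
Proof. by rewrite -scaleN1r lfun_traceZ mulN1r. Qed.
Lemma lfun_trace_comp f h : lfun_trace (f \o h)%VF = lfun_trace (h \o f)%VF.
Proof.
by rewrite /lfun_trace !(mxof_comp _ _ (vbasisP _)) mxtrace_mulC.
Qed.

End Trace.

Section Killing.
Variables (F : fieldType) (g : lieAlgType F).
Implicit Types (x y z : g) (f : 'End(g)).

Lemma killingC x y : killing x y = killing y x.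
Proof. exact: lfun_trace_comp. Qed.
Lemma killingDl x y z : killing (x + y) z = killing x z + killing y z.
Proof. by rewrite /killing adD comp_lfunDl lfun_traceD. Qed.
Lemma killingZl c x z : killing (c *: x) z = c * killing x z.
Proof. by rewrite /killing adZ -comp_lfunZl lfun_traceZ. Qed.
Lemma killingDr x y z : killing x (y + z) = killing x y + killing x z.
Proof. by rewrite !(killingC x) killingDl. Qed.
Lemma killingNl x z : killing (- x) z = - killing x z.
Proof. by rewrite -scaleN1r killingZl mulN1r. Qed.
Lemma killingNr x z : killing x (- z) = - killing x z.
Proof. by rewrite !(killingC x) killingNl. Qed.
Lemma killing0l x : killing 0 x = 0.
Proof. by rewrite -(scale0r (0 : g)) killingZl mul0r. Qed.

Lemma killing_lie x y z : killing (lie x y) z = killing x (lie y z).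
Proof.
rewrite /killing !ad_lie comp_lfunDl comp_lfunDr !lfun_traceD; congr (_ + _).
  by rewrite comp_lfunA.
rewrite comp_lfunNl comp_lfunNr !lfun_traceN; congr (- _).
by rewrite comp_lfunA [RHS]lfun_trace_comp comp_lfunA.
Qed.

Lemma lie_autM f : lie_aut f -> forall x y, f (lie x y) = lie (f x) (f y).
Proof. by case=> _ fM x y; apply: fM; rewrite memvf. Qed.

Lemma lie_aut_lker f : lie_aut f -> lker f == 0%VS.
Proof.
case=> fi _; rewrite -dimv_eq0; have := limg_ker_dim f fullv.
by rewrite capfv fi => /eqP; rewrite -[X in _ == X]add0n eqn_add2r.
Qed.

Lemma killing_aut f x y : lie_aut f -> killing (f x) (f y) = killing x y.
Proof.
move=> fA; have f0 := lie_aut_lker fA.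
have adf z : ad (f z) = (f \o ad z \o f^-1)%VF.
  apply/lfunP=> w; rewrite !lfunSE !adE (lie_autM fA) ?lker0_lfunVK //.
rewrite /killing !adf -!comp_lfunA lfun_trace_comp lker0_compKf //.
by rewrite -!comp_lfunA lker0_compVf // comp_lfun1r.
Qed.

End Killing.

Section Ideals.
Variables (F : fieldType) (g : lieAlgType F).

(** The smallest subspace [I] that contains [V] and is stable under [q] is an
    ideal: the [x] of [I] with [[g, x] <= I] form such a subspace. Typically [n]
    and [q] are the positive and nonpositive parts of a gradation, and [V] lies
    in the top degree. *)
Lemma simple_top_generates (q n V P : {vspace g}) :
    lie_simple g -> (q + n)%VS = fullv -> V <> 0%VS -> (V <= P)%VS ->
    (forall y x, y \in n -> x \in V -> lie y x = 0) ->
    (forall y x, y \in q -> x \in P -> lie y x \in P) ->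
  P = fullv.
Proof.
move=> [_ simple] qn V0 VP nV qP.
pose good (S : {vspace g}) :=
  (V <= S)%VS /\ forall y x, y \in q -> x \in S -> lie y x \in S.
have [I IE] : exists I : {vspace g},
    forall x, x \in I <-> forall S, good S -> x \in S.
  apply: vspace_of_pred => [S _|c x y xS yS S gS]; first exact: mem0v.
  by rewrite memvD ?memvZ ?xS ?yS.
have VI : (V <= I)%VS by apply/subvP=> x xV; apply/IE=> S [/subvP VS _]; apply: VS.
have qI y x : y \in q -> x \in I -> lie y x \in I.
  by move=> yq /IE xI; apply/IE=> S gS; apply: gS.2 => //; apply: xI.
have [Q QE] : exists Q : {vspace g},
    forall x, x \in Q <-> x \in I /\ forall y, lie y x \in I.
  apply: vspace_of_pred => [|c x y [xI gx] [yI gy]].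
    by split=> [|y]; rewrite ?lie0r mem0v.
  split=> [|z]; first by rewrite memvD ?memvZ.
  by rewrite lieDr lieZr memvD ?memvZ.
have idI : lie_ideal I.
  have goodQ : good Q.
    split.
      apply/subvP=> x xV; apply/QE; split=> [|y]; first exact: (subvP VI).
      have /memv_addP[y1 y1q [y2 y2n ->]] : y \in (q + n)%VS by rewrite qn memvf.
      by rewrite lieDl (nV y2) // addr0 qI // (subvP VI).
    move=> y x yq /QE[xI gx]; apply/QE; split=> [|z]; first exact: qI.
    by rewrite lie_der memvD // qI.
  by move=> y x /IE/(_ Q goodQ)/QE[].
have IP : (I <= P)%VS by apply/subvP=> x /IE; apply.
case: (simple I idI) => I1; last by apply/eqP; rewrite eqEsubv subvf -I1.
by case: V0; apply/eqP; rewrite -subv0 -I1.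
Qed.

Lemma simple_center0 (x : g) : lie_simple g -> (forall y, lie x y = 0) -> x = 0.
Proof.
move=> [nab simple] xC.
have idx : lie_ideal <[x]>%VS.
  by move=> y _ /vlineP[c ->]; rewrite lieZr lieC xC oppr0 scaler0 mem0v.
case: (simple _ idx) => [x0|xf].
  by apply/eqP; rewrite -memv0 -x0 memv_line.
case: nab => y z _ _; have : y \in <[x]>%VS by rewrite xf memvf.
by move=> /vlineP[c ->]; rewrite lieZl xC scaler0.
Qed.

End Ideals.

Section Weights.
Variables (F : fieldType) (g : lieAlgType F) (a : {vspace g}).
Implicit Types (mu nu : vdual a) (x y : g) (H : subvs_of a).

Definition weight_vector mu x := forall H, lie (vsval H) x = (mu H : F) *: x.

Lemma weight_vector_lie mu nu x y :
  weight_vector mu x -> weight_vector nu y -> weight_vector (mu + nu) (lie x y).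
Proof.
move=> xmu ynu H; rewrite lie_der xmu ynu lieZl lieZr -scalerDl.
by rewrite lfun_simp.
Qed.

Lemma weight_vector_root mu x : mu <> 0 -> x <> 0 -> weight_vector mu x ->
  lie_root mu.
Proof. by move=> mu0 x0 xmu; split=> //; exists x. Qed.

(** The eigenvalues of a common eigenvector [x] depend linearly on the operator:
    they are read off with a linear form that takes the value 1 at [x]. *)
Lemma weight_exists (W : {vspace g}) :
    abelian_vs a -> W <> 0%VS ->
    (forall h x, h \in a -> x \in W -> lie h x \in W) ->
    (forall h, h \in a -> forall U, (U <= W)%VS -> U <> 0%VS ->
      stable_under (ad h) U -> exists c x, [/\ x \in U, x <> 0 & ad h x = c *: x]) ->
  exists mu x, [/\ x \in W, x <> 0 & weight_vector mu x].
Proof.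
move=> aab W0 aW eig.
have vba h : h \in (vbasis a : seq g) -> h \in a by apply: vbasis_mem.
have [_ /mapP[h /vba ha ->]|_ _ /mapP[h /vba ha ->] /mapP[k /vba ka ->] x|
      _ /mapP[h /vba ha ->]|x [xW x0 xeig]] :=
    common_eigenvector_seq (s := [seq ad h | h <- vbasis a]) W0.
- by move=> x xW; rewrite adE; apply: aW.
- by rewrite !adE lie_der (aab h k) // lie0l add0r.
- exact: eig.
have [S SE] : exists S : {vspace g}, forall h, h \in S <-> exists c, lie h x = c *: x.
  apply: vspace_of_pred => [|c h k [d hx] [e kx]].
    by exists 0; rewrite lie0l scale0r.
  by exists (c * d + e); rewrite lieDl lieZl hx kx scalerA -scalerDl.
have aS : (a <= S)%VS.
  have /andP[/eqP <- _] := vbasisP a; apply/span_subvP=> h hb; apply/SE.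
  by have [|c] := xeig (ad h); [apply: map_f | rewrite adE; exists c].
have [phi phi1] := dual_vector x0.
exists (phi \o (- ad x) \o linfun vsval)%VF, x; split=> // H.
rewrite !lfunSE (lfunE vsval) adE -lieC.
have /SE[c ->] := subvP aS _ (subvsP H).
by rewrite linearZ /= phi1; congr (_ *: _); apply/esym/mulr1.
Qed.

End Weights.

(** * Complexification *)

Section Complexification.
Variables (R : rcfType) (g : lieAlgType R).
Local Notation gC := (complexify g).
Implicit Types (x y u : g) (z w : gC).

Lemma complexify_eqP z w : z.1 = w.1 -> z.2 = w.2 -> z = w.
Proof. by case: z w => [x y] [u v] /= -> ->. Qed.

Lemma complexifyD z w : z + w = (z.1 + w.1, z.2 + w.2) :> gC.
Proof. by []. Qed.

Lemma complexifyN z : - z = (- z.1, - z.2) :> gC.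
Proof. by []. Qed.

Lemma complexify_lieE z w :
  lie z w = (lie z.1 w.1 - lie z.2 w.2, lie z.1 w.2 + lie z.2 w.1) :> gC.
Proof. by []. Qed.

Lemma complexify_scaleE (c : R[i]) z :
  c *: z = (complex.Re c *: z.1 - complex.Im c *: z.2,
            complex.Re c *: z.2 + complex.Im c *: z.1) :> gC.
Proof. by []. Qed.

Lemma creal_lieE x z : lie (creal x) z = (lie x z.1, lie x z.2) :> gC.
Proof. by rewrite complexify_lieE /= !lie0l subr0 addr0. Qed.

Lemma complexify_realscaleE (c : R) z : c%:C%C *: z = (c *: z.1, c *: z.2) :> gC.
Proof. by rewrite complexify_scaleE /= !scale0r subr0 addr0. Qed.

Lemma complexify_intscaleE (p : int) z :
  p%:~R *: z = (p%:~R *: z.1, p%:~R *: z.2) :> gC.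
Proof. by rewrite -complexify_realscaleE rmorph_int. Qed.

Lemma complexify_iscaleE z : 'i%C *: z = (- z.2, z.1) :> gC.
Proof. by rewrite complexify_scaleE /= !scale0r !scale1r sub0r add0r. Qed.

Lemma complexifyE z : z = creal z.1 + 'i%C *: creal z.2 :> gC.
Proof.
by rewrite complexify_iscaleE complexifyD /= oppr0 addr0 add0r; case: z.
Qed.

Lemma crealD x y : creal (x + y) = creal x + creal y :> gC.
Proof. by rewrite complexifyD /= addr0. Qed.
Lemma crealZ c x : creal (c *: x) = c%:C%C *: creal x :> gC.
Proof. by rewrite complexify_realscaleE /= scaler0. Qed.
Lemma creal_lie x y : creal (lie x y) = lie (creal x) (creal y) :> gC.
Proof. by rewrite creal_lieE /= lie0r. Qed.

Definition cconj z : gC := (z.1, - z.2).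

Lemma cconj_lie z w : cconj (lie z w) = lie (cconj z) (cconj w).
Proof.
rewrite /cconj !complexify_lieE /= !(lieNl, lieNr) opprK opprD.
by [].
Qed.
Lemma cconjZ (c : R[i]) z : cconj (c *: z) = (c^*)%C *: cconj z.
Proof.
case: c => c d; rewrite /cconj !complexify_scaleE /= !scaleNr scalerN opprK.
by rewrite opprD scalerN.
Qed.
Lemma cconjK z : cconj (cconj z) = z.
Proof. by case: z => x y; rewrite /cconj /= opprK. Qed.

Lemma creal_eigenP (x : g) (p : int) z :
  reflect (lie x z.1 = p%:~R *: z.1 /\ lie x z.2 = p%:~R *: z.2)
          (z \in leigenspace (ad (creal x)) p%:~R).
Proof.
apply: (iffP (leigenspaceP _ _ _)); rewrite adE creal_lieE complexify_intscaleE.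
  by case.
by move=> [-> ->].
Qed.

End Complexification.

(** * Exponentials of infinitesimal rotations *)

Section LinearFunction.
Variables (F : fieldType) (U V : vectType F).

Lemma linear_linfun (f : U -> V) : linear f -> linfun f =1 f.
Proof.
move=> lf x.
pose ff : {linear U -> V} := HB.pack f (GRing.isLinear.Build F U V _ f lf).
exact: (lfunE ff).
Qed.

End LinearFunction.

Section Exponential.
Variables (R : realType) (V : vectType R).
Implicit Types (f : 'End(V)) (u v w : V).
Local Open Scope classical_set_scope.

Definition exp_cvg f u w := forall i : 'I_(\dim {:V}),
  (coord (vbasis {:V}) i (exp_psum f u n) : R) @[n --> \oo] -->
  (coord (vbasis {:V}) i w : R).

Lemma exp_cvg_fun f u w : exp_cvg f u w -> exp_fun f u = w.
Proof.
move=> fw; rewrite [RHS](coord_vbasis (memvf w)).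
by apply: eq_bigr => i _; rewrite (cvg_lim _ (fw i)).
Qed.

Lemma exp_psumP f c u v n :
  exp_psum f (c *: u + v) n = c *: exp_psum f u n + exp_psum f v n.
Proof.
rewrite /exp_psum scaler_sumr -big_split; apply: eq_bigr => k _ /=.
rewrite scalerA mulrC -scalerA -scalerDr; congr (_ *: _).
by elim: (k : nat) => //= m ->; rewrite linearP.
Qed.

Lemma exp_cvgP f c u v w z :
  exp_cvg f u w -> exp_cvg f v z -> exp_cvg f (c *: u + v) (c *: w + z).
Proof.
move=> uw vz i; rewrite linearP /=.
under eq_fun => n do rewrite exp_psumP linearP /=.
by apply: cvgD; [apply: cvgMl_tmp; apply: uw | apply: vz].
Qed.

Lemma exp_cvg0 f : exp_cvg f 0 0.
Proof.
move=> i; rewrite linear0; under eq_fun => n.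
  rewrite /exp_psum big1 ?linear0; last first.
    move=> k _; suff -> : iter k f 0 = 0 by rewrite scaler0.
    by elim: (k : nat) => //= m ->; rewrite linear0.
  over.
exact: cvg_cst.
Qed.

(** Convergence everywhere makes the sum of the series linear, so that its
    values are those of the endomorphism [exp_lfun f]. *)
Lemma exp_lfun_cvg f u w : (forall u, exists w, exp_cvg f u w) ->
  exp_cvg f u w -> exp_lfun f u = w.
Proof.
move=> fcvg uw; rewrite /exp_lfun linear_linfun; first exact: exp_cvg_fun.
move=> c x y; have [wx xP] := fcvg x; have [wy yP] := fcvg y.
by rewrite (exp_cvg_fun xP) (exp_cvg_fun yP); apply/exp_cvg_fun/exp_cvgP.
Qed.

Lemma iter_rotation f u v t k : f u = t *: v -> f v = - t *: u ->
  iter k f u = ((~~ odd k)%:R * (-1) ^+ k./2 * t ^+ k) *: u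
             + ((odd k)%:R * (-1) ^+ k.-1./2 * t ^+ k) *: v.
Proof.
move=> fu fv; elim: k => [|k IH] /=.
  by rewrite !expr0 !mulr1 mulr1n mulr0n scale1r scale0r addr0.
rewrite IH linearD !linearZ /= fu fv !scalerA addrC negbK; congr (_ *: _ + _ *: _).
  case: k {IH} => [|k] /=; first by rewrite !(mulr0n, mul0r).
  by case: (odd k) => /=; rewrite !(mulr0n, mulr1n, mul0r, mul1r) // !exprS; ring.
by case: (odd k) => /=; rewrite !(mulr0n, mulr1n, mul0r, mul1r) // !exprS; ring.
Qed.

(** In the plane of [u] and [v] the exponential series separates into the cosine
    and sine series of [t]. *)
Lemma exp_cvg_rotation f u v t : f u = t *: v -> f v = - t *: u ->
  exp_cvg f u (cos t *: u + sin t *: v).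
Proof.
move=> fu fv i.
have psE n : exp_psum f u n = series (cos_coeff t) n *: u + series (sin_coeff t) n *: v.
  rewrite !seriesEord /exp_psum !scaler_suml -big_split; apply: eq_bigr => k _ /=.
  rewrite (iter_rotation k fu fv) scalerDr !scalerA /cos_coeff /sin_coeff /=.
  by congr (_ *: _ + _ *: _); rewrite mulrC.
under eq_fun => n do rewrite psE linearD !linearZ /=.
rewrite linearD !linearZ /=.
apply: cvgD; apply: cvgMr_tmp; rewrite unlock;
  [exact: is_cvg_series_cos_coeff | exact: is_cvg_series_sin_coeff].
Qed.

End Exponential.

Section QuarterTurn.
Variables (R : realType) (g : lieAlgType R).
Local Notation gC := (complexify g).
Local Notation gCR := (realify (complexify g)).
Implicit Types (Z x : gC).

Lemma rscaleE (c : R) (x : gCR) : c *: x = c%:C%C *: (x : gC) :> gC.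
Proof. by []. Qed.

Lemma cos_sin_quarter (p : int) :
  (cos (pi / 2 * p%:~R : R))%:C%C + 'i%C * (sin (pi / 2 * p%:~R : R))%:C%C = 'i%C ^ p.
Proof.
have step (q : int) : 
  (cos (pi / 2 * (q + 1)%:~R : R))%:C%C + 'i%C * (sin (pi / 2 * (q + 1)%:~R : R))%:C%C
  = 'i%C * ((cos (pi / 2 * q%:~R : R))%:C%C + 'i%C * (sin (pi / 2 * q%:~R : R))%:C%C).
  rewrite intrD mulrDr mulr1 cosD sinD cos_pihalf sin_pihalf !mulr0 !mulr1 ?add0r ?addr0.
  by rewrite mulrDr mulrA -expr2 sqr_i rmorphN /= mulN1r addrC.
have i0 : 'i%C \is a @GRing.unit R[i] by rewrite unitfE neq0Ci.
elim: p => [|n IH|n IH].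
- by rewrite mulr0 cos0 sin0 mulr0 addr0.
- have -> : n.+1%:Z = n%:Z + 1 by lia.
  by rewrite step IH exprzDr // expr1z mulrC.
apply: (mulrI i0); rewrite -step.
have -> : - n.+1%:Z + 1 = - n%:Z by lia.
rewrite IH; have -> : - n%:Z = 1 + - n.+1%:Z by lia.
by rewrite exprzDr // expr1z.
Qed.

(** On an eigenvector [x] of [ad Z], the operator [ad (pi / 2 i Z)] rotates the
    real plane of [x] and [i x] by the angle [pi / 2 * p]. *)
Lemma half_pi_cvg Z x (p : int) : lie Z x = p%:~R *: x ->
  exp_cvg (ad (half_pi_i Z)) (x : gCR) ('i%C ^ p *: x : gC).
Proof.
move=> Zx.
have adE' (y : gC) : ad (half_pi_i Z) y = ((pi / 2 : R)%:C%C * 'i%C) *: lie Z y :> gC.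
  by rewrite adE -lieZl.
have tE : (pi / 2 * p%:~R : R)%:C%C = (pi / 2)%:C%C * p%:~R.
  by rewrite [LHS](rmorphM (real_complex R)) /= rmorph_int.
rewrite -cos_sin_quarter.
have -> : ((cos (pi / 2 * p%:~R))%:C%C + 'i%C * (sin (pi / 2 * p%:~R))%:C%C) *: x
   = (cos (pi / 2 * p%:~R) *: (x : gCR) + sin (pi / 2 * p%:~R) *: ('i%C *: x : gCR)) :> gC.
  by rewrite scalerDl (mulrC 'i%C) -scalerA !rscaleE.
apply: exp_cvg_rotation.
  rewrite adE' Zx rscaleE !scalerA.
  apply: (congr1 (fun c => c *: x)).
  by rewrite tE; ring.
rewrite adE' lieZr Zx rscaleE !scalerA.
apply: (congr1 (fun c => c *: x)).
rewrite rmorphN /= tE.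
transitivity ('i%C ^+ 2 * ((pi / 2 : R)%:C%C * p%:~R)); first by ring.
by rewrite sqr_i mulN1r.
Qed.

(** The exponential series converges everywhere because it does on eigenvectors,
    which span. *)
Lemma Ad_exp_half_pi Z x (p : int) (m : nat) :
  (\sum_(k < m.*2.+1) leigenspace (ad Z) (k%:Z - m%:Z)%:~R)%VS = fullv ->
  lie Z x = p%:~R *: x ->
  Ad_exp (half_pi_i Z) (x : gCR) = 'i%C ^ p *: x :> gC.
Proof.
move=> full Zx; apply: exp_lfun_cvg (half_pi_cvg Zx) => y.
have /memv_sumP[z zP ->] : (y : gC) \in
    (\sum_(k < m.*2.+1) leigenspace (ad Z) (k%:Z - m%:Z)%:~R)%VS.
  by rewrite full memvf.
elim/big_ind: _ => [|u v [u' uP] [v' vP]|k _].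
- by exists 0; apply: exp_cvg0.
- by exists (1 *: u' + v'); rewrite -[u + v]/((u : gCR) + v) -[u : gCR]scale1r; apply: exp_cvgP.
have /leigenspaceP := zP k isT; rewrite adE => /half_pi_cvg zk.
by exists ('i%C ^ (k%:Z - m%:Z) *: z k).
Qed.

End QuarterTurn.

(** * Quarter turns of graded complex Lie algebras *)

Lemma eigenvectors_independent (F : fieldType) (V : vectType F) (f : 'End(V))
    (I : finType) (d : I -> F) (v : I -> V) : injective d ->
  (forall k, f (v k) = d k *: v k) -> \sum_k v k = 0 -> forall k, v k = 0.
Proof.
move=> dinj fv v0 k; apply/eqP; rewrite -oppr_eq0.
have e : - v k = \sum_(j | j != k) v j.
  by apply/eqP; rewrite eq_sym -addr_eq0 addrC -[X in _ == X]v0 [X in _ == X](bigD1 k).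
rewrite e; apply/eqP.
apply: (@eigenvectors_separate _ _ f _ _ (fun j => j != k) d v (d k)) => //.
  by move=> j; apply: contra => /eqP/dinj ->.
by rewrite -e linearN /= fv scalerN.
Qed.

Lemma exprz_i4 (R : rcfType) (p : int) : ('i%C ^ p) ^+ 4 = 1 :> R[i].
Proof.
have i4 : 'i%C ^+ 4 = 1 :> R[i] by rewrite (exprM _ 2 2) sqr_i sqrrN expr1n.
by rewrite -[LHS]/(('i%C ^ p) ^ 4%:Z) exprzAC [X in X ^ p]i4 exp1rz.
Qed.

Lemma exprz_i_conj (R : rcfType) (p : int) : (('i%C ^ p)^*)%C = 'i%C ^ (- p) :> R[i].
Proof.
have ci : ('i%C^*)%C = ('i%C)^-1 :> R[i].
  apply: (mulfI (x := 'i%C)); first exact: neq0Ci.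
  rewrite mulfV ?neq0Ci //; apply/eqP; rewrite eq_complex /=.
  by rewrite !(mul0r, mulr0, mul1r, mulr1, sub0r, opprK, addr0) !eqxx.
by rewrite (rmorphXz (@conjc R)) ?unitfE ?neq0Ci // [X in X ^ p]ci exprz_inv.
Qed.

Section GradedQuarterTurn.
Variables (R : realType) (g : lieAlgType R) (Z : complexify g).
Local Notation gC := (complexify g).
Local Notation gCR := (realify (complexify g)).
Local Notation EC p := (leigenspace (ad Z) p%:~R).
Hypothesis gradedP : (\sum_(k < 7) EC (k%:Z - 3))%VS = fullv.
Local Notation sigma := (Ad_exp (half_pi_i Z)).
Implicit Types X Y : gC.

Lemma graded_span X : exists e : 'I_7 -> gC,
  (forall k, e k \in EC (k%:Z - 3)) /\ X = \sum_k e k.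
Proof.
have /memv_sumP[e eE ->] : X \in (\sum_(k < 7) EC (k%:Z - 3))%VS.
  by rewrite gradedP memvf.
by exists e; split=> // k; apply: eE.
Qed.

Lemma graded_lie (p r : int) X Y : X \in EC p -> Y \in EC r -> lie X Y \in EC (p + r).
Proof.
move=> /leigenspaceP Xp /leigenspaceP Yr; rewrite !adE in Xp Yr.
by apply/leigenspaceP; rewrite adE lie_der Xp Yr lieZl lieZr -scalerDl intrD.
Qed.

Lemma quarter_turnE (p : int) X : X \in EC p -> sigma X = 'i%C ^ p *: X :> gC.
Proof. by move=> /leigenspaceP; rewrite adE; apply: (Ad_exp_half_pi (m := 3)). Qed.

(** Identities between additive functions need only be checked in each degree. *)
Lemma homogeneous_ind (P : gC -> Prop) : P 0 ->
  (forall X Y, P X -> P Y -> P (X + Y)) ->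
  (forall (p : int) X, X \in EC p -> P X) -> forall X, P X.
Proof.
move=> P0 PD PE X; have [e [eE ->]] := graded_span X.
by elim/big_ind: _ => // k _; apply: PE (eE k).
Qed.

Lemma quarter_turnD X Y : sigma (X + Y) = sigma X + sigma Y :> gC.
Proof. exact: (linearD sigma). Qed.

Lemma quarter_turnZ (c : R[i]) X : sigma (c *: X) = c *: (sigma X : gC) :> gC.
Proof.
elim/homogeneous_ind: X => [|X Y IX IY|p X XE].
- by rewrite scaler0 !(linear0 sigma) scaler0.
- by rewrite scalerDr !quarter_turnD scalerDr IX IY.
by rewrite !(quarter_turnE (p := p)) ?memvZ // !scalerA mulrC.
Qed.

Lemma quarter_turn_iter m p X : X \in EC p -> iter m sigma X = ('i%C ^ p) ^+ m *: X :> gC.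
Proof.
move=> XE; elim: m => [|k IH] /=; first by rewrite scale1r.
by rewrite IH (quarter_turnE (p := p)) ?memvZ // scalerA -exprS.
Qed.

Lemma quarter_turn4 X : sigma (sigma (sigma (sigma X))) = X.
Proof.
elim/homogeneous_ind: X => [|X Y IX IY|p X XE]; first by rewrite !linear0.
  by rewrite !quarter_turnD IX IY.
by rewrite [LHS](quarter_turn_iter 4 XE) exprz_i4 scale1r.
Qed.

Lemma quarter_turn_lker0 : lker sigma == 0%VS.
Proof. by apply/lker0P => X Y e; rewrite -[X]quarter_turn4 e quarter_turn4. Qed.

Lemma quarter_turn_lie X Y : sigma (lie X Y) = lie (sigma X : gC) (sigma Y : gC).
Proof.
elim/homogeneous_ind: X => [|X X' IX IX'|p X XE].
- by rewrite lie0l !(linear0 sigma) lie0l.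
- by rewrite lieDl !quarter_turnD IX IX' lieDl.
elim/homogeneous_ind: Y => [|Y Y' IY IY'|r Y YE].
- by rewrite lie0r !(linear0 sigma) lie0r.
- by rewrite lieDr !quarter_turnD IY IY' lieDr.
rewrite (quarter_turnE XE) (quarter_turnE YE) (quarter_turnE (graded_lie XE YE)).
by rewrite lieZl lieZr scalerA exprzDr // unitfE neq0Ci.
Qed.

Lemma degrees_disjoint p r X Y : p != r -> X \in EC p -> Y \in EC r -> X + Y = 0 -> X = 0.
Proof.
move=> pr XE YE /eqP; rewrite addr_eq0 => /eqP XY.
have : X \in EC r by rewrite XY memvN.
move=> /leigenspaceP; have /leigenspaceP -> := XE.
move=> /eqP; rewrite -subr_eq0 -scalerBl scaler_eq0.
by rewrite subr_eq0 eqr_int (negbTE pr) => /eqP.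
Qed.

(** The powers [i ^ p] with [-3 <= p <= 3] are 1 only for [p = 0]; this is where
    the bound 3 on the degrees enters. *)
Lemma quarter_turn_fixed X : X \in fixedSpace sigma <-> X \in EC 0.
Proof.
split=> [/fixedSpaceP|XE]; last by apply/fixedSpaceP; rewrite (quarter_turnE XE) expr0z scale1r.
have [e [eE ->]] := graded_span X.
have sumE (f : 'I_7 -> gC) : sigma (\sum_k f k) = \sum_k (sigma (f k) : gC) :> gC.
  by apply: (big_morph sigma quarter_turnD); apply: (linear0 sigma).
rewrite sumE => /eqP; rewrite -subr_eq0 -sumrB => /eqP s0.
suff e0 k : k != (Ordinal (isT : 3 < 7)%N) -> e k = 0.
  by rewrite (bigD1 (Ordinal (isT : 3 < 7)%N)) //= big1 // addr0; apply: eE.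
move=> k3.
have : ('i%C ^ (k%:Z - 3) - 1) *: e k = 0.
  pose v (j : 'I_7) := ('i%C ^ (j%:Z - 3) - 1) *: e j.
  apply: (@eigenvectors_independent _ _ (ad Z) _ (fun j : 'I_7 => (j%:Z - 3)%:~R) v).
  - by move=> j j' /eqP; rewrite eqr_int => /eqP jj; apply: val_inj => /=; lia.
  - by move=> j; apply/leigenspaceP; apply: memvZ; apply: eE.
  rewrite -[RHS]s0; apply: eq_bigr => j _.
  by rewrite (quarter_turnE (eE j)) /v scalerBl scale1r.
move/eqP; rewrite scaler_eq0 => /orP[|/eqP //]; rewrite subr_eq0.
have i0 : 'i%C \is a @GRing.unit R[i] by rewrite unitfE neq0Ci.
move=> /eqP e1; exfalso.
have : 'i%C ^ k%:Z = 'i%C ^ 3%:Z :> R[i] by rewrite -[k%:Z](subrK 3) exprzDr // e1 mul1r.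
have i2 := sqr_i R; have i3 : 'i%C ^+ 3 = - 'i%C :> R[i] by rewrite exprS i2 mulrN1.
have i4 : 'i%C ^+ 4 = 1 :> R[i] by have := exprz_i4 R 1; rewrite expr1z.
rewrite [RHS]i3 -exprnP.
case: k k3 {e1} => -[|[|[|[|[|[|[|//]]]]]]] k7 //= _.
- by move/eqP; rewrite expr0 eq_complex /= oppr0 oner_eq0.
- move/eqP; rewrite expr1 -subr_eq0 opprK -mulr2n -mulr_natl mulf_eq0 pnatr_eq0 /=.
  by rewrite (negbTE (neq0Ci _)).
- by move/eqP; rewrite i2 eq_complex /= oppr0 oppr_eq0 oner_eq0.
- by move/eqP; rewrite i4 eq_complex /= oppr0 oner_eq0.
- move/eqP; rewrite exprS i4 mulr1 -subr_eq0 opprK -mulr2n -mulr_natl mulf_eq0 pnatr_eq0 /=.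
  by rewrite (negbTE (neq0Ci _)).
by move/eqP; rewrite (exprD _ 4 2) i4 mul1r i2 eq_complex /= oppr0 oppr_eq0 oner_eq0.
Qed.

End GradedQuarterTurn.

(** * Restricted roots *)

Lemma finite_of_bounded (T : eqType) (P : T -> Prop) (N : nat) :
    (forall s : seq T, uniq s -> (forall x, x \in s -> P x) -> (size s <= N)%N) ->
  exists2 s : seq T, uniq s & forall x, x \in s <-> P x.
Proof.
move=> bound.
suff H k : forall s : seq T, (N - size s <= k)%N -> uniq s ->
    (forall x, x \in s -> P x) -> exists2 s : seq T, uniq s & forall x, x \in s <-> P x.
  by apply: (H _ [::]).
elim: k => [|k IH] s sk us sP;
  case: (pselect (forall x, P x -> x \in s)) => [Ps|]; try by exists s => // x; split; auto.
  move=> /existsNP[x /not_implyP[Px /negP xs]].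
  have := bound (x :: s); rewrite /= xs us => /(_ isT) => le.
  have {}le : (size s < N)%N by apply: le => y; rewrite inE => /predU1P[->|/sP].
  by move: sk; rewrite leqn0 subn_eq0 leqNgt le.
move=> /existsNP[x /not_implyP[Px /negP xs]].
apply: (IH (x :: s)); rewrite /= ?xs ?us //; last first.
  by move=> y; rewrite inE => /predU1P[->|/sP].
by lia.
Qed.

(** Otherwise [a + <[z]>] would be a larger abelian subspace of [P]. *)
Lemma maximal_abelianP (F : fieldType) (g : lieAlgType F) (P a : {vspace g}) z :
  maximal_abelian_in P a -> z \in P -> (forall h, h \in a -> lie h z = 0) -> z \in a.
Proof.
move=> [aP aab amax] zP za.
have : (a + <[z]>)%VS = a.
  apply: amax; first exact: addvSl.
    by rewrite subv_add aP -memvE.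
  move=> _ _ /memv_addP[u ua [_ /vlineP[c ->] ->]] /memv_addP[v va [_ /vlineP[d ->] ->]].
  rewrite !(lieDl, lieDr, lieZl, lieZr) liexx (aab u v) // za // (lieC z) za //.
  by rewrite oppr0 !scaler0 !addr0.
by move=> <-; rewrite (subvP (addvSr _ _)) ?memv_line.
Qed.

Section SubvsVal.
Variables (F : fieldType) (V : vectType F) (a : {vspace V}).

Lemma vsvalD (x y : subvs_of a) : vsval (x + y) = vsval x + vsval y.
Proof. exact: linearD. Qed.
Lemma vsvalB (x y : subvs_of a) : vsval (x - y) = vsval x - vsval y.
Proof. exact: linearB. Qed.
Lemma vsvalZ c (x : subvs_of a) : vsval (c *: x) = c *: vsval x.
Proof. exact: linearZ. Qed.
Lemma vsval_sum (I : finType) (G : I -> subvs_of a) :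
  vsval (\sum_i G i) = \sum_i vsval (G i).
Proof. exact: linear_sum. Qed.

End SubvsVal.

Section CartanInner.
Variables (R : realType) (gs : lieAlgType R) (tau : 'End(gs)).
Hypothesis tauP : cartan_involution tau.
Implicit Types (x y z : gs).

(** The inner product for which elements of [p] act by symmetric operators and
    elements of [k] by skew ones. *)
Definition cartan_form x y := - killing x (tau y).
Local Notation q := cartan_form.

Lemma cartan_lie x y : tau (lie x y) = lie (tau x) (tau y).
Proof. by case: tauP => /lie_autM. Qed.
Lemma cartanK x : tau (tau x) = x.
Proof. by case: tauP. Qed.

Lemma cartan_killing x y : killing (tau x) (tau y) = killing x y.
Proof. by apply: killing_aut; case: tauP. Qed.

Lemma cartan_formP : inner_product q.
Proof.
rewrite /q; split=> [x y z|c x z|x y|x x0].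
- by rewrite killingDl opprD.
- by rewrite killingZl mulrN.
- by rewrite killingC -cartan_killing cartanK.
- by case: tauP => _ _; apply.
Qed.
Let qP := cartan_formP.

Lemma cartan_form_adj x y z : q (lie x y) z = - q y (lie (tau x) z).
Proof.
rewrite /q cartan_lie cartanK -killing_lie (lieC x y).
by rewrite killingNl.
Qed.

Lemma cartan_pP x : reflect (tau x = - x) (x \in cartan_p tau).
Proof. by apply: (iffP (leigenspaceP _ _ _)) => ->; rewrite scaleN1r. Qed.
Lemma cartan_kP x : reflect (tau x = x) (x \in cartan_k tau).
Proof. exact: fixedSpaceP. Qed.

Lemma cartan_p_symmetric x : x \in cartan_p tau -> symmetric_for q (ad x).
Proof.
by move=> /cartan_pP xp y z; rewrite !adE cartan_form_adj xp lieNl (innerC qP) (innerNl qP)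
  opprK (innerC qP).
Qed.

Lemma cartan_k_skew x y z : x \in cartan_k tau -> q (lie x y) z = - q y (lie x z).
Proof. by move=> /cartan_kP xk; rewrite cartan_form_adj xk. Qed.

Section RestrictedRoots.
Variable (a : {vspace gs}).
Hypothesis aP : maximal_abelian_in (cartan_p tau) a.
Implicit Types (mu nu : vdual a) (H : subvs_of a).

Lemma restricted_p H : vsval H \in cartan_p tau.
Proof. by case: aP => /subvP ap _ _; apply/ap/subvsP. Qed.

Lemma restricted_form H x : q (vsval H) x = killing (vsval H) x.
Proof.
by rewrite /q -cartan_killing cartanK (cartan_pP _ (restricted_p H)) killingNl opprK.
Qed.

Lemma restricted_weight_exists (W : {vspace gs}) :
    W <> 0%VS -> (forall h x, h \in a -> x \in W -> lie h x \in W) ->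
  exists mu x, [/\ x \in W, x <> 0 & weight_vector mu x].
Proof.
move=> W0 aW; have [ap aab _] := aP.
apply: weight_exists => // h ha U _ U0 stU.
by apply: (symmetric_eigenvector qP) => //; apply/cartan_p_symmetric/(subvP ap).
Qed.

Lemma weight_vector_tau mu x : weight_vector mu x -> weight_vector (- mu) (tau x).
Proof.
move=> xmu H; have /cartan_pP Hp := restricted_p H.
rewrite -[vsval H]opprK -Hp lieNl -cartan_lie xmu linearZ /=.
by rewrite lfunSE scaleNr.
Qed.

Lemma lie_root_opp mu : lie_root mu -> lie_root (- mu).
Proof.
move=> [mu0 [x x0 xmu]]; apply: (weight_vector_root _ _ (weight_vector_tau xmu)).
  by move=> /eqP; rewrite oppr_eq0 => /eqP.
by move=> tx; apply: x0; rewrite -(cartanK x) tx linear0.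
Qed.

Lemma weight_vector_orthogonal mu nu x y : mu <> nu ->
  weight_vector mu x -> weight_vector nu y -> q x y = 0.
Proof.
move=> munu xmu ynu; apply: contrapT => /eqP qxy; apply: munu; apply/lfunP=> H.
have := cartan_p_symmetric (restricted_p H) x y.
rewrite !adE xmu ynu (innerZl qP) (innerZr qP) => /eqP.
by rewrite -subr_eq0 -mulrBl mulf_eq0 (negbTE qxy) orbF subr_eq0 => /eqP.
Qed.

(** Weight vectors of distinct weights are orthogonal, so there are at most
    [\dim gs] roots. *)
Lemma finite_roots : exists2 s : seq (vdual a), uniq s & forall mu, mu \in s <-> lie_root mu.
Proof.
apply: (@finite_of_bounded _ _ (\dim {:gs})) => s us sP.
have /choice[X XP] mu : exists x, mu \in s -> x <> 0 /\ weight_vector mu x.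
  case: (boolP (mu \in s)) => [/sP[_ [x x0 xmu]]|_]; first by exists x.
  by exists 0.
have -> : size s = size (map X s) by rewrite size_map.
suff : free (in_tuple (map X s)) by rewrite /free => /eqP <-; rewrite dimvS // subvf.
apply/freeP => k k0 i.
have si (j : 'I_(size (map X s))) : (j < size s)%N by rewrite -(size_map X).
pose j0 := nth (0 : vdual a) s i.
have js : j0 \in s by rewrite mem_nth.
have [x0 xmu] := XP _ js.
have := congr1 (q^~ (X j0)) k0; rewrite /= (inner0l qP) (inner_suml qP) (bigD1 i) //=.
rewrite big1 => [|j ji]; last first.
  rewrite (innerZl qP) (nth_map (0 : vdual a)) // (@weight_vector_orthogonal (nth 0 s j) j0) ?mulr0 //.
    by apply/eqP; rewrite nth_uniq //; apply: contra ji => /eqP/val_inj ->.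
  by case: (XP (nth 0 s j)) => //; rewrite mem_nth.
rewrite addr0 (innerZl qP) (nth_map (0 : vdual a)) // => /eqP.
by rewrite mulf_eq0 => /orP[/eqP //|/eqP/(inner_eq0 qP)].
Qed.

(** On [a] the form [q] is the Killing form, so [T] is the dual vector of [mu]. *)
Definition represents mu (T : subvs_of a) :=
  forall H, q (vsval T) (vsval H) = mu H.

Lemma represents_unique mu T T' : represents mu T -> represents mu T' -> T = T'.
Proof.
move=> TP TP'; apply/eqP; rewrite -subr_eq0; apply/eqP/(can_inj vsvalK).
rewrite linear0; apply: (inner_eq0 qP).
by rewrite [X in q X _]vsvalB (innerBl qP) TP TP' subrr.
Qed.

Lemma lie_tau_in mu x : weight_vector mu x -> lie (tau x) x \in a.
Proof.
move=> xmu; apply: (maximal_abelianP aP).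
  by apply/cartan_pP; rewrite cartan_lie cartanK lieC.
move=> h ha; rewrite -[h](vsprojK ha) lie_der.
rewrite xmu (weight_vector_tau xmu) lieZl lieZr lfunSE -scalerDl addNr.
by rewrite scale0r.
Qed.

(** By invariance, the Killing form pairs [[tau x, x]] and [H] to
    [mu(H) |x|^2]: up to that factor, [[tau x, x]] is the coroot of [mu]. *)
Lemma lie_tau_represents mu x : weight_vector mu x ->
  represents (q x x *: mu) (vsproj a (lie (tau x) x)).
Proof.
move=> xmu H; rewrite vsprojK ?(lie_tau_in xmu) // (innerC qP) restricted_form.
rewrite -killing_lie (weight_vector_tau xmu) lfunSE killingZl.
by rewrite /q lfunSE killingC mulNr mulrC -mulNr.
Qed.

Lemma root_represented mu : lie_root mu -> exists T, represents mu T.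
Proof.
move=> [mu0 [x /(inner_gt0 qP) x0 xmu]].
exists ((q x x)^-1 *: vsproj a (lie (tau x) x)) => H.
rewrite linearZ /= (innerZl qP) (lie_tau_represents xmu) lfunSE.
by rewrite [LHS]mulrA mulVf ?mul1r // gt_eqF.
Qed.

(** If [[tau x, y] = 0] then [| [x, y] |^2 = - <y, [[tau x, x], y]>]: a lowest
    weight is nonpositive on the coroot. *)
Lemma lowest_weight_le0 mu nu x y T : weight_vector mu x -> weight_vector nu y ->
  x <> 0 -> y <> 0 -> lie (tau x) y = 0 -> represents mu T -> nu T <= 0 :> R.
Proof.
move=> xmu ynu /(inner_gt0 qP) x0 /(inner_gt0 qP) y0 txy TP.
have TE : vsproj a (lie (tau x) x) = q x x *: T.
  apply: (represents_unique (lie_tau_represents xmu)) => H.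
  by rewrite linearZ /= (innerZl qP) TP lfunSE.
have : 0 <= q (lie x y) (lie x y) by apply: (inner_ge0 qP).
rewrite cartan_form_adj lie_der txy lie0r addr0.
rewrite -(vsprojK (lie_tau_in xmu)) ynu TE linearZ /= (innerZr qP) oppr_ge0.
by rewrite pmulr_lle0 // pmulr_rle0.
Qed.

(** If every weight of [W] vanishes on [Z] then [Z] acts trivially on [W]: its
    eigenvalues on [W] are values of weights, and [ad Z] is symmetric. *)
Lemma weights_vanish (W : {vspace gs}) (Z : subvs_of a) :
    (forall h x, h \in a -> x \in W -> lie h x \in W) ->
    (forall mu x, x \in W -> x <> 0 -> weight_vector mu x -> mu Z = 0 :> R) ->
  forall x, x \in W -> lie (vsval Z) x = 0.
Proof.
move=> aW muZ x xW; rewrite -adE; move: x xW.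
apply: (symmetric_eq0 cartan_formP (cartan_p_symmetric (restricted_p Z))).
  by move=> x xW; rewrite adE aW // subvsP.
move=> c x xW x0 Zx.
have [||mu [y [yU y0 ymu]]] :=
    restricted_weight_exists (W := (W :&: leigenspace (ad (vsval Z)) c)%VS).
- by apply/vspace_neq0P; exists x => //; rewrite memv_cap xW; apply/leigenspaceP.
- move=> h y ha; rewrite !memv_cap => /andP[yW /leigenspaceP Zy].
  rewrite aW //=; apply/leigenspaceP; rewrite adE lie_der.
  have [_ aab _] := aP; rewrite (aab (vsval Z) h) ?subvsP // lie0l add0r -(adE _ y) Zy.
  by rewrite lieZr.
move: yU; rewrite memv_cap => /andP[yW /leigenspaceP]; rewrite adE ymu => /eqP.
rewrite (muZ mu y) // scale0r eq_sym scaler_eq0 => /orP[/eqP //|/eqP //].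
Qed.

Lemma vdual_sumE (I : finType) (c : I -> R) (f : I -> vdual a) H :
  (\sum_j c j *: f j) H = \sum_j c j * f j H.
Proof. by rewrite sum_lfunE; apply: eq_bigr => j _; rewrite lfunSE. Qed.

Lemma represents_sum (I : finType) (c : I -> R) (f : I -> vdual a) (T : I -> subvs_of a) :
  (forall j, represents (f j) (T j)) ->
  represents (\sum_j c j *: f j) (\sum_j c j *: T j).
Proof.
move=> TP H; rewrite vdual_sumE vsval_sum (inner_suml qP).
by apply: eq_bigr => j _; rewrite vsvalZ (innerZl qP) TP.
Qed.

End RestrictedRoots.
End CartanInner.

(** * Simple roots of a lexicographic ordering *)

Lemma count_strict (T : eqType) (p r : pred T) (s : seq T) x :
  subpred p r -> x \in s -> r x -> ~~ p x -> (count p s < count r s)%N.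
Proof.
move=> pr + rx px; elim: s => //= y s IH.
rewrite inE => /predU1P[<-|/IH lt]; first by rewrite rx (negbTE px) ltnS sub_count.
by rewrite -addnS leq_add //; case: (p y) (pr y) => // ->.
Qed.

Section LexOrder.
Variables (R : realType) (V : vectType R) (a : {vspace V}) (b : seq (subvs_of a)).
Implicit Types mu nu : vdual a.

Lemma vdual_addE mu nu H : (mu + nu) H = (mu H : R) + nu H :> R.
Proof. by rewrite add_lfunE. Qed.
Lemma vdual_oppE mu H : (- mu) H = - (mu H : R) :> R.
Proof. by rewrite opp_lfunE. Qed.
Lemma vdual_scaleE c mu H : (c *: mu) H = c * (mu H : R) :> R.
Proof. by rewrite scale_lfunE. Qed.
Lemma vdual_0E H : (0 : vdual a) H = 0 :> R.
Proof. by rewrite zero_lfunE. Qed.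

Lemma lex_posD mu nu : lex_pos b mu -> lex_pos b nu -> lex_pos b (mu + nu).
Proof.
move=> [j [jb mj muj]] [k [kb nk nuk]].
case: (ltngtP j k) => jk.
- exists j; split=> // [|i ij]; rewrite vdual_addE; first by rewrite nuk // addr0.
  by rewrite muj // nuk ?addr0 // (ltn_trans ij).
- exists k; split=> // [|i ik]; rewrite vdual_addE; first by rewrite muj // add0r.
  by rewrite nuk // muj ?addr0 // (ltn_trans ik).
exists j; split=> // [|i ij]; rewrite vdual_addE.
  by rewrite addr_gt0 // jk.
by rewrite muj // nuk ?addr0 // -jk.
Qed.

Lemma lex_posZ c mu : 0 < c -> lex_pos b mu -> lex_pos b (c *: mu).
Proof.
move=> c0 [j [jb mj muj]]; exists j; split=> // [|i ij]; rewrite vdual_scaleE.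
  exact: mulr_gt0.
by rewrite muj // mulr0.
Qed.

Lemma lex_pos_neq0 mu : lex_pos b mu -> mu <> 0.
Proof. by move=> [j [_ + _]] m0; rewrite m0 vdual_0E ltxx. Qed.

Lemma lex_pos_total mu : basis_of {:subvs_of a} b -> mu <> 0 ->
  lex_pos b mu \/ lex_pos b (- mu).
Proof.
move=> bb mu0.
have ex : exists j, (j < size b)%N && (mu b`_j != 0).
  apply: contrapT => no; apply: mu0; apply/lfunP=> H.
  have Hb : H \in <<b>>%VS by case/andP: bb => /eqP-> _; rewrite memvf.
  rewrite zero_lfunE; move: Hb; suff /subvP/[apply] : (<<b>> <= lker mu)%VS.
    by rewrite memv_ker => /eqP.
  apply/span_subvP=> h /(nthP 0)[j jb <-]; rewrite memv_ker.
  by apply/negPn/negP=> muj; apply: no; exists j; rewrite jb.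
case: (ex_minnP ex) => j /andP[jb muj] minj.
have zero i : (i < j)%N -> mu b`_i = 0.
  move=> ij; apply/eqP/negPn/negP => mui.
  by have := minj i; rewrite (ltn_trans ij jb) mui leqNgt ij => /(_ isT).
case: (ltgtP 0 (mu b`_j : R)) => m0.
- by left; exists j.
- right; exists j; split=> // [|i ij]; rewrite vdual_oppE ?oppr_gt0 //.
  by rewrite zero // oppr0.
by rewrite -m0 eqxx in muj.
Qed.

Definition lex_ge0 mu := mu = 0 \/ lex_pos b mu.

Lemma lex_ge0_sum (I : finType) (P : pred I) (c : I -> R) (f : I -> vdual a) :
  (forall j, 0 <= c j) -> (forall j, lex_pos b (f j)) ->
  lex_ge0 (\sum_(j | P j) c j *: f j).
Proof.
move=> c0 fpos; elim/big_ind: _ => [|x y [->|xp] [->|yp]|j _].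
- by left.
- by left; rewrite addr0.
- by right; rewrite add0r.
- by right; rewrite addr0.
- by right; apply: lex_posD.
have := c0 j; rewrite le_eqVlt => /orP[/eqP <-|cj]; first by left; rewrite scale0r.
by right; apply: lex_posZ.
Qed.

Lemma lex_pos_sum_eq0 (I : finType) (c : I -> R) (f : I -> vdual a) :
  (forall j, 0 <= c j) -> (forall j, lex_pos b (f j)) ->
  \sum_j c j *: f j = 0 -> forall j, c j = 0.
Proof.
move=> c0 fpos s0 j; have := c0 j; rewrite le_eqVlt => /orP[/eqP //|cj].
have p := lex_posZ cj (fpos j); rewrite (bigD1 j) //= in s0.
have [z|z] := lex_ge0_sum (fun i => i != j) c0 fpos.
  by case: (lex_pos_neq0 p); rewrite -s0 z addr0.
by case: (lex_pos_neq0 (lex_posD p z)).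
Qed.

End LexOrder.

Section SimpleRoots.
Variables (R : realType) (gs : lieAlgType R) (tau : 'End(gs)).
Hypothesis tauP : cartan_involution tau.
Variable (a : {vspace gs}).
Hypothesis aP : maximal_abelian_in (cartan_p tau) a.
Variable (b : seq (subvs_of a)).
Hypothesis bP : basis_of {:subvs_of a} b.
Implicit Types mu nu : vdual a.
Local Notation q := (cartan_form tau).
Let qP := cartan_formP tauP.

Lemma root_lex_total mu : lie_root mu -> lex_pos b mu \/ lex_pos b (- mu).
Proof. by move=> [mu0 _]; apply: lex_pos_total. Qed.

(** If [nu T > 0] then [nu - mu] is a root. It or its opposite is positive, so
    one of [nu] and [mu] is not simple. *)
Lemma simple_roots_obtuse mu nu T : mu <> nu ->
  lex_simple_root b mu -> lex_simple_root b nu -> represents tau mu T ->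
  nu T <= 0 :> R.
Proof.
move=> munu [rmu pmu smu] [rnu pnu snu] TP.
have [_ [x x0 xmu]] := rmu; have [_ [y y0 ynu]] := rnu.
apply: (lowest_weight_le0 tauP aP xmu ynu x0 y0) TP.
apply: contrapT => txy.
have w := weight_vector_lie (weight_vector_tau tauP aP xmu) ynu.
have rt : lie_root (- mu + nu).
  apply: weight_vector_root txy w => /eqP; rewrite addrC subr_eq0 => /eqP.
  by move=> e; apply: munu.
have [p|p] := root_lex_total rt.
  by apply: snu; exists mu, (- mu + nu); split=> //; rewrite addrA subrr add0r.
rewrite opprD opprK in p.
apply: smu; exists nu, (mu - nu); split=> //; last by rewrite addrC subrK.
by rewrite -opprB addrC; apply: (lie_root_opp tauP aP).
Qed.

(** A positive root that is not simple is a sum of two smaller positive roots;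
    the induction is on the number of positive roots below. *)
Lemma lex_simple_combination (l : nat) (lam : 'I_l -> vdual a) :
  (forall mu, lex_simple_root b mu <-> exists j, mu = lam j) ->
  forall mu, lie_root mu -> lex_pos b mu ->
  exists k : 'I_l -> nat, mu = \sum_j (k j)%:R *: lam j.
Proof.
move=> lamP; have [s us sP] := finite_roots tauP aP.
pose below mu nu := `[< lex_pos b nu /\ lex_pos b (mu - nu) >].
move=> mu; have [N] := ubnP (count (below mu) s).
elim: N mu => // N IH mu; rewrite ltnS => muN rmu pmu.
case: (pselect (lex_simple_root b mu)) => [/lamP[j ->]|nsimple].
  exists (fun i => (i == j) : nat); rewrite (bigD1 j) //= eqxx scale1r big1 ?addr0 //.
  by move=> i /negbTE ->; rewrite scale0r.
have [mu1 [mu2 [r1 p1 r2 p2 mu12]]] : exists mu1 mu2 : vdual a,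
    [/\ lie_root mu1, lex_pos b mu1, lie_root mu2, lex_pos b mu2 & mu = mu1 + mu2].
  by apply: contrapT => no; apply: nsimple; split.
have dec nu rho : lie_root nu -> lex_pos b nu -> lex_pos b rho -> mu = nu + rho ->
    (count (below nu) s < N)%N.
  move=> rnu pnu prho e; apply: leq_trans muN.
  have sub x : below nu x -> below mu x.
    move=> /asboolP[px pnx]; apply/asboolP; split=> //.
    by rewrite e addrAC; apply: lex_posD.
  have nus : nu \in s by apply/sP.
  apply: count_strict sub nus _ _.
    by apply/asboolP; rewrite e [nu + rho]addrC addrK.
  by apply/negP=> /asboolP[_]; rewrite subrr => /lex_pos_neq0.
have [k1 e1] := IH mu1 (dec _ _ r1 p1 p2 mu12) r1 p1.
have [k2 e2] := IH mu2 (dec _ _ r2 p2 p1 (etrans mu12 (addrC _ _))) r2 p2.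
exists (fun j => (k1 j + k2 j)%N); rewrite mu12 e1 e2 -big_split.
by apply: eq_bigr => j _ /=; rewrite natrD scalerDl.
Qed.

(** Separate the positive and the negative coefficients of a relation: the two
    halves give the same vector [T], and [<T, T> <= 0] because distinct simple
    roots have nonpositive pairing. A vanishing nonnegative combination of
    positive functionals has zero coefficients. *)
Lemma simple_roots_independent (I : finType) (f : I -> vdual a) (c : I -> R) :
    injective f -> (forall j, lex_simple_root b (f j)) ->
  \sum_j c j *: f j = 0 -> forall j, c j = 0.
Proof.
move=> finj fs s0.
have fpos j : lex_pos b (f j) by case: (fs j).
have /choice[T TP] j : exists T, represents tau (f j) T.
  by apply: (root_represented tauP aP); case: (fs j).
pose p j := Num.max (c j) 0; pose n j := Num.max (- c j) 0.
have p0 j : 0 <= p j by rewrite /p le_max lexx orbT.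
have n0 j : 0 <= n j by rewrite /n le_max lexx orbT.
have [cE pn] : (forall j, c j = p j - n j) /\ (forall j, p j * n j = 0).
  split=> j; rewrite /p /n; case: (leP 0 (c j)) => cj.
  - by rewrite (@max_r _ _ (- c j)) ?subr0 //; lra.
  - by rewrite (@max_l _ _ (- c j)) ?sub0r ?opprK //; lra.
  - by rewrite (@max_r _ _ (- c j)) ?mulr0 //; lra.
  - by rewrite mul0r.
have PN : \sum_j p j *: f j = \sum_j n j *: f j.
  apply/eqP; rewrite -subr_eq0 -sumrB -[X in _ == X]s0; apply/eqP/eq_bigr => j _.
  by rewrite cE scalerBl.
have PT := represents_sum tauP p TP.
have T0 : \sum_j p j *: T j = 0.
  apply: (can_inj vsvalK); rewrite linear0; apply: (inner_eq0 qP).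
  apply/eqP; rewrite eq_le (inner_ge0 qP) andbT PT PN vdual_sumE.
  rewrite sumr_le0 // => j _; rewrite linear_sum mulr_sumr sumr_le0 // => k _.
  rewrite linearZ /= mulrA; case: (eqVneq j k) => [->|jk].
    by rewrite [n k * _]mulrC pn mul0r.
  rewrite mulr_ge0_le0 ?mulr_ge0 //; apply: simple_roots_obtuse (TP k) => //.
  by move=> /finj e; rewrite e eqxx in jk.
have P0 : \sum_j p j *: f j = 0.
  by apply/lfunP=> H; rewrite -PT T0 zero_lfunE linear0 (inner0l qP).
move=> j; rewrite cE (lex_pos_sum_eq0 p0 fpos P0 j).
by rewrite PN in P0; rewrite (lex_pos_sum_eq0 n0 fpos P0 j) subrr.
Qed.

End SimpleRoots.

(** * Gradations of the third kind *)

Section ThirdKindGradation.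
Variables (R : realType) (gs : lieAlgType R) (tau : 'End(gs)).
Variables (a : {vspace gs}) (b : seq (subvs_of a)) (l : nat).
Variables (lam : 'I_l -> vdual a) (n : 'I_l -> nat) (h : 'I_l -> subvs_of a).
Variable (i : 'I_l).
Hypothesis tkg : third_kind_graded tau b lam n h i.
Local Notation hh := (vsval (h i)).
Local Notation E := (characteristic_gradation hh).
Local Notation q := (cartan_form tau).
Let tauP := tkg_cartan tkg.
Let aP := tkg_maximal_abelian tkg.
Let qP := cartan_formP tauP.
Implicit Types (x y z u v w : gs) (mu nu : vdual a) (W : {vspace gs}).

Lemma gradationP (p : int) x : reflect (lie hh x = p%:~R *: x) (x \in E p).
Proof. by rewrite -adE; apply: leigenspaceP. Qed.

Lemma gradation_lie (p r : int) x y : x \in E p -> y \in E r -> lie x y \in E (p + r).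
Proof.
move=> /gradationP xp /gradationP yr; apply/gradationP.
by rewrite lie_der xp yr lieZl lieZr -scalerDl intrD.
Qed.

Lemma gradation_tau (p : int) x : x \in E p -> tau x \in E (- p).
Proof.
move=> /gradationP xp; apply/gradationP.
have /cartan_pP hp := restricted_p aP (h i).
by rewrite -[hh]opprK -hp lieNl -(cartan_lie tauP) xp linearZ /= mulrNz scaleNr.
Qed.

Lemma gradation_big (p : int) x : (3 < `|p|)%N -> x \in E p -> x = 0.
Proof.
case: (tkg_kind tkg) => _ _ big _ _ /big ->.
by rewrite memv0 => /eqP.
Qed.

Lemma gradation_span x : exists e : 'I_7 -> gs,
  (forall k, e k \in E (k%:Z - 3)) /\ x = \sum_k e k.
Proof.
have [_ full _ _ _] := tkg_kind tkg.
have /memv_sumP[e eE ->] : x \in (\sum_(k < 3.*2.+1) E (k%:Z - 3%:Z)%R)%VS.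
  by rewrite full memvf.
by exists e; split=> // k; apply: eE.
Qed.

Lemma abelian_in_degree0 x : x \in a -> x \in E 0.
Proof.
have [_ aab _] := aP => xa; apply/gradationP.
by rewrite (aab hh x) ?subvsP // scale0r.
Qed.

Lemma weight_degree mu x (p : int) : weight_vector mu x -> mu (h i) = p%:~R -> x \in E p.
Proof. by move=> xmu mup; apply/gradationP; rewrite xmu mup. Qed.

Lemma degree_weight mu x (p : int) : x \in E p -> x <> 0 -> weight_vector mu x ->
  mu (h i) = p%:~R.
Proof.
move=> /gradationP xp /eqP x0 xmu; apply/eqP; rewrite -subr_eq0.
have /eqP : (mu (h i) - p%:~R : R) *: x = 0 by rewrite scalerBl -xmu xp subrr.
by rewrite scaler_eq0 (negbTE x0) orbF.
Qed.

Lemma simple_combination_eval (c : 'I_l -> R) j : (\sum_k c k *: lam k) (h j) = c j.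
Proof.
rewrite vdual_sumE (bigD1 j) //= (tkg_dual tkg) eqxx mulr1 big1 ?addr0 // => k kj.
by rewrite (tkg_dual tkg) (negbTE kj) mulr0.
Qed.

Lemma simple_root_exists j : exists2 x, x <> 0 & weight_vector (lam j) x.
Proof.
have /(tkg_lam tkg)[[_ [x x0 xmu]] _ _] : exists k, lam j = lam k by exists j.
by exists x.
Qed.

Lemma root_combination mu : lie_root mu -> exists k : 'I_l -> nat,
  mu = \sum_j (k j)%:R *: lam j \/ mu = - \sum_j (k j)%:R *: lam j.
Proof.
move=> rmu.
have [pm|pm] := root_lex_total (tkg_basis tkg) rmu.
  by have [k ->] := lex_simple_combination tauP aP (tkg_lam tkg) rmu pm; exists k; left.
have [k e] := lex_simple_combination tauP aP (tkg_lam tkg)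
  (lie_root_opp tauP aP rmu) pm.
by exists k; right; rewrite -e opprK.
Qed.

(** The degree [p > 0] of [x] is the coefficient of [lam i] in its weight, so the
    sign in [root_combination] is positive. *)
Lemma positive_weight mu x (p : nat) : (0 < p)%N -> x \in E p -> x <> 0 ->
  weight_vector mu x -> exists k : 'I_l -> nat, mu = \sum_j (k j)%:R *: lam j.
Proof.
move=> p0 xE x0 xmu; have mup := degree_weight xE x0 xmu.
have p0R : (0 : R) < p%:~R by rewrite ltr0z ltz_nat.
have [|k [->|e]] := root_combination (mu := mu); last 2 first.
- by exists k.
- move: p0R; rewrite -mup e vdual_oppE simple_combination_eval oppr_gt0 => lt0.
  by have := lt_le_trans lt0 (ler0n R (k i)); rewrite ltxx.
apply: weight_vector_root x0 xmu => m0.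
by rewrite -mup m0 vdual_0E ltxx in p0R.
Qed.

(** A weight [nu] of minimal height in [W] satisfies [<nu, lam j> <= 0] for all
    [j], although it is a nonnegative combination of the [lam j]. *)
Lemma lowered_by_simple_root_eq0 (p : nat) W y : (0 < p)%N -> (W <= E p)%VS ->
    (forall u x, u \in E 0 -> x \in W -> lie u x \in W) ->
    y <> 0 -> weight_vector (lam i) y ->
    (forall x, x \in W -> lie (tau y) x = 0) ->
  W = 0%VS.
Proof.
move=> p0 /subvP WE W0 y0 ylam yW; apply: contrapT => Wn0.
have aW u x : u \in a -> x \in W -> lie u x \in W.
  by move=> ua; apply: W0; apply: abelian_in_degree0.
have [nu [x [xW x0 xnu]]] := restricted_weight_exists tauP aP Wn0 aW.
have [k e] := positive_weight p0 (WE _ xW) x0 xnu.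
have [N] := ubnP (\sum_j k j)%N.
elim: N k nu x xW x0 xnu e => // N IH k nu x xW x0 xnu nuE; rewrite ltnS => kN.
have /choice[T TP] j : exists T, represents tau (lam j) T.
  apply: (root_represented tauP aP).
  by have /(tkg_lam tkg)[] : exists k, lam j = lam k by exists j.
(* Otherwise [[tau u, x]] has weight [nu - lam j], of smaller height. *)
have nuT j : nu (T j) <= 0 :> R.
  case: (eqVneq j i) => [->|ji].
    exact: (lowest_weight_le0 tauP aP ylam xnu y0 x0 (yW _ xW) (TP i)).
  have [u u0 ulam] := simple_root_exists j.
  apply: (lowest_weight_le0 tauP aP ulam xnu u0 x0 _ (TP j)).
  apply: contrapT => ux0.
  have utau := weight_vector_tau tauP aP ulam.
  have tuE : tau u \in E 0.
    by apply: weight_degree utau _; rewrite vdual_oppE (tkg_dual tkg) (negbTE ji) oppr0.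
  have uxW := W0 _ _ tuE xW.
  have uxnu := weight_vector_lie utau xnu.
  have [k' e'] := positive_weight p0 (WE _ uxW) ux0 uxnu.
  apply: (IH k' _ _ uxW ux0 uxnu e').
  have ev m : (k' m)%:R = (k m)%:R - (j == m)%:R :> R.
    by rewrite -(simple_combination_eval (fun m => (k' m)%:R)) -e' vdual_addE vdual_oppE
      (tkg_dual tkg) nuE simple_combination_eval addrC.
  apply: leq_trans kN.
  rewrite (bigD1 j) //= [X in (_ < X)%N](bigD1 j) //= -addSn.
  have kj : k j = (k' j).+1.
    by apply/eqP; rewrite -(eqr_nat R) -natr1 ev eqxx subrK.
  rewrite kj leq_add2l; apply: leq_sum => m mj.
  by rewrite -(ler_nat R) ev eq_sym (negbTE mj) subr0.
pose TT := \sum_j (k j)%:R *: T j.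
have TTP : represents tau nu TT by rewrite nuE; apply: represents_sum.
have TT0 : TT = 0.
  apply: (can_inj vsvalK); rewrite linear0; apply: (inner_eq0 qP).
  apply/eqP; rewrite eq_le (inner_ge0 qP) andbT TTP /TT linear_sum sumr_le0 // => j _.
  by rewrite linearZ /= mulr_ge0_le0.
have := degree_weight (WE _ xW) x0 xnu; rewrite -TTP TT0 linear0 (inner0l qP) => /esym/eqP.
by rewrite intr_eq0 eqz_nat (gtn_eqF p0).
Qed.

Definition central0 z := z \in E 0 /\ forall u, u \in E 0 -> lie z u = 0.

(** An element of [p] that centralizes [E 0] lies in [a], and every simple root
    except [lam i] vanishes on it. *)
Lemma central0_p z : central0 z -> z \in cartan_p tau -> z \in <[hh]>%VS.
Proof.
move=> [z0 zc] zp.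
have za : z \in a.
  apply: (maximal_abelianP aP zp) => u ua.
  by rewrite lieC zc ?oppr0 //; apply: abelian_in_degree0.
pose Z := vsproj a z.
have ZE : vsval Z = z by rewrite vsprojK.
have lamZ j : j != i -> lam j Z = 0.
  move=> ji; have [x x0 xlam] := simple_root_exists j.
  have xE : x \in E 0.
    by apply: weight_degree xlam _; rewrite (tkg_dual tkg) (negbTE ji).
  have := xlam Z; rewrite ZE zc // => /esym/eqP.
  by rewrite scaler_eq0 => /orP[/eqP //|/eqP].
pose Z' := Z - (lam i Z : R) *: h i.
have lamZ' j : lam j Z' = 0.
  rewrite linearB linearZ /= (tkg_dual tkg); case: (eqVneq j i) => [->|ji].
    by rewrite [_ *: _]mulr1 subrr.
  by rewrite lamZ // [_ *: _]mulr0 subrr.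
have rootZ' mu : lie_root mu -> mu Z' = 0.
  have s0 (k : 'I_l -> nat) : (\sum_j (k j)%:R *: lam j) Z' = 0.
    by rewrite vdual_sumE big1 // => j _; rewrite lamZ' mulr0.
  by move=> /root_combination[k [->|->]]; rewrite ?vdual_oppE s0 ?oppr0.
have : vsval Z' = 0.
  apply: (simple_center0 (tkg_simple tkg)) => y.
  apply: (weights_vanish tauP aP (W := fullv)) (memvf y) => [u x _ _|mu x _ x0 xmu].
    exact: memvf.
  case: (pselect (mu = 0)) => [->|mu0]; first exact: vdual_0E.
  by apply: rootZ'; apply: weight_vector_root x0 xmu.
rewrite vsvalB vsvalZ ZE => /eqP; rewrite subr_eq0 => /eqP ->.
by rewrite memvZ // memv_line.
Qed.

End ThirdKindGradation.

(** * Central elements of degree zero fixed by the Cartan involution *)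

Section CentralElementOfK.
Variables (R : realType) (gs : lieAlgType R) (tau : 'End(gs)).
Variables (a : {vspace gs}) (b : seq (subvs_of a)) (l : nat).
Variables (lam : 'I_l -> vdual a) (n : 'I_l -> nat) (h : 'I_l -> subvs_of a).
Variable (i : 'I_l).
Hypothesis tkg : third_kind_graded tau b lam n h i.
Local Notation hh := (vsval (h i)).
Local Notation E := (characteristic_gradation hh).
Local Notation q := (cartan_form tau).
Let tauP := tkg_cartan tkg.
Let aP := tkg_maximal_abelian tkg.
Let qP := cartan_formP tauP.
Implicit Types (x y z u v w : gs) (mu nu : vdual a) (W : {vspace gs}).

Section CentralInK.
Variable z : gs.
Hypothesis zc : central0 h i z.
Hypothesis zk : z \in cartan_k tau.

Let zz : 'End(gs) := (ad z \o ad z)%VF.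

Lemma central_squareE x : zz x = lie z (lie z x).
Proof. by rewrite lfunSE !adE. Qed.

Lemma central_square_symmetric : symmetric_for q zz.
Proof.
by move=> x y; rewrite !central_squareE !(cartan_k_skew tauP) // (innerC qP) (cartan_k_skew tauP) //
  opprK (innerC qP).
Qed.

Lemma central_stable_degree (p : int) x : x \in E p -> lie z x \in E p.
Proof. by case: zc => z0 _ xp; have := gradation_lie z0 xp; rewrite add0r. Qed.

Lemma central_commute0 u x : u \in E 0 -> lie z (lie u x) = lie u (lie z x).
Proof. by case: zc => _ zu uE; rewrite lie_der zu // lie0l add0r. Qed.

Lemma central_square_commute0 u x : u \in E 0 -> zz (lie u x) = lie u (zz x).
Proof. by move=> uE; rewrite !central_squareE !central_commute0. Qed.

(** [ad z] is skew for the inner product. *)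
Lemma central_square_eq0 x : zz x = 0 -> lie z x = 0.
Proof.
move=> zx; apply: (inner_eq0 qP).
by rewrite (cartan_k_skew tauP) // -central_squareE zx (inner0r qP) oppr0.
Qed.

Lemma central_tau x : tau (lie z x) = lie z (tau x).
Proof. by rewrite (cartan_lie tauP); move/cartan_kP: zk => ->. Qed.

Lemma gradation_tau_opp (p : int) x : x \in E (- p) -> tau x \in E p.
Proof. by move=> /(gradation_tau tkg); rewrite opprK. Qed.

(** [E 1] is an irreducible [E 0]-module, and [zz] commutes with [E 0]. *)
Lemma central_square_scalar_degree1 : exists c : R,
  (forall x, x \in E 1 -> zz x = c *: x) /\ (forall x, x \in E (- 1) -> zz x = c *: x).
Proof.
have [S SE] : exists S : {vspace gs}, forall x, x \in S <-> weight_vector (lam i) x.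
  apply: vspace_of_pred => [H|c x y xl yl H]; first by rewrite lie0r scaler0.
  by rewrite lieDr lieZr xl yl scalerDr !scalerA mulrC.
have S0 : S <> 0%VS.
  have [x x0 xl] := simple_root_exists tkg i.
  by apply/vspace_neq0P; exists x => //; apply/SE.
have zzS : stable_under zz S.
  move=> x /SE xl; apply/SE=> H.
  by rewrite -central_square_commute0 ?xl ?linearZ //; apply: (abelian_in_degree0 tkg); apply: subvsP.
have [c [y [/SE yl y0 zy]]] := symmetric_eigenvector qP central_square_symmetric S0 zzS.
have yE : y \in E 1.
  by apply: weight_degree yl _; rewrite (tkg_dual tkg) eqxx.
have deg1 x : x \in E 1 -> zz x = c *: x.
  pose f : 'End(gs) := zz - c *: \1%VF.
  have fE u : f u = zz u - c *: u by rewrite !lfunSE.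
  have fsym : symmetric_for q f.
    move=> u v; rewrite !fE (innerBl qP) (innerDr qP) central_square_symmetric.
    by rewrite -(scaleN1r (c *: v)) !(innerZr qP) (innerZl qP) mulN1r.
  have fdeg u : u \in E 1 -> f u \in E 1.
    by move=> uE; rewrite fE memvB ?memvZ // central_squareE !central_stable_degree.
  have f0 : (f @: E 1)%VS = 0%VS.
    apply: (lowered_by_simple_root_eq0 tkg (p := 1) _ _ _ y0 yl) => //.
    - by apply/subvP=> _ /memv_imgP[u uE ->]; apply: fdeg.
    - move=> u _ uE /memv_imgP[v vE ->].
      have -> : lie u (f v) = f (lie u v).
        by rewrite !fE central_square_commute0 // lieBr lieZr.
      by apply: memv_img; have := gradation_lie uE vE; rewrite add0r.
    move=> _ /memv_imgP[u uE ->].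
    set v := lie _ _.
    have vE : v \in E 0.
      by have := gradation_lie (gradation_tau tkg yE) (fdeg _ uE); rewrite addNr.
    apply: (inner_eq0 qP).
    rewrite {1}/v (cartan_form_adj tauP) (cartanK tauP) fsym.
    have -> : f (lie y v) = 0.
      by rewrite fE lieC linearN /= central_square_commute0 // zy lieZr scalerN subrr.
    by rewrite (inner0r qP) oppr0.
  move=> xE; apply/eqP; rewrite -subr_eq0 -fE -memv0 -f0.
  exact: memv_img.
exists c; split=> // x xE.
have <- : tau (zz (tau x)) = zz x by rewrite !central_squareE !central_tau (cartanK tauP).
by rewrite deg1 ?gradation_tau_opp // linearZ /= (cartanK tauP).
Qed.

Local Notation EC p := (leigenspace (ad (creal hh)) p%:~R).

Lemma complex_gradationP (p : int) (X : complexify gs) :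
  reflect (X.1 \in E p /\ X.2 \in E p) (X \in EC p).
Proof.
by apply: (iffP (creal_eigenP _ _ _)) => -[? ?]; split; apply/gradationP.
Qed.

Lemma complex_gradation_big (p : int) (X : complexify gs) : (3 < `|p|)%N ->
  X \in EC p -> X = 0.
Proof.
move=> p3 /complex_gradationP[X1 X2]; apply: complexify_eqP.
  by rewrite (gradation_big tkg p3 X1).
by rewrite (gradation_big tkg p3 X2).
Qed.

Lemma complex_gradation_lie (p r : int) (X Y : complexify gs) :
  X \in EC p -> Y \in EC r -> lie X Y \in EC (p + r).
Proof.
move=> /complex_gradationP[X1 X2] /complex_gradationP[Y1 Y2].
apply/complex_gradationP; rewrite complexify_lieE /=.
by split; [apply: memvB | apply: memvD]; apply: gradation_lie.
Qed.

Lemma complex_gradation_span (X : complexify gs) : exists e : 'I_7 -> complexify gs,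
  (forall k, e k \in EC (k%:Z - 3)) /\ X = \sum_k e k.
Proof.
have [e1 [e1E X1]] := gradation_span tkg X.1.
have [e2 [e2E X2]] := gradation_span tkg X.2.
exists (fun k => creal (e1 k) + 'i%C *: creal (e2 k)); split=> [k|].
  rewrite complexify_iscaleE complexifyD /= oppr0 addr0 add0r.
  by apply/complex_gradationP; split; [apply: e1E | apply: e2E].
rewrite [X in X = _]complexifyE X1 X2 big_split /= -scaler_sumr.
have sumC (e : 'I_7 -> gs) : creal (\sum_k e k) = \sum_k creal (e k) :> complexify gs.
  by apply: (big_morph (@creal R gs)) => // x y; apply: crealD.
by rewrite !sumC.
Qed.

(** If [zz] had a nonzero eigenvalue on [E 3], then the eigenspace [V] of [ad z]
    for the eigenvalue [i s] on the top degree of the complexification would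
    generate an ideal whose top degree is [V]; but the conjugate of [V] belongs
    to the eigenvalue [- i s]. *)
Lemma central_degree3_eq0 x : x \in E 3 -> lie z x = 0.
Proof.
move=> xE; apply: central_square_eq0; move: x xE.
apply: (symmetric_eq0 qP central_square_symmetric) => [x xE|c x xE x0 zx].
  by rewrite central_squareE !central_stable_degree.
apply: contrapT => c0.
have zxx := inner_gt0 qP x0.
have c_lt0 : c < 0.
  rewrite lt_neqAle; apply/andP; split; first exact/eqP.
  have : 0 <= q (lie z x) (lie z x) by apply: (inner_ge0 qP).
  rewrite (cartan_k_skew tauP) // -central_squareE zx (innerZr qP) oppr_ge0.
  by rewrite pmulr_lle0.
pose s := Num.sqrt (- c).
have s0 : 0 < s by rewrite sqrtr_gt0 oppr_gt0.
have s2 : s * s = - c by rewrite -expr2 sqr_sqrtr // oppr_ge0 ltW.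
pose w := - (s^-1 *: lie z x).
have zw : lie z w = s *: x.
  rewrite /w lieNr lieZr -central_squareE zx scalerA -scaleNr; congr (_ *: _).
  by rewrite -mulrN -s2 mulrA mulVf ?mul1r // gt_eqF.
have zxE : lie z x = - (s *: w).
  by rewrite /w scalerN opprK scalerA mulfV ?scale1r // gt_eqF.
pose X : complexify gs := (x, w).
have is_scale (Y : complexify gs) : ('i%C * s%:C%C) *: Y = (- (s *: Y.2), s *: Y.1) :> complexify gs.
  by rewrite -scalerA complexify_realscaleE complexify_iscaleE.
pose V := (EC 3 :&: leigenspace (ad (creal z)) ('i%C * s%:C%C))%VS.
have wE : w \in E 3 by rewrite memvN memvZ // central_stable_degree.
have XV : X \in V.
  rewrite memv_cap; apply/andP; split; first exact/complex_gradationP.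
  by apply/leigenspaceP; rewrite adE creal_lieE is_scale /= zxE zw.
pose nonpos := (\sum_(k < 4) EC (- k%:Z))%VS.
pose pos := (\sum_(k < 3) EC (k%:Z + 1))%VS.
pose low := (\sum_(k < 6) EC (k%:Z - 3))%VS.
have V3 Y : Y \in V -> Y \in EC 3 by rewrite memv_cap => /andP[].
have in_low (p : int) Y : p < 3 -> Y \in EC p -> Y \in low.
  move=> p3 Yp; case: (ltnP 3 `|p|%N) => p3'; first by rewrite (complex_gradation_big p3' Yp) mem0v.
  have k6 : (absz (p + 3)%R < 6)%N by lia.
  apply: (memv_sum_at (k := Ordinal k6)) => /=.
  by have -> : (absz (p + 3)%R)%:Z - 3 = p by lia.
have full : (low + V)%VS = fullv.
  apply: (simple_top_generates (q := nonpos) (n := pos) (V := V)) => //.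
  - exact: tkg_complexify_simple tkg.
  - apply/eqP; rewrite eqEsubv subvf /=; apply/subvP=> Y _.
    have [e [eE ->]] := complex_gradation_span Y.
    apply: memv_suml => k _; case: (ltnP 3 k) => k3.
      have k3' : (k - 4 < 3)%N by have := ltn_ord k; lia.
      apply: (subvP (addvSr _ _)); apply: (memv_sum_at (k := Ordinal k3')) => /=.
      by have -> : (k - 4)%N%:Z + 1 = k%:Z - 3 by lia.
    have k3' : (3 - k < 4)%N by lia.
    apply: (subvP (addvSl _ _)); apply: (memv_sum_at (k := Ordinal k3')) => /=.
    by have -> : - (3 - k)%N%:Z = k%:Z - 3 by lia.
  - by apply/vspace_neq0P; exists X => //; case.
  - exact: addvSr.
  - move=> Y X' /memv_sumP[e eE ->] /V3 X'V.
    rewrite lieC linear_sum big1 ?oppr0 // => k _ /=.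
    apply: (complex_gradation_big (p := 3 + (k%:Z + 1))); first by lia.
    exact: complex_gradation_lie X'V (eE k isT).
  move=> Y _ /memv_sumP[e eE ->] /memv_addP[L /memv_sumP[f fE ->] [v vV ->]].
  rewrite lieC linear_sum memvN; apply: memv_suml => k _; rewrite /= lieC memvN.
  rewrite lieDr linear_sum memvD //=.
    apply: (subvP (addvSl _ _)); apply: memv_suml => m _.
    apply: (in_low (- k%:Z + (m%:Z - 3))); first by have := ltn_ord m; lia.
    exact: complex_gradation_lie (eE k isT) (fE m isT).
  have evE := complex_gradation_lie (eE k isT) (V3 _ vV).
  case: (posnP k) => k0; last by apply: (subvP (addvSl _ _)); apply: in_low evE; lia.
  apply: (subvP (addvSr _ _)); rewrite memv_cap.
  have := eE k isT; rewrite k0 oppr0 => eE0; rewrite k0 oppr0 add0r in evE.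
  apply/andP; split; first exact: evE.
  apply/leigenspaceP.
  rewrite adE lie_der.
  have -> : lie (creal z) (e k) = 0.
    have [_ zu] := zc.
    by have /complex_gradationP[e1 e2] := eE0; rewrite creal_lieE !zu.
  have := vV; rewrite lie0l add0r memv_cap => /andP[_ /leigenspaceP]; rewrite adE => ->.
  by rewrite lieZr.
have Y3 : cconj X \in EC 3.
  by apply/complex_gradationP; rewrite /= memvN.
have /memv_addP[_ /memv_sumP[f fE ->] [v vV XE]] : cconj X \in (low + V)%VS.
  by rewrite full memvf.
have f0 : \sum_k f k = 0.
  apply: (@eigenvectors_separate _ _ (ad (creal hh)) _ _ xpredT (fun k : 'I_6 => (k%:Z - 3)%:~R) f 3%:~R).
  - by move=> k _; rewrite eqr_int; have := ltn_ord k; lia.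
  - by move=> k _; apply/leigenspaceP; apply: fE.
  apply/leigenspaceP; have -> : \sum_(k < 6) f k = cconj X - v by rewrite XE addrK.
  by rewrite memvB // V3.
have : cconj X \in V by rewrite XE f0 add0r.
rewrite memv_cap => /andP[_ /leigenspaceP]; rewrite adE creal_lieE is_scale /=.
case=> _; rewrite lieNr zw => /eqP; rewrite eq_sym -addr_eq0 -scalerDl scaler_eq0.
by case/orP=> [|/eqP //]; rewrite gt_eqF // addr_gt0.
Qed.

End CentralInK.
End CentralElementOfK.

(** * The center of the subalgebra of degree zero *)

Section ThirdKindCenter.
Variables (R : realType) (gs : lieAlgType R) (tau : 'End(gs)).
Variables (a : {vspace gs}) (b : seq (subvs_of a)) (l : nat).
Variables (lam : 'I_l -> vdual a) (n : 'I_l -> nat) (h : 'I_l -> subvs_of a).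
Variable (i : 'I_l).
Hypothesis tkg : third_kind_graded tau b lam n h i.
Local Notation hh := (vsval (h i)).
Local Notation E := (characteristic_gradation hh).
Local Notation q := (cartan_form tau).
Let tauP := tkg_cartan tkg.
Let aP := tkg_maximal_abelian tkg.
Let qP := cartan_formP tauP.
Implicit Types (x y z u v w : gs) (mu nu : vdual a) (W : {vspace gs}).

(** The lowering element is the image under [tau] of a root vector of [lam i]. *)
Lemma lowered_eq0 (p : nat) W : (0 < p)%N -> (W <= E p)%VS ->
    (forall u x, u \in E 0 -> x \in W -> lie u x \in W) ->
    (forall y x, y \in E (- 1) -> x \in W -> lie y x = 0) ->
  W = 0%VS.
Proof.
move=> p0 WE W0 lowW; have [y y0 yl] := simple_root_exists tkg i.
apply: (lowered_by_simple_root_eq0 tkg p0 WE W0 y0 yl) => x xW.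
apply: lowW xW; apply: (gradation_tau tkg).
by apply: weight_degree yl _; rewrite (tkg_dual tkg) eqxx.
Qed.

Lemma degree3_neq0 : exists2 x, x \in E 3 & x <> 0.
Proof.
have [[_ [x x0 xmu]] _] := tkg_highest tkg.
exists x => //; apply: weight_degree xmu _.
by rewrite (simple_combination_eval tkg) (tkg_coef tkg).
Qed.

Section CentralInK.
Variable z : gs.
Hypothesis zc : central0 h i z.
Hypothesis zk : z \in cartan_k tau.

(** [ad z] vanishes on [E 3], and its square is a scalar [c] on [E (- 1)] and
    [E 1]. For [y] in [E (- 1)] and [w] in [[E (- 1), E 3]] the derivation rule
    gives [[z y, z w] = - (c / 2) [y, w]]; used twice, [c ^ 2 = c ^ 2 / 4]. *)
Lemma central_degree1_eq0 x : x \in E 1 -> lie z x = 0.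
Proof.
have [c [zz1 zzN1]] := central_square_scalar_degree1 tkg zc zk.
suff c0 : c = 0.
  by move=> /zz1; rewrite c0 scale0r => /(central_square_eq0 tkg zk).
have {}zz1 u : u \in E 1 -> lie z (lie z u) = c *: u by move=> /zz1 <-; rewrite central_squareE.
have {}zzN1 u : u \in E (- 1) -> lie z (lie z u) = c *: u.
  by move=> /zzN1 <-; rewrite central_squareE.
have z3 u : u \in E 3 -> lie z u = 0 by apply: (central_degree3_eq0 tkg zc zk).
have zdeg := central_stable_degree zc.
apply: contrapT => /eqP c0.
have zyu y u : y \in E (- 1) -> u \in E 3 -> lie z (lie y u) = lie (lie z y) u.
  by move=> yE uE; rewrite lie_der (z3 _ uE) lie0r addr0.
have zzw y u : y \in E (- 1) -> u \in E 3 -> lie z (lie z (lie y u)) = c *: lie y u.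
  move=> yE uE; rewrite (zyu _ _ yE uE) (zyu _ _ (zdeg _ _ yE) uE).
  by rewrite (zzN1 _ yE) lieZl.
have half y y' u : y \in E (- 1) -> y' \in E (- 1) -> u \in E 3 ->
    lie (lie z y') (lie z (lie y u)) = (- (c / 2)) *: lie y' (lie y u).
  move=> yE y'E uE.
  have vE : lie y' (lie y u) \in E 1.
    by have := gradation_lie y'E (gradation_lie yE uE).
  have := zz1 _ vE.
  rewrite (lie_der z y') lieDr !(lie_der z _ (lie y u)) (lie_der z _ (lie z _)).
  rewrite (zzw _ _ yE uE) (zzN1 _ y'E) lieZl lieZr => e; apply: (scalerI (a := 2)); first by rewrite pnatr_eq0.
  rewrite scalerA mulrN mulrC divfK ?pnatr_eq0 // scaleNr scaler_nat mulr2n.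
  apply: (addrI (c *: lie y' (lie y u))); rewrite subrr.
  apply: (addIr (c *: lie y' (lie y u))); rewrite add0r -[RHS]e.
  by rewrite !addrA.
have yyu0 y y' u : y \in E (- 1) -> y' \in E (- 1) -> u \in E 3 ->
    lie y' (lie y u) = 0.
  move=> yE y'E uE.
  have e1 := half y y' u yE y'E uE.
  have := half (lie z y) (lie z y') u (zdeg _ _ yE) (zdeg _ _ y'E) uE.
  rewrite -(zyu _ _ yE uE) e1 (zzw _ _ yE uE) (zzN1 _ y'E) !lieZl lieZr !scalerA.
  move/eqP; rewrite -subr_eq0 -scalerBl scaler_eq0 => /orP[|/eqP //].
  have -> : c * c - - (c / 2) * - (c / 2) = (3 / 4) * (c * c) by field.
  by rewrite !mulf_eq0 (negbTE c0) !orbF => /orP[]; rewrite ?invr_eq0 pnatr_eq0.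
have degree2 y u : y \in E (- 1) -> u \in E 3 -> lie y u = 0.
  have [W WE] : exists W : {vspace gs}, forall w, w \in W <->
      w \in E 2 /\ forall y', y' \in E (- 1) -> lie y' w = 0.
    apply: vspace_of_pred => [|d v w [vE vy] [wE wy]].
      by split=> [|y' _]; rewrite ?mem0v ?lie0r.
    split=> [|y' y'E]; first by rewrite memvD ?memvZ.
    by rewrite lieDr lieZr vy // wy // scaler0 addr0.
  move=> yE uE; apply/eqP; rewrite -memv0 -(lowered_eq0 (p := 2) (W := W)) //.
  - by apply/WE; split=> [|y' y'E]; [have := gradation_lie yE uE | apply: yyu0].
  - by apply/subvP=> w /WE[].
  - move=> v w vE /WE[wE wy]; apply/WE; split.
      by have := gradation_lie vE wE; rewrite add0r.
    move=> y' y'E; rewrite lie_der (wy _ y'E) lie0r addr0 wy //.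
    by have := gradation_lie y'E vE; rewrite addr0.
  by move=> y' w y'E /WE[_ wy]; apply: wy.
have [u uE] := degree3_neq0; apply; apply/eqP.
rewrite -memv0 -(lowered_eq0 (p := 3) (W := E 3)) //.
by move=> v w vE wE; have := gradation_lie vE wE; rewrite add0r.
Qed.

(** [ad z] vanishes in degrees 0, 1 and 3, and in negative degrees by [tau]. In
    degree 2, lowering [[z, w]] gives [[z, .]] of an element of degree 1, hence
    zero, and [lowered_eq0] applies to the image of [ad z]. *)
Lemma central0_k : z = 0.
Proof.
have z3 u : u \in E 3 -> lie z u = 0 by apply: (central_degree3_eq0 tkg zc zk).
have zdeg := central_stable_degree zc.
have ztau (p : int) : (forall u, u \in E p -> lie z u = 0) ->
    forall u, u \in E (- p) -> lie z u = 0.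
  move=> zp u uE; apply: (can_inj (cartanK tauP)).
  rewrite (central_tau tkg zk) zp ?linear0 //.
  by rewrite -[p]opprK; apply: (gradation_tau tkg).
have zN1 := ztau 1 central_degree1_eq0.
have z2 u : u \in E 2 -> lie z u = 0.
  have z20 : (ad z @: E 2)%VS = 0%VS.
    apply: (lowered_eq0 (p := 2)) => //.
    - by apply/subvP=> _ /memv_imgP[v vE ->]; rewrite adE; apply: zdeg.
    - move=> v _ vE /memv_imgP[w wE ->]; rewrite adE -(central_commute0 zc) // -adE.
      by apply: memv_img; have := gradation_lie vE wE; rewrite add0r.
    move=> v _ vE /memv_imgP[w wE ->]; rewrite adE.
    have : lie z (lie v w) = 0 by apply: central_degree1_eq0; have := gradation_lie vE wE.
    by rewrite lie_der zN1 // lie0l add0r.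
  by move=> uE; apply/eqP; rewrite -memv0 -z20 -adE; apply: memv_img.
apply: (simple_center0 (tkg_simple tkg)) => x.
have [e [eE ->]] := gradation_span tkg x.
rewrite linear_sum big1 // => k _ /=.
have := eE k; have := ltn_ord k; move: (e k) => y.
have [_ z0] := zc.
case: (nat_of_ord k) => [|[|[|[|[|[|[|//]]]]]]] _.
- exact: (ztau 3).
- exact: (ztau 2).
- exact: (ztau 1 central_degree1_eq0).
- exact: z0.
- exact: central_degree1_eq0.
- exact: z2.
- exact: z3.
Qed.

End CentralInK.

(** The center of [E 0] is stable under [tau]; its part in [k] is zero. *)
Lemma third_kind_center z : central0 h i z -> z \in <[hh]>%VS.
Proof.
move=> zc; have tc : central0 h i (tau z).
  have [z0 zu] := zc; split; first by have := gradation_tau tkg z0; rewrite oppr0.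
  move=> u uE; apply: (can_inj (cartanK tauP)).
  rewrite (cartan_lie tauP) (cartanK tauP) zu ?linear0 //.
  by have := gradation_tau tkg uE; rewrite oppr0.
have cD u v c : central0 h i u -> central0 h i v -> central0 h i (u + c *: v).
  move=> [u0 uc] [v0 vc]; split=> [|x xE]; first by rewrite memvD ?memvZ.
  by rewrite lieDl lieZl uc // vc // scaler0 addr0.
have zk : z + tau z = 0.
  apply: central0_k; first by have := cD _ _ 1 zc tc; rewrite scale1r.
  by apply/cartan_kP; rewrite linearD /= (cartanK tauP) addrC.
apply: (central0_p tkg zc); apply/cartan_pP; apply/eqP.
by rewrite -addr_eq0 addrC zk.
Qed.

End ThirdKindCenter.

(** * The automorphism of order four of the compact dual *)

Lemma lie_centerP (F : fieldType) (g : lieAlgType F) (U : {vspace g}) x :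
  x \in lie_center U <-> x \in U /\ forall u, u \in U -> lie u x = 0.
Proof.
rewrite memv_cap; split=> [/andP[xU xc]|[xU xc]].
  split=> // u /coord_vbasis ->.
  rewrite lieC linear_sum big1 ?oppr0 // => j _ /=.
  rewrite linearZ /= lieC; move: xc; rewrite memvE => /subv_bigcapP/(_ j isT).
  by rewrite -memvE memv_ker adE => /eqP ->; rewrite oppr0 scaler0.
rewrite xU memvE; apply/subv_bigcapP => j _; rewrite -memvE memv_ker adE xc //.
by rewrite vbasis_mem // mem_nth // size_tuple.
Qed.

Section CompactDual.
Variables (R : realType) (gs : lieAlgType R) (tau : 'End(gs)).
Local Notation gC := (complexify gs).
Local Notation gCR := (realify (complexify gs)).

Lemma creal_linear : linear (@creal R gs : gs -> gCR).
Proof.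
move=> c x y; rewrite [in RHS]rscaleE -crealZ.
exact: crealD.
Qed.

Lemma cimag_linear : linear (@cimag R gs : gs -> gCR).
Proof.
move=> c x y; rewrite [in RHS]rscaleE complexify_realscaleE /cimag /=.
by rewrite scaler0 complexifyD /= addr0.
Qed.

Lemma compact_dualP (X : gCR) :
  X \in compact_dual tau <-> (X.1 \in cartan_k tau /\ X.2 \in cartan_p tau).
Proof.
have E1 := linear_linfun creal_linear; have E2 := linear_linfun cimag_linear.
split=> [/memv_addP[_ /memv_imgP[x xk ->] [_ /memv_imgP[y yp ->] ->]]|[X1 X2]].
  by rewrite E1 E2 complexifyD /= addr0 add0r.
apply/memv_addP; exists (creal X.1); first by rewrite -E1 memv_img.
exists (cimag X.2); first by rewrite -E2 memv_img.
by apply: complexify_eqP; rewrite /= ?addr0 ?add0r.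
Qed.

Lemma complexify_lfunE (f : 'End(gs)) (X : gC) :
  complexify_lfun f X = (f X.1, f X.2) :> gC.
Proof.
rewrite /complexify_lfun (@linear_linfun R gCR gCR (fun z : gCR => (f z.1, f z.2) : gCR)) //.
by move=> c x y; rewrite !rscaleE !complexify_realscaleE !complexifyD /= !linearP.
Qed.

End CompactDual.

Section PartOne.
Variables (R : realType) (gs : lieAlgType R) (tau : 'End(gs)).
Variables (a : {vspace gs}) (b : seq (subvs_of a)) (l : nat).
Variables (lam : 'I_l -> vdual a) (n : 'I_l -> nat) (h : 'I_l -> subvs_of a).
Variable (i : 'I_l).
Hypothesis tkg : third_kind_graded tau b lam n h i.
Local Notation hh := (vsval (h i)).
Local Notation E := (characteristic_gradation hh).
Local Notation gC := (complexify gs).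
Local Notation gCR := (realify (complexify gs)).
Local Notation EC p := (leigenspace (ad (creal hh : gC)) p%:~R).
Local Notation g := (compact_dual tau).
Let tauP := tkg_cartan tkg.
Let aP := tkg_maximal_abelian tkg.
Local Notation sigma := (Ad_exp (half_pi_i (creal hh))).
Implicit Types X Y : gC.

Lemma third_kind_graded_sum : (\sum_(k < 7) EC (k%:Z - 3))%VS = fullv.
Proof.
apply/eqP; rewrite eqEsubv subvf /=; apply/subvP=> Y _.
have [e [eE ->]] := complex_gradation_span tkg Y.
by apply: memv_suml => k _; apply: (memv_sum_at (k := k)); apply: eE.
Qed.
Let gr := third_kind_graded_sum.

(** The conjugation of [gC] whose fixed points are the compact dual. *)
Definition compact_conj X : gC := (tau X.1, - tau X.2).

Lemma compact_conjP X : X \in (g : {vspace gCR}) <-> compact_conj X = X.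
Proof.
rewrite compact_dualP; split=> [[/cartan_kP X1 /cartan_pP X2]|XE].
  by apply: complexify_eqP; rewrite /= ?X1 // X2 opprK.
split; first by apply/cartan_kP; rewrite -[in RHS]XE.
by apply/cartan_pP; rewrite -[in RHS]XE /= opprK.
Qed.

Lemma compact_conjD X Y : compact_conj (X + Y) = compact_conj X + compact_conj Y.
Proof. by rewrite /compact_conj complexifyD /= !linearD. Qed.

Lemma compact_conjZ c X : compact_conj (c *: X) = (c^*)%C *: compact_conj X.
Proof.
case: c => c d; rewrite /compact_conj !complexify_scaleE; apply: complexify_eqP => /=.
  by rewrite linearB !linearZ /= scalerN scaleNr opprK.
by rewrite linearD !linearZ /= scalerN scaleNr opprD.
Qed.

Lemma compact_conj_degree p X : X \in EC p -> compact_conj X \in EC (- p).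
Proof.
move=> /complex_gradationP[X1 X2]; apply/complex_gradationP.
by split; rewrite /= ?memvN; apply: (gradation_tau tkg).
Qed.

Lemma sigma_compact_conj X : sigma (compact_conj X) = compact_conj (sigma X) :> gC.
Proof.
elim/(homogeneous_ind gr): X => [|X Y IX IY|p X XE].
- have -> : compact_conj 0 = 0.
    by apply: complexify_eqP; rewrite /= ?linear0 ?oppr0.
  by rewrite !(linear0 sigma); apply: complexify_eqP; rewrite /= ?linear0 ?oppr0.
- by rewrite compact_conjD !quarter_turnD compact_conjD IX IY.
rewrite (quarter_turnE gr XE) (quarter_turnE gr (compact_conj_degree XE)) compact_conjZ.
by rewrite exprz_i_conj.
Qed.

Lemma sigma_compact_dual X : X \in (g : {vspace gCR}) -> sigma X \in g.
Proof.
by move=> /compact_conjP XE; apply/compact_conjP; rewrite -sigma_compact_conj XE.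
Qed.

Lemma sigma_aut : lie_aut_on g sigma.
Proof.
split; last by move=> X Y _ _; apply: (quarter_turn_lie gr).
apply/eqP; rewrite eqEdim limg_dim_eq ?leqnn ?andbT.
  by apply/subvP=> _ /memv_imgP[X XE ->]; apply: sigma_compact_dual.
by rewrite (eqP (quarter_turn_lker0 gr)) capv0.
Qed.

(** [sigma ^ m] fixes [x + tau x], of components in degrees 1 and -1, only if
    [i ^ m = 1]. *)
Lemma sigma_order : order_on g sigma 4.
Proof.
split=> // [X _|m m14 mid]; first exact: (quarter_turn4 gr).
have [_ _ _ _ /vspace_neq0P[x xE x0]] := tkg_kind tkg.
have XE : (creal x : gC) \in EC 1 by apply/complex_gradationP; rewrite /= mem0v.
have YE : (creal (tau x) : gC) \in EC (- 1).
  by apply/complex_gradationP; rewrite /= mem0v; split=> //; apply: (gradation_tau tkg).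
have iterD X Y : iter m sigma (X + Y) = iter m sigma X + iter m sigma Y :> gC.
  by elim: (m) => //= k ->; rewrite quarter_turnD.
have : iter m sigma (creal x + creal (tau x)) = creal x + creal (tau x) :> gC.
  apply: mid; apply/compact_conjP; rewrite /compact_conj /= !addr0 linear0 oppr0.
  by rewrite linearD /= (cartanK tauP) addrC complexifyD /= addr0.
rewrite iterD (quarter_turn_iter gr m XE) (quarter_turn_iter gr m YE) => /eqP; rewrite -subr_eq0 opprD addrACA.
rewrite -{2}[creal x]scale1r -{2}[creal (tau x)]scale1r -!scalerBl => /eqP s0.
have := degrees_disjoint (isT : 1 != - 1 :> int) (memvZ _ XE) (memvZ _ YE) s0.
move=> /eqP; rewrite scaler_eq0 => /orP[|/eqP []//].
rewrite subr_eq0; move: m14; case: m {mid iterD s0} => [|[|[|[|//]]]] // _.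
- by rewrite expr1 expr1z eq_complex /= oner_eq0 andbF.
- by rewrite expr1z sqr_i -subr_eq0 -opprD oppr_eq0 -mulr2n pnatr_eq0.
by rewrite expr1z exprS sqr_i mulrN1 eq_complex /= oppr_eq0 oner_eq0 andbF.
Qed.

(** The fixed points of [sigma] in the compact dual are those of degree 0, and
    both components of a central one centralize [E 0]. *)
Lemma sigma_center : lie_center (g :&: fixedSpace sigma) = <[(cimag hh : gCR)]>%VS.
Proof.
have /cartan_pP hp := restricted_p aP (h i).
have fixP (X : gCR) : X \in (g :&: fixedSpace sigma)%VS <->
    [/\ X.1 \in cartan_k tau, X.2 \in cartan_p tau, X.1 \in E 0 & X.2 \in E 0].
  rewrite memv_cap; split=> [/andP[/compact_dualP[X1 X2] /(quarter_turn_fixed gr)/complex_gradationP[]]|].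
    by split.
  move=> [X1 X2 X10 X20]; apply/andP; split; first exact/compact_dualP.
  by apply/(quarter_turn_fixed gr)/complex_gradationP.
have hE : hh \in E 0 by apply/gradationP; rewrite liexx scale0r.
apply/vspaceP=> X; apply/idP/idP => [/lie_centerP[/fixP[X1 X2 X10 X20] Xc]|/vlineP[c ->]].
  (* [u + tau u] and [i (u - tau u)] are fixed points of [sigma] in the dual. *)
  have half u : u \in E 0 -> lie u X.1 = 0 /\ lie u X.2 = 0.
    move=> uE; have tuE : tau u \in E 0.
      by have := gradation_tau tkg uE; rewrite oppr0.
    have kE : (creal (u + tau u) : gCR) \in (g :&: fixedSpace sigma)%VS.
      apply/fixP; split; rewrite /= ?mem0v //; last exact: memvD.
      by apply/cartan_kP; rewrite linearD /= (cartanK tauP) addrC.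
    have pE : (cimag (u - tau u) : gCR) \in (g :&: fixedSpace sigma)%VS.
      apply/fixP; split; rewrite /= ?mem0v //; last exact: memvB.
      by apply/cartan_pP; rewrite linearB /= (cartanK tauP) opprB.
    have [k1 k2] : lie (u + tau u) X.1 = 0 /\ lie (u + tau u) X.2 = 0.
      by have := Xc _ kE; rewrite -[lie _ _]/(lie (creal _ : gC) X) creal_lieE; case.
    have [p1 p2] : lie (u - tau u) X.1 = 0 /\ lie (u - tau u) X.2 = 0.
      have := Xc _ pE; rewrite -[lie _ _]/(lie (cimag _ : gC) X) complexify_lieE /=.
      by rewrite !lie0l sub0r add0r => -[/eqP]; rewrite oppr_eq0 => /eqP.
    have uu : u = (2 : R)^-1 *: ((u + tau u) + (u - tau u)).
      rewrite addrACA subrr addr0 (_ : u + u = (2 : R) *: u); last by rewrite scaler_nat.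
      by rewrite scalerA mulVf ?scale1r // pnatr_eq0.
    by rewrite uu !lieZl !(lieDl (u + tau u)) k1 k2 p1 p2 !addr0 !scaler0.
  have c1 : central0 h i X.1.
    by split=> // u uE; rewrite lieC (half u uE).1 oppr0.
  have c2 : central0 h i X.2.
    by split=> // u uE; rewrite lieC (half u uE).2 oppr0.
  have X10' : X.1 = 0 by apply: (central0_k tkg c1 X1).
  have /vlineP[c X2c] := third_kind_center tkg c2.
  apply/vlineP; exists c; rewrite rscaleE complexify_realscaleE.
  by apply: complexify_eqP; rewrite /= ?scaler0 // X2c.
have hfix : (cimag hh : gCR) \in (g :&: fixedSpace sigma)%VS.
  by apply/fixP; rewrite /= !mem0v; split=> //; apply/cartan_pP.
apply/lie_centerP; split=> [|u /fixP[_ _ /gradationP u1 /gradationP u2]]; first exact: memvZ.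
rewrite linearZ /=; apply/eqP; rewrite scaler_eq0; apply/orP; right.
rewrite -[lie _ _]/(lie (u : gC) (cimag hh)) complexify_lieE /= !lie0r sub0r addr0.
by rewrite (lieC u.1) (lieC u.2) u1 u2 !scale0r !oppr0.
Qed.

Lemma sigma_center_dim : \dim (lie_center (g :&: fixedSpace sigma)) = 1%N.
Proof.
rewrite sigma_center dim_vline; case: eqP => // -[/eqP h0].
have := tkg_dual tkg i i; rewrite eqxx.
suff -> : h i = 0 by move/eqP; rewrite linear0 eq_sym oner_eq0.
by apply: (can_inj vsvalK); rewrite linear0; apply/eqP.
Qed.

(** [tau] exchanges the degrees [p] and [- p], on which [sigma] acts by
    [i ^ p] and its inverse. *)
Lemma sigma_reversed X : complexify_lfun tau (sigma X) = (sigma^-1)%VF (complexify_lfun tau X).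
Proof.
have tauE := complexify_lfunE tau.
have sts Y : sigma (complexify_lfun tau (sigma Y)) = complexify_lfun tau Y.
  elim/(homogeneous_ind gr): Y => [|Y Z IY IZ|p Y YE].
  - by rewrite !linear0.
  - by rewrite quarter_turnD !(linearD (complexify_lfun tau)) /= quarter_turnD IY IZ.
  have tYE : complexify_lfun tau Y \in EC (- p).
    move: YE => /complex_gradationP[Y1 Y2]; rewrite tauE; apply/complex_gradationP.
    by split; apply: (gradation_tau tkg).
  have tZ c : complexify_lfun tau (c *: Y) = c *: (complexify_lfun tau Y : gC) :> gC.
    rewrite !tauE !complexify_scaleE; apply: complexify_eqP => /=.
      by rewrite linearB !linearZ.
    by rewrite linearD !linearZ.
  rewrite (quarter_turnE gr YE) tZ (quarter_turnE gr (p := - p)) ?memvZ // scalerA -exprzDr ?subrr ?scale1r //.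
    by rewrite addNr expr0z scale1r.
  by rewrite unitfE neq0Ci.
by rewrite -(sts X) lker0_lfunK // (quarter_turn_lker0 gr).
Qed.

End PartOne.

(** * Compact simple Lie algebras *)

Section CompactSimple.
Variables (R : realType) (g : lieAlgType R).
Local Notation gC := (complexify g).
Local Notation gCR := (realify (complexify g)).
Hypothesis cptg : lie_compact g.
Hypothesis simg : lie_simple g.
Implicit Types (x y u v : g) (X Y : gC).

(** An ideal [U] of the complexification meets [g] in [0] or [g]. If it meets it
    in [0] and projects onto [g], then [U] is the graph of a complex structure
    [J] with [[J x, y] = J [x, y]], whence [B(J x, J x) = - B(x, x)]: the Killing
    form [B] cannot be definite. *)
Lemma compact_complexify_simple : lie_simple gC.
Proof.
split=> [ab|U idU].
  case: simg => nab _; apply: nab => x y _ _.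
  have := ab (creal x) (creal y) (memvf _) (memvf _).
  by rewrite creal_lieE => -[].
have [A AE] : exists A : {vspace g}, forall x, x \in A <-> (creal x : gC) \in U.
  apply: vspace_of_pred => [|c x y xU yU]; first exact: mem0v.
  by rewrite crealD crealZ memvD ?memvZ.
have [B BE] : exists B : {vspace g}, forall x, x \in B <-> exists y, ((x, y) : gC) \in U.
  apply: vspace_of_pred => [|c x y [x' xU] [y' yU]]; first by exists 0; apply: mem0v.
  exists (c *: x' + y').
  have -> : (c *: x + y, c *: x' + y') = c%:C%C *: ((x, x') : gC) + (y, y').
    by rewrite complexify_realscaleE.
  by rewrite memvD ?memvZ.
have idA : lie_ideal A.
  by move=> x y /AE yU; apply/AE; rewrite creal_lie; apply: idU.
have idB : lie_ideal B.
  move=> x y /BE[y' yU]; apply/BE; exists (lie x y').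
  by have := idU (creal x) _ yU; rewrite creal_lieE.
have imU x y : ((x, y) : gC) \in U -> ((- y, x) : gC) \in U.
  by move=> xyU; have := memvZ 'i%C xyU; rewrite complexify_iscaleE.
case: simg => _ /[dup] /(_ A idA)[A0|A1] /(_ B idB)[B0|B1].
- left; apply/eqP; rewrite -subv0; apply/subvP=> -[x y] xyU; rewrite memv0.
  have /BE : exists y, ((x, y) : gC) \in U by exists y.
  have /BE : exists z, ((- y, z) : gC) \in U by exists x; apply: imU.
  by rewrite B0 !memv0 oppr_eq0 => /eqP -> /eqP ->.
- exfalso.
  have /choice[j jU] x : exists y, ((x, y) : gC) \in U by apply/BE; rewrite B1 memvf.
  have juniq x y : ((x, y) : gC) \in U -> y = j x.
    move=> xyU; have := memvB xyU (jU x); rewrite complexifyN complexifyD /= subrr.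
    move=> /imU/imU/imU; rewrite opprK !oppr0 => /AE.
    by rewrite A0 memv0 subr_eq0 => /eqP.
  have jlin : linear j.
    move=> c x y; apply/esym/juniq.
    have -> : (c *: x + y, c *: j x + j y) = c%:C%C *: ((x, j x) : gC) + (y, j y).
      by rewrite complexify_realscaleE.
    by rewrite memvD ?memvZ.
  pose J : 'End(g) := linfun j.
  have JE : J =1 j := linear_linfun jlin.
  have Jlie x y : J (lie x y) = lie x (J y).
    rewrite !JE; apply/esym/juniq.
    by have := idU (creal x) _ (jU y); rewrite creal_lieE.
  have JJ x : J (J x) = - x.
    rewrite !JE; have /juniq e := imU _ _ (jU x).
    by have := linearN J (j x); rewrite /= !JE -e => xE; rewrite [in RHS]xE opprK.
  have adJ x : ad (J x) = (J \o ad x)%VF.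
    by apply/lfunP=> y; rewrite !lfunSE !adE lieC -Jlie (lieC y) linearN opprK.
  have Jad x : (J \o ad x)%VF = (ad x \o J)%VF.
    by apply/lfunP=> y; rewrite !lfunSE !adE Jlie.
  have kJ x : killing (J x) (J x) = - killing x x.
    rewrite /killing !adJ {2}Jad lfun_trace_comp -comp_lfunA (comp_lfunA J J) -lfun_traceN.
    have -> : (J \o J)%VF = - \1%VF.
      by apply/lfunP=> y; rewrite !lfunSE JJ.
    by rewrite comp_lfunNl comp_lfun1l comp_lfunNr.
  have [x [y xy]] : exists x y, lie x y <> 0.
    apply: contrapT => no; case: simg => nab _; apply: nab => x y _ _.
    by apply: contrapT => xy; apply: no; exists x, y.
  have x0 : x <> 0 by move=> x0; apply: xy; rewrite x0 lie0l.
  have := cptg x0; rewrite -oppr_gt0 -kJ => Jx; case: (pselect (J x = 0)) => J0.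
    by rewrite J0 killing0l ltxx in Jx.
  by have := lt_trans Jx (cptg J0); rewrite ltxx.
all: right; apply/eqP; rewrite eqEsubv subvf /=; apply/subvP=> X _.
all: rewrite (complexifyE X) memvD ?memvZ //; apply/AE; rewrite A1 memvf //.
Qed.

Definition compact_form x y := - killing x y.
Local Notation q := compact_form.

Lemma compact_formP : inner_product q.
Proof.
rewrite /q; split=> [x y z|c x z|x y|x /cptg].
- by rewrite killingDl opprD.
- by rewrite killingZl mulrN.
- by rewrite killingC.
- by rewrite oppr_gt0.
Qed.
Let qP := compact_formP.

Lemma compact_form_skew u x y : q (lie u x) y = - q x (lie u y).
Proof. by rewrite /q lieC killingNl killing_lie. Qed.

(** The real part of the hermitian form on the complexification that extends
    [compact_form]. *)
Definition hermitian_real_part (X Y : gCR) := q X.1 Y.1 + q X.2 Y.2.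
Local Notation qC := hermitian_real_part.

Lemma hermitian_real_partP : inner_product qC.
Proof.
rewrite /qC; split=> [X Y Z|c X Z|X Y|X X0].
- by rewrite !(innerDl qP) addrACA.
- by rewrite rscaleE complexify_realscaleE /= !(innerZl qP) mulrDr.
- by rewrite !(innerC qP _ Y.1) !(innerC qP _ Y.2).
case: (pselect (X.1 = 0)) => [X1|X1]; last first.
  by rewrite ltr_wpDr ?(inner_gt0 qP) ?(inner_ge0 qP).
rewrite ltr_wpDl ?(inner_ge0 qP) // (inner_gt0 qP) // => X2.
by apply: X0; apply: complexify_eqP.
Qed.
Let qCP := hermitian_real_partP.

Lemma cimag_lieE v X : lie (cimag v : gC) X = (- lie v X.2, lie v X.1) :> gC.
Proof. by rewrite complexify_lieE /= !lie0l sub0r add0r. Qed.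

Lemma cimag_symmetric v : symmetric_for qC (ad (cimag v : gCR)).
Proof.
move=> X Y; rewrite !adE -[lie _ X]/(lie (cimag v : gC) X) -[lie _ Y]/(lie (cimag v : gC) Y).
rewrite !cimag_lieE /qC /= (innerNl qP) !compact_form_skew opprK.
by rewrite -[X in _ = q _ X + _]scaleN1r (innerZr qP) mulN1r addrC.
Qed.

End CompactSimple.

(** * Roots and characteristic elements of a compact Lie algebra *)

Lemma complexify_vsP (R : rcfType) (g : lieAlgType R) (t : {vspace g}) (X : complexify g) :
  X \in complexify_vs t <-> (X.1 \in t /\ X.2 \in t).
Proof.
split=> [|[X1 X2]].
  have [S SE] : exists S : {vspace complexify g},
      forall Y : complexify g, Y \in S <-> Y.1 \in t /\ Y.2 \in t.
    apply: vspace_of_pred => [|c Y Z [Y1 Y2] [Z1 Z2]]; first by rewrite !mem0v.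
    rewrite complexifyD complexify_scaleE /=.
    by split; rewrite memvD ?memvB ?memvD ?memvZ.
  suff /subvP/[apply] : (complexify_vs t <= S)%VS by move/SE.
  apply/span_subvP=> _ /mapP[x /vbasis_mem xt ->].
  by apply/SE; rewrite mem0v.
have tC x : x \in t -> (creal x : complexify g) \in complexify_vs t.
  move=> xt; rewrite (coord_vbasis xt).
  have -> : creal (\sum_j coord (vbasis t) j x *: (vbasis t)`_j)
      = \sum_j (coord (vbasis t) j x)%:C%C *: creal (vbasis t)`_j :> complexify g.
    rewrite (big_morph (@creal R g) (@crealD R g) (id1 := 0)) //.
    by apply: eq_bigr => j _; rewrite crealZ.
  apply: memv_suml => j _; apply: memvZ; apply: memv_span; apply: map_f.
  by rewrite mem_nth // size_tuple.
by rewrite (complexifyE X) memvD ?memvZ ?tC.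
Qed.

Section CompactRoots.
Variables (R : realType) (g : lieAlgType R) (t : {vspace g}).
Local Notation gC := (complexify g).
Local Notation gCR := (realify (complexify g)).
Local Notation tC := (complexify_vs t).
Hypothesis cptg : lie_compact g.
Hypothesis simg : lie_simple g.
Hypothesis tP : maximal_abelian_in fullv t.
Implicit Types (x y u v : g) (X Y : gC) (mu : vdual tC).
Local Notation qC := (@hermitian_real_part R g).
Let qCP := hermitian_real_partP cptg.

Lemma complexified_torus_abelian : abelian_vs tC.
Proof.
have [_ tab _] := tP.
move=> X Y /complexify_vsP[X1 X2] /complexify_vsP[Y1 Y2].
by rewrite complexify_lieE !tab // subrr addr0.
Qed.

Lemma cimag_in_torus x : x \in t -> cimag x \in tC.
Proof. by move=> xt; apply/complexify_vsP; rewrite mem0v. Qed.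

Lemma complexified_weight_exists (W : {vspace gC}) :
    W <> 0%VS -> (forall H X, H \in tC -> X \in W -> lie H X \in W) ->
  exists mu X, [/\ X \in W, X <> 0 & weight_vector mu X].
Proof.
move=> W0 tW; apply: weight_exists => //; first exact: complexified_torus_abelian.
by move=> H _ U _ U0 stU; apply: closed_eigenvector.
Qed.

(** [ad (i v)] is symmetric for the real part of the hermitian form. *)
Lemma weight_real mu X v : X <> 0 -> weight_vector mu X -> v \in t ->
  exists c : R, mu (vsproj tC (cimag v)) = c%:C%C.
Proof.
move=> X0 Xmu vt.
have := Xmu (vsproj tC (cimag v)); rewrite vsprojK ?cimag_in_torus //.
case: (mu _) => c d Xcd.
have := cimag_symmetric cptg v (X : gCR) ('i%C *: X : gC).
rewrite !adE -[lie _ _ in LHS]/(lie (cimag v : gC) X).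
rewrite -[X in qC _ X = _]/('i%C *: X : gC) -[lie _ _ in RHS]/(lie (cimag v : gC) ('i%C *: X)).
rewrite lieZr Xcd !complexify_iscaleE !complexify_scaleE /hermitian_real_part /=.
have qP := compact_formP cptg.
rewrite !(innerDl qP, innerNl qP, innerDr qP) -!(scaleN1r X.2) -!(scaleN1r (_ + _)).
rewrite !(innerZl qP, innerZr qP, innerDr qP) (innerC qP X.2 X.1) => e.
have p : 0 < qC X X by apply: (inner_gt0 qCP).
have : d * qC X X = 0.
  move: e; rewrite /hermitian_real_part -(scaleNr d X.2) (innerZr qP) => e; lra.
by move/eqP; rewrite mulf_eq0 (gt_eqF p) orbF => /eqP ->; exists c.
Qed.

Local Notation ti v := (vsproj tC (cimag v)).

(** Elements of the complexified torus are written with [i t], where roots are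
    real. *)
Lemma complexified_torus_decomposition (H : subvs_of tC) : exists u v, [/\ u \in t, v \in t &
  H = - 'i%C *: ti u + ti v].
Proof.
have /complexify_vsP[H1 H2] := subvsP H.
exists (vsval H).1, (vsval H).2; split=> //.
apply: (can_inj vsvalK); rewrite vsvalD vsvalZ !vsprojK ?cimag_in_torus //.
rewrite scaleNr complexify_iscaleE complexifyN complexifyD.
by apply: complexify_eqP; rewrite /= ?opprK ?addr0 ?oppr0 ?add0r.
Qed.

(** Roots are imaginary on [t], so conjugating a root vector changes the sign of
    the root. *)
Lemma weight_conj mu X : X <> 0 -> weight_vector mu X -> weight_vector (- mu) (cconj X).
Proof.
move=> X0 Xmu.
have real v : v \in t -> lie (cimag v) (cconj X) = - mu (ti v) *: cconj X.
  move=> vt; have [c mc] := weight_real X0 Xmu vt.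
  have := congr1 (@cconj R g) (Xmu (ti v)).
  rewrite mc vsprojK ?cimag_in_torus // cconj_lie cconjZ conjc_real scaleNr => <-.
  have -> : cconj (cimag v) = - cimag v :> gC.
    by rewrite /cconj complexifyN /= oppr0.
  by rewrite lieNl opprK.
move=> H; have [u [v [ut vt ->]]] := complexified_torus_decomposition H.
rewrite vsvalD vsvalZ !vsprojK ?cimag_in_torus // lieDl lieZl !real //.
have muE : mu (- 'i%C *: ti u + ti v) = - 'i%C * mu (ti u) + mu (ti v) :> R[i].
  by rewrite linearD linearZ.
by rewrite scalerA -scalerDl opp_lfunE muE opprD mulrN.
Qed.

(** If [ad u] were not zero, a nonzero eigenvalue of the symmetric operator
    [ad (i u)] would be the value of a root. *)
Lemma roots_separate u : u \in t ->
  (forall mu, lie_root mu -> mu (ti u) = 0) -> u = 0.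
Proof.
move=> ut mu0; apply: (simple_center0 simg) => x.
suff : lie (cimag u : gC) (creal x) = 0 by rewrite cimag_lieE /= => -[].
rewrite -[lie _ _]/(lie (cimag u : gCR) (creal x)) -adE.
have sU := cimag_symmetric cptg u.
apply: (symmetric_eq0 qCP sU (W := fullv)) (memvf _) => [Y _|c Y _ Y0 Yc]; first exact: memvf.
have [||mu [X [/leigenspaceP + X0 Xmu]]] :=
    complexified_weight_exists (W := leigenspace (ad (cimag u : gC)) c%:C%C).
- by apply/vspace_neq0P; exists Y => //; apply/leigenspaceP; rewrite adE -rscaleE -Yc adE.
- move=> H X HtC /leigenspaceP Xc; apply/leigenspaceP; rewrite adE lie_der.
  by rewrite (complexified_torus_abelian (cimag_in_torus ut) HtC) lie0l add0r -(adE (cimag u : gC)) Xc lieZr.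
rewrite adE; have := Xmu (ti u); rewrite vsprojK ?cimag_in_torus // => ->.
have -> : mu (ti u) = 0.
  case: (pselect (mu = 0)) => [->|m0]; first by rewrite zero_lfunE.
  by apply: mu0; apply: weight_vector_root X0 Xmu.
rewrite scale0r => /esym/eqP; rewrite scaler_eq0 => /orP[|/eqP //].
by rewrite eq_complex /= => /andP[/eqP].
Qed.

Section CharacteristicElement.
Variables (n : nat) (alpha : 'I_n -> vdual tC) (m : 'I_n -> nat) (i : 'I_n).
Variable (K : 'I_n -> subvs_of tC).
Hypothesis alphaP : root_base alpha.
Hypothesis highP : highest_root alpha (\sum_j (m j)%:R *: alpha j).
Hypothesis dualP : forall j k, alpha j (K k) = (j == k)%:R.
Hypothesis mi : m i = 3%N.
Local Notation Ki := (vsval (K i)).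

Lemma sum_alphaE (c : 'I_n -> R[i]) (H : subvs_of tC) :
  (\sum_j c j *: alpha j) H = \sum_j c j * alpha j H.
Proof. by rewrite sum_lfunE; apply: eq_bigr => j _; rewrite scale_lfunE. Qed.

Lemma sum_alphaK (c : 'I_n -> R[i]) : (\sum_j c j *: alpha j) (K i) = c i.
Proof.
rewrite sum_alphaE (bigD1 i) //= dualP eqxx mulr1 big1 ?addr0 // => j ji.
by rewrite dualP (negbTE ji) mulr0.
Qed.

Lemma simple_roots_separate u : u \in t -> (forall j, alpha j (ti u) = 0) -> u = 0.
Proof.
move=> ut a0; apply: roots_separate => // mu rmu.
have s0 (k : 'I_n -> nat) : (\sum_j (k j)%:R *: alpha j) (ti u) = 0.
  by rewrite sum_alphaE big1 // => j _; rewrite a0 mulr0.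
have [_ _ /(_ mu rmu)[k [->|->]]] := alphaP; first exact: s0.
by rewrite opp_lfunE s0 oppr0.
Qed.

Lemma alpha_root_vector j : exists2 X, X <> 0 & weight_vector (alpha j) X.
Proof. by have [/(_ j)[_ [X X0 XP]] _ _] := alphaP; exists X. Qed.

(** [Z] is [i K_i]. The roots are real on [i t] and on [K_i], hence vanish on the
    component of [K_i] in [t]. *)
Lemma characteristic_element : exists Z, [/\ Z \in t, Ki = - cimag Z &
  creal Z = 'i%C *: Ki].
Proof.
have [u [v [ut vt KE]]] := complexified_torus_decomposition (K i).
have u0 : u = 0.
  apply: simple_roots_separate => // j; have [X X0 Xj] := alpha_root_vector j.
  have [c cE] := weight_real X0 Xj ut; have [d dE] := weight_real X0 Xj vt.
  have := dualP j i; rewrite KE linearD linearZ /= cE dE.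
  have -> : (j == i)%:R = ((j == i)%:R : R)%:C%C by rewrite rmorph_nat.
  move/eqP; rewrite eq_complex /= => /andP[_].
  by rewrite !(mul0r, mulr0, mulN1r, oppr0, add0r, addr0) oppr_eq0 => /eqP ->.
have KE' : Ki = cimag v.
  rewrite KE u0 vsvalD vsvalZ !vsprojK ?cimag_in_torus ?mem0v //.
  by rewrite (_ : cimag 0 = 0) // scaler0 add0r.
exists (- v); split; rewrite ?memvN //.
  by rewrite KE' complexifyN /= opprK oppr0.
by rewrite KE' complexify_iscaleE.
Qed.

(** The coefficient of [alpha i] in a root is at most [m i = 3], and the opposite
    of a root is a root. *)
Lemma root_integral mu : lie_root mu -> exists p : int, (`|p| <= 3)%N /\ mu (K i) = p%:~R.
Proof.
have le3 nu : lie_root nu -> exists2 p : int, p <= 3 & nu (K i) = p%:~R.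
  move=> rnu; have [_ /(_ nu rnu)[k e]] := highP.
  exists (3 - (k i)%:Z); first by lia.
  have := congr1 (fun f : vdual tC => f (K i)) e.
  rewrite /= add_lfunE opp_lfunE !sum_alphaK mi => /eqP.
  by rewrite subr_eq addrC -subr_eq => /eqP <-; rewrite intrB.
move=> /[dup] /le3[p p3 pE] [mu0 [X X0 Xmu]].
have [|r r3 rE] := le3 (- mu).
  apply: (weight_vector_root _ _ (weight_conj X0 Xmu)).
    by move=> /eqP; rewrite oppr_eq0 => /eqP.
  by move=> c0; apply: X0; rewrite -[X]cconjK c0 /cconj /= oppr0.
exists p; split=> //.
have /eqP : p%:~R = (- r)%:~R :> R[i] by rewrite -pE mulrNz -rE opp_lfunE opprK.
by rewrite eqr_int => /eqP; lia.
Qed.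

Local Notation EK p := (leigenspace (ad (Ki : gC)) p%:~R).

(** [ad Ki] is symmetric for the real part of the hermitian form, and each of its
    eigenvalues is the value at [K i] of a root or of 0. *)
Lemma characteristic_graded : (\sum_(k < 7) EK (k%:Z - 3))%VS = fullv.
Proof.
have [Z [Zt KZ _]] := characteristic_element.
set S := (\sum_(k < 7) EK (k%:Z - 3))%VS.
have inS (p : int) X : (`|p| <= 3)%N -> X \in EK p -> X \in S.
  move=> p3 Xp; have k7 : (absz (p + 3)%R < 7)%N by lia.
  apply: (memv_sum_at (k := Ordinal k7)).
  by rewrite /= (_ : (absz (p + 3)%R)%:Z - 3 = p); last lia.
have [S' S'E] : exists S' : {vspace gCR}, forall X, X \in S' <-> (X : gC) \in S.
  apply: vspace_of_pred => [|c X Y XS YS]; first exact: mem0v.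
  by rewrite rscaleE memvD ?memvZ.
suff S'f : S' = fullv.
  by apply/vspaceP=> X; rewrite memvf; apply/S'E; rewrite S'f; apply: memvf.
have KE (X : gC) : lie Ki X = lie (cimag (- Z) : gC) X.
  by rewrite KZ; congr lie; apply: complexify_eqP; rewrite /= ?oppr0.
apply: (symmetric_eigenvectors_span qCP (cimag_symmetric cptg (- Z))) => [X /S'E XS|c X].
  apply/S'E; rewrite adE -[lie _ _]/(lie (cimag (- Z) : gC) X) -KE.
  have /memv_sumP[e eE ->] := XS; rewrite linear_sum; apply: memv_suml => k _ /=.
  have /leigenspaceP := eE k isT; rewrite adE => ->.
  by apply: memvZ; apply: (memv_sum_at (k := k)); apply: eE.
rewrite adE -[lie _ _]/(lie (cimag (- Z) : gC) X) -KE rscaleE => Xc; apply/S'E.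
case: (pselect (X = 0)) => [->|X0]; first exact: mem0v.
have [||mu [Y [/leigenspaceP Yc Y0 Ymu]]] :=
    complexified_weight_exists (W := leigenspace (ad (Ki : gC)) c%:C%C).
- by apply/vspace_neq0P; exists X => //; apply/leigenspaceP; rewrite adE.
- move=> H Y HtC /leigenspaceP Yc; apply/leigenspaceP; rewrite adE lie_der.
  by rewrite (complexified_torus_abelian (subvsP _) HtC) lie0l add0r -(adE Ki) Yc lieZr.
have [p [p3 pE]] : exists p : int, (`|p| <= 3)%N /\ mu (K i) = p%:~R.
  case: (pselect (mu = 0)) => [->|m0]; first by exists 0; rewrite zero_lfunE.
  by apply: root_integral; apply: weight_vector_root Y0 Ymu.
apply: (inS p) => //; apply/leigenspaceP; rewrite adE Xc; congr (_ *: _).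
move: Yc; rewrite adE (Ymu (K i)) pE => /eqP.
by rewrite -subr_eq0 -scalerBl scaler_eq0 subr_eq0 => /orP[/eqP //|/eqP].
Qed.

End CharacteristicElement.

End CompactRoots.

(** * Involutions that reverse the automorphism of order four *)

Section Reversal.
Variables (R : realType) (g : lieAlgType R) (t : {vspace g}).
Local Notation gC := (complexify g).
Local Notation gCR := (realify (complexify g)).
Local Notation tC := (complexify_vs t).
Hypothesis cptg : lie_compact g.
Hypothesis simg : lie_simple g.
Hypothesis tP : maximal_abelian_in fullv t.
Variables (n : nat) (alpha : 'I_n -> vdual tC) (m : 'I_n -> nat) (i : 'I_n).
Variable (K : 'I_n -> subvs_of tC).
Hypothesis alphaP : root_base alpha.
Hypothesis highP : highest_root alpha (\sum_j (m j)%:R *: alpha j).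
Hypothesis dualP : forall j k, alpha j (K k) = (j == k)%:R.
Hypothesis mi : m i = 3%N.
Local Notation Ki := (vsval (K i)).
Local Notation EK p := (leigenspace (ad (Ki : gC)) p%:~R).
Variable Z : g.
Hypothesis Zt : Z \in t.
Hypothesis KZ : Ki = - cimag Z.
Local Notation ti v := (vsproj tC (cimag v)).
Let gr := characteristic_graded cptg simg tP alphaP highP dualP mi.
Implicit Types (x y u v : g) (X Y : gC).

Lemma characteristic_lieE X : lie Ki X = (lie Z X.2, - lie Z X.1) :> gC.
Proof. by rewrite KZ lieNl cimag_lieE complexifyN /= opprK. Qed.

Lemma characteristic_degree0 x : (creal x : gC) \in EK 0 <-> lie Z x = 0.
Proof.
split=> [/leigenspaceP|Zx]; last apply/leigenspaceP; rewrite adE characteristic_lieE scale0r /= lie0r.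
  by case=> /eqP; rewrite oppr_eq0 => /eqP.
by rewrite Zx oppr0.
Qed.

Lemma simple_root_characteristic j : alpha j (ti Z) = - (j == i)%:R.
Proof.
have -> : ti Z = - K i.
  by apply: (can_inj vsvalK); rewrite vsprojK ?cimag_in_torus // linearN /= KZ opprK.
by rewrite linearN /= dualP.
Qed.

Lemma characteristic_neq0 : Z <> 0.
Proof.
move=> Z0; have := simple_root_characteristic i; rewrite Z0 eqxx.
have -> : ti 0 = 0.
  by apply: (can_inj vsvalK); rewrite vsprojK ?cimag_in_torus ?mem0v // linear0.
by move/eqP; rewrite linear0 eq_sym oppr_eq0 oner_eq0.
Qed.

(** Such an [x] lies in [t] and is killed by every simple root except [alpha i];
    the value of [alpha i] fixes the multiple of [Z]. *)
Lemma characteristic_center x : lie Z x = 0 ->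
  (forall y, lie Z y = 0 -> lie x y = 0) -> x \in <[Z]>%VS.
Proof.
move=> Zx xc; have [_ tab _] := tP.
have xt : x \in t.
  apply: (maximal_abelianP tP (memvf x)) => u ut.
  by rewrite lieC xc ?oppr0 //; apply: tab.
have aj j : j != i -> alpha j (ti x) = 0.
  move=> ji; have [X X0 Xa] := alpha_root_vector alphaP j.
  have := Xa (K i); rewrite dualP (negbTE ji) scale0r characteristic_lieE => -[X2 /eqP].
  rewrite oppr_eq0 => /eqP X1.
  have := Xa (ti x); rewrite vsprojK ?cimag_in_torus // cimag_lieE !xc // oppr0.
  by move=> /esym/eqP; rewrite scaler_eq0 => /orP[/eqP //|/eqP].
have [X X0 Xa] := alpha_root_vector alphaP i.
have [c ac] := weight_real cptg X0 Xa xt.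
suff : x + c *: Z = 0.
  by move=> /eqP; rewrite addr_eq0 => /eqP ->; rewrite memvN memvZ ?memv_line.
have xcZt : x + c *: Z \in t by rewrite memvD ?memvZ.
apply: (simple_roots_separate cptg simg tP alphaP) => // j.
have -> : ti (x + c *: Z) = ti x + c%:C%C *: ti Z.
  apply: (can_inj vsvalK); rewrite vsvalD vsvalZ !vsprojK ?cimag_in_torus //.
  by rewrite complexify_realscaleE /cimag /= scaler0 complexifyD /= addr0.
rewrite linearD linearZ /= simple_root_characteristic; case: (eqVneq j i) => [->|ji].
  by rewrite ac [_ *: _]mulrN1 subrr.
by rewrite aj // mulr0n oppr0 scaler0 addr0.
Qed.

Variables (sigma tau : 'End(g)).
Hypothesis sigmaP : forall x : g,
  (creal (sigma x) : realify (complexify g)) = Ad_exp (half_pi_i Ki) (creal x).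
Hypothesis tauP : lie_involution tau.
Hypothesis tau_sigma : (tau \o sigma)%VF = (sigma^-1 \o tau)%VF.
Local Notation S := (Ad_exp (half_pi_i Ki)).

Lemma involutionK x : tau (tau x) = x.
Proof. by have [_ [_ /(_ x (memvf x))]] := tauP. Qed.
Lemma involution_lie x y : tau (lie x y) = lie (tau x) (tau y).
Proof. by have [/lie_autM] := tauP. Qed.

Lemma order4_lker0 : lker sigma == 0%VS.
Proof.
apply/lker0P => x y xy; have /lker0P inj := quarter_turn_lker0 gr.
by have := inj (creal x) (creal y); rewrite -!sigmaP xy => /(_ erefl)[].
Qed.

Lemma sigma_tau_sigma x : sigma (tau (sigma x)) = tau x.
Proof.
have := congr1 (fun f : 'End(g) => sigma (f x)) tau_sigma.
by rewrite /= !comp_lfunE lker0_lfunVK // order4_lker0.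
Qed.

Lemma sigma_fixedP x : sigma x = x <-> lie Z x = 0.
Proof.
rewrite -characteristic_degree0 -(quarter_turn_fixed gr); split=> [e|/fixedSpaceP].
  by apply/fixedSpaceP; rewrite -sigmaP e.
by rewrite -sigmaP => -[].
Qed.

Lemma involution_degree0 x : lie Z x = 0 -> lie Z (tau x) = 0.
Proof.
move=> /sigma_fixedP sx; apply/sigma_fixedP.
by rewrite -[in LHS]sx sigma_tau_sigma.
Qed.

(** [Z] spans the center of the fixed algebra of [sigma], so [tau Z = c Z] with
    [c ^ 2 = 1]. If [c = 1], then [tau] commutes with [sigma], which contradicts
    [sigma tau sigma = tau] on the eigenspace of [sigma] for [i]. *)
Lemma involution_reverses : tau Z = - Z.
Proof.
have ZZ := liexx Z.
have : tau Z \in <[Z]>%VS.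
  apply: characteristic_center => [|y Zy]; first exact: involution_degree0.
  have := involution_degree0 Zy => Zty.
  by rewrite -[y]involutionK -involution_lie Zty linear0.
move=> /vlineP[c tZ].
have : c * c = 1.
  have := involutionK Z; rewrite tZ linearZ /= tZ scalerA => /eqP.
  rewrite -subr_eq0 -{2}[Z]scale1r -scalerBl scaler_eq0 subr_eq0 => /orP[/eqP //|/eqP].
  by move/characteristic_neq0.
move=> /eqP; rewrite -expr2 sqrf_eq1 => /orP[|] /eqP c1; last by rewrite tZ c1 scaleN1r.
exfalso; rewrite c1 scale1r in tZ.
(* The root vector of [alpha i] has degree 1. *)
have [X X0 Xa] := alpha_root_vector alphaP i.
pose tauC Y : gC := (tau Y.1, tau Y.2).
have SE (Y : gC) : S Y = (sigma Y.1, sigma Y.2) :> gC.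
  rewrite [Y in LHS]complexifyE quarter_turnD (quarter_turnZ gr) -!sigmaP.
  rewrite complexify_iscaleE complexifyD /=.
  by rewrite oppr0 addr0 add0r.
have sts Y : S (tauC (S Y)) = tauC Y :> gC.
  by rewrite !SE /tauC /= !sigma_tau_sigma.
have X1 : X \in EK 1.
  by apply/leigenspaceP; rewrite adE (Xa (K i)) dualP eqxx.
have tX1 : tauC X \in EK 1.
  apply/leigenspaceP; move/leigenspaceP: X1; rewrite !adE !characteristic_lieE scale1r => Xe.
  have [e1 e2] : lie Z X.2 = X.1 /\ - lie Z X.1 = X.2 by case: (X) Xe => ? ? /= [].
  rewrite /tauC scale1r /= -[in lie Z (tau X.2)]tZ -[in lie Z (tau X.1)]tZ.
  by rewrite -!involution_lie -linearN e1 e2.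
have := sts X; rewrite (quarter_turnE gr X1) expr1z.
have -> : tauC ('i%C *: X) = 'i%C *: tauC X.
  by rewrite !complexify_iscaleE /tauC /= linearN.
rewrite (quarter_turnZ gr) (quarter_turnE gr tX1) expr1z scalerA -expr2 sqr_i scaleN1r.
move=> /eqP; rewrite eq_sym -addr_eq0 -mulr2n -scaler_nat scaler_eq0 pnatr_eq0 /= => /eqP tX0.
apply: X0; apply: complexify_eqP; rewrite /= -[LHS]involutionK.
  by have := congr1 fst tX0; rewrite /= => ->; rewrite linear0.
by have := congr1 snd tX0; rewrite /= => ->; rewrite linear0.
Qed.

End Reversal.

(** * The bracket of the noncompact dual *)

Lemma lie_simple_isomorphic (F : fieldType) (g1 g2 : lieAlgType F) (f : 'Hom(g1, g2)) :
  lie_hom f -> lker f == 0%VS -> limg f = fullv -> lie_simple g1 -> lie_simple g2.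
Proof.
move=> fM f0 ff [nab simple]; have /lker0P finj := f0; split=> [ab|U idU].
  by apply: nab => x y _ _; apply: finj; rewrite fM ab ?memvf // linear0.
have UE : U = (f @: (f @^-1: U))%VS by rewrite lpreimK // ff subvf.
have idf : lie_ideal (f @^-1: U)%VS.
  by move=> x y; rewrite -!memv_preim fM => yU; apply: idU.
by case: (simple _ idf) => fU; [left|right]; rewrite UE fU ?limg0.
Qed.

(** An ideal [U] gives the ideal [U + i U]. *)
Lemma complexify_simple_simple (R : rcfType) (g : lieAlgType R) :
  lie_simple (complexify g) -> lie_simple g.
Proof.
move=> [nab simple]; split=> [ab|U idU].
  by apply: nab => X Y _ _; rewrite complexify_lieE !ab ?memvf // subrr addr0.
have [UC UCE] : exists UC : {vspace complexify g},
    forall X : complexify g, X \in UC <-> X.1 \in U /\ X.2 \in U.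
  apply: vspace_of_pred => [|c X Y [X1 X2] [Y1 Y2]]; first by rewrite mem0v.
  rewrite complexifyD complexify_scaleE /=.
  by split; rewrite memvD ?memvB ?memvD ?memvZ.
have idUC : lie_ideal UC.
  move=> X Y /UCE[Y1 Y2]; apply/UCE; rewrite complexify_lieE /=.
  by split; rewrite ?memvB ?memvD ?idU.
case: (simple _ idUC) => UC1; [left|right]; apply/eqP.
  rewrite -subv0; apply/subvP=> x xU.
  have /UCE : (creal x : complexify g).1 \in U /\ (creal x : complexify g).2 \in U.
    by rewrite mem0v.
  by rewrite UC1 !memv0 => /eqP[->].
rewrite eqEsubv subvf /=; apply/subvP=> x _.
by have /UCE[] : (creal x : complexify g) \in UC by rewrite UC1 memvf.
Qed.

(** The symmetric dual of [g] with respect to the involution [tau]: the space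
    [g = k + p] itself, with the sign of the bracket changed on [p x p]. It is
    the real form [k + i p] of the complexification. *)
Definition noncompact_dual (R : realType) (g : lieAlgType R) (tau : 'End(g))
  (tauP : lie_involution tau) : Type := g.

Section DualBracket.
Variables (R : realType) (g : lieAlgType R) (tau : 'End(g)).
Hypothesis tauP : lie_involution tau.
Local Notation gd := (noncompact_dual tauP).
Local Notation gC := (complexify g).
Implicit Types (x y u v : g).

Definition fixed_part : 'End(g) := 2^-1 *: (\1 + tau)%VF.
Definition anti_part : 'End(g) := 2^-1 *: (\1 - tau)%VF.

Lemma fixed_partE x : fixed_part x = 2^-1 *: (x + tau x).
Proof. by rewrite !lfunSE. Qed.
Lemma anti_partE x : anti_part x = 2^-1 *: (x - tau x).
Proof. by rewrite !lfunSE. Qed.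

Lemma half_double (V : lmodType R) (x : V) : 2^-1 *: (x + x) = x.
Proof.
rewrite (_ : x + x = (2 : R) *: x); last by rewrite scaler_nat.
by rewrite scalerA mulVf ?scale1r // pnatr_eq0.
Qed.

Lemma kp_sum x : fixed_part x + anti_part x = x.
Proof. by rewrite fixed_partE anti_partE -scalerDr addrACA subrr addr0 half_double. Qed.
Lemma tau_fixed_part x : tau (fixed_part x) = fixed_part x.
Proof. by rewrite fixed_partE linearZ /= linearD /= (involutionK tauP) addrC. Qed.
Lemma tau_anti_part x : tau (anti_part x) = - anti_part x.
Proof.
by rewrite anti_partE linearZ /= linearB /= (involutionK tauP) -scalerN opprB.
Qed.
Lemma kp_diff x : fixed_part x - anti_part x = tau x.
Proof. by rewrite -tau_anti_part -[fixed_part x]tau_fixed_part -linearD /= kp_sum. Qed.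

Lemma fixed_part_id x : tau x = x -> fixed_part x = x.
Proof. by move=> tx; rewrite fixed_partE tx half_double. Qed.
Lemma anti_part_fixed x : tau x = x -> anti_part x = 0.
Proof. by move=> tx; rewrite anti_partE tx subrr scaler0. Qed.
Lemma fixed_part_anti x : tau x = - x -> fixed_part x = 0.
Proof. by move=> tx; rewrite fixed_partE tx subrr scaler0. Qed.
Lemma anti_part_id x : tau x = - x -> anti_part x = x.
Proof. by move=> tx; rewrite anti_partE tx opprK half_double. Qed.

Lemma part_unique x u v : x = u + v -> tau u = u -> tau v = - v ->
  fixed_part x = u /\ anti_part x = v.
Proof.
move=> -> tu tv; rewrite !linearD /= fixed_part_id // (fixed_part_anti tv) (anti_part_fixed tu) anti_part_id //.
by rewrite addr0 add0r.
Qed.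

Definition dual_lie (x y : g) : g := lie (fixed_part x) y + lie (anti_part x) (tau y).

(** The embedding of the dual in the complexification as [k + i p]. *)
Definition dual_embed (x : g) : gC := (fixed_part x, anti_part x).

Lemma dual_embed_inj x y : dual_embed x = dual_embed y -> x = y.
Proof. by case=> e1 e2; rewrite -(kp_sum x) e1 e2 kp_sum. Qed.

Lemma dual_embed_lie x y :
  dual_embed (dual_lie x y) = lie (dual_embed x) (dual_embed y).
Proof.
have tl := involution_lie tauP.
have [e1 e2] : fixed_part (dual_lie x y) = lie (fixed_part x) (fixed_part y) - lie (anti_part x) (anti_part y)
   /\ anti_part (dual_lie x y) = lie (fixed_part x) (anti_part y) + lie (anti_part x) (fixed_part y).
  apply: part_unique.
  - have -> : dual_lie x y = lie (fixed_part x) (fixed_part y + anti_part y)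
        + lie (anti_part x) (fixed_part y - anti_part y) by rewrite kp_sum kp_diff.
    by rewrite lieDr lieBr [lie (anti_part x) _ - _]addrC addrACA.
  - by rewrite linearB /= !tl !tau_fixed_part !tau_anti_part lieNl lieNr opprK.
  by rewrite linearD /= !tl !tau_fixed_part !tau_anti_part lieNl lieNr opprD.
by rewrite /dual_embed e1 e2.
Qed.

Fact dual_lie_linearl (y : g) : linear (dual_lie^~ y).
Proof.
move=> c x z; rewrite /dual_lie [fixed_part _]linearP [anti_part _]linearP /= !lieDl !lieZl scalerDr.
by rewrite addrACA.
Qed.

Fact dual_lie_linearr (x : g) : linear (dual_lie x).
Proof.
move=> c y z; rewrite /dual_lie [tau _]linearP /= !lieDr !lieZr scalerDr.
by rewrite addrACA.
Qed.

Lemma dual_embedD x y : dual_embed (x + y) = dual_embed x + dual_embed y.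
Proof. by rewrite /dual_embed complexifyD /= !linearD. Qed.
Lemma dual_embed0 : dual_embed 0 = 0.
Proof. by rewrite /dual_embed !linear0. Qed.

Fact dual_liexx (x : g) : dual_lie x x = 0.
Proof. by apply: dual_embed_inj; rewrite dual_embed_lie liexx dual_embed0. Qed.

Fact dual_lie_jacobi (x y z : g) :
  dual_lie x (dual_lie y z) + dual_lie y (dual_lie z x) + dual_lie z (dual_lie x y) = 0.
Proof.
apply: dual_embed_inj; rewrite 2!dual_embedD !dual_embed_lie dual_embed0.
exact: lie_jacobi.
Qed.

HB.instance Definition _ := Vector.copy gd g.
HB.instance Definition _ := Vector_isLieAlgebra.Build R gd
  dual_lie_linearl dual_lie_linearr dual_liexx dual_lie_jacobi.

End DualBracket.

(** * Structure of the noncompact dual *)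

Section DualAlgebra.
Variables (R : realType) (g : lieAlgType R) (tau : 'End(g)).
Hypothesis tauP : lie_involution tau.
Local Notation gd := (noncompact_dual tauP).
Local Notation gC := (complexify g).
Local Notation gdC := (complexify (noncompact_dual tauP)).
Local Notation kp := (fixed_part tau).
Local Notation pp := (anti_part tau).
Let taud : 'End(gd) := tau.
Implicit Types (x y u v : g).

Lemma dual_lieE x y : lie (x : gd) (y : gd) = lie (kp x) y + lie (pp x) (tau y) :> g.
Proof. by []. Qed.

Lemma dual_lie_k x y : tau x = x -> lie (x : gd) (y : gd) = lie x y :> g.
Proof. by move=> tx; rewrite dual_lieE (fixed_part_id tx) (anti_part_fixed tx) lie0l addr0. Qed.

Lemma dual_lie_p x y : tau x = - x -> lie (x : gd) (y : gd) = lie x (tau y) :> g.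
Proof. by move=> tx; rewrite dual_lieE (fixed_part_anti tx) (anti_part_id tx) lie0l add0r. Qed.

Lemma dual_aut : lie_aut taud.
Proof.
split.
  apply/eqP; rewrite eqEsubv subvf /=; apply/subvP=> x _.
  by rewrite -[x](involutionK tauP); apply: (memv_img taud); rewrite memvf.
move=> x y _ _; change (tau (lie (x : gd) y) = lie (tau x : gd) (tau y) :> g).
rewrite !dual_lieE linearD /= !(involution_lie tauP) !(involutionK tauP).
rewrite (tau_fixed_part tauP) (tau_anti_part tauP).
have -> : kp (tau x) = kp x by rewrite !fixed_partE (involutionK tauP) addrC.
have -> : pp (tau x) = - pp x.
  by rewrite !anti_partE (involutionK tauP) -scalerN opprB.
by [].
Qed.

Lemma dual_killing_k x : tau x = x -> killing (x : gd) x = killing x x.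
Proof.
move=> tx; rewrite /killing; have -> : ad (x : gd) = @ad R g x :> 'End(gd).
  apply/lfunP=> y; rewrite adE.
  exact: etrans (dual_lie_k y tx) (esym (adE x y)).
by [].
Qed.

(** [ad x] in the dual is [ad x \o tau], and [tau] anticommutes with [ad x]. *)
Lemma dual_killing_p x : tau x = - x -> killing (x : gd) x = - killing x x.
Proof.
move=> tx; have -> : killing (x : gd) x = lfun_trace ((ad x \o tau) \o (ad x \o tau))%VF.
  rewrite /killing; have -> : ad (x : gd) = (@ad R g x \o tau)%VF :> 'End(gd).
    apply/lfunP=> y; rewrite adE; apply: etrans (dual_lie_p y tx) _.
    by rewrite -adE; apply/esym/(comp_lfunE (@ad R g x) tau).
  by [].
rewrite /killing -lfun_traceN; congr lfun_trace.
apply/lfunP=> y; rewrite !lfunSE !adE (involution_lie tauP) tx (involutionK tauP).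
by rewrite lieNl lieNr.
Qed.

Hypothesis cptg : lie_compact g.

(** For [x = u + v] with [u] in [k] and [v] in [p], the dual Killing form gives
    [- B'(x, tau x) = - B(u, u) - B(v, v)]. *)
Lemma dual_cartan : cartan_involution taud.
Proof.
split; [exact: dual_aut | exact: (involutionK tauP) | move=> x x0].
have tE : taud x = (kp x : gd) - (pp x : gd) by rewrite -(kp_diff tauP).
have xE : x = (kp x : gd) + (pp x : gd) by rewrite -[LHS](kp_sum tau).
rewrite tE {1}xE killingDl !(killingDr, killingNr).
rewrite (killingC (pp x : gd) (kp x)) (dual_killing_k (tau_fixed_part tauP x))
  (dual_killing_p (tau_anti_part tauP x)) !opprD !opprK.
have le0 u : killing u u <= 0.
  case: (eqVneq u 0) => [->|/eqP/cptg/ltW //]; first by rewrite killing0l.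
have : killing (kp x) (kp x) < 0 \/ killing (pp x) (pp x) < 0.
  case: (eqVneq (kp x) 0) => [k0|/eqP/cptg]; last by left.
  case: (eqVneq (pp x) 0) => [p0|/eqP/cptg]; last by right.
  by case: x0; rewrite -[LHS](kp_sum tau) k0 p0 addr0.
have := le0 (kp x); have := le0 (pp x).
set A := killing (kp x : g) (kp x); set B := killing (pp x : g) (pp x).
set C := killing (kp x : gd) (pp x).
move=> ? ? [] ?; lra.
Qed.

Lemma dual_noncompact Z : Z <> 0 -> tau Z = - Z -> ~ lie_compact gd.
Proof.
move=> Z0 tZ /(_ (Z : gd) Z0); rewrite (dual_killing_p tZ) oppr_lt0.
by move=> /(lt_trans (cptg Z0)); rewrite ltxx.
Qed.

(** The complexifications of [g] and of its dual are both that of [k + i p]. *)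
Definition dual_complexify (X : gC) : gdC := (kp X.1 - pp X.2, pp X.1 + kp X.2).
Local Notation phi := dual_complexify.

Lemma dual_complexifyD X Y : phi (X + Y) = phi X + phi Y.
Proof.
rewrite /phi !complexifyD; apply: complexify_eqP => /=;
  by rewrite !linearD /= addrACA.
Qed.

Lemma dual_complexifyZ (c : R[i]) X : phi (c *: X) = c *: phi X.
Proof.
have phir (d : R) Y : phi (d%:C%C *: Y) = d%:C%C *: phi Y.
  rewrite /phi !complexify_realscaleE; apply: complexify_eqP => /=.
    by rewrite !linearZ /= scalerDr.
  by rewrite !linearZ /= scalerDr.
have phii Y : phi ('i%C *: Y) = 'i%C *: phi Y.
  rewrite /phi !complexify_iscaleE; apply: complexify_eqP => /=.
    by rewrite linearN /= opprD addrC.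
  by rewrite linearN /= addrC.
case: c => c d.
have -> : (c +i* d)%C = c%:C%C + 'i%C * d%:C%C.
  apply/eqP; rewrite eq_complex /=.
  by rewrite !(mul0r, mulr0, mul1r, subr0, addr0, add0r) !eqxx.
by rewrite !scalerDl -!scalerA dual_complexifyD phii !phir.
Qed.

Lemma dual_complexify_linear : linear phi.
Proof. by move=> c X Y; rewrite dual_complexifyD dual_complexifyZ. Qed.

Lemma dual_complexify_creal x : phi (creal x) = (kp x, pp x).
Proof. by rewrite /phi /= !linear0 !addr0. Qed.

Lemma dual_complexify_lie X Y : phi (lie X Y) = lie (phi X) (phi Y).
Proof.
have real x y : phi (lie (creal x) (creal y)) = lie (phi (creal x)) (phi (creal y)).
  rewrite -creal_lie !dual_complexify_creal complexify_lieE /=.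
  rewrite !(dual_lie_k _ (tau_fixed_part tauP _)) !(dual_lie_p _ (tau_anti_part tauP _)).
  rewrite (tau_fixed_part tauP) (tau_anti_part tauP) lieNr opprK.
  have [|||-> ->] // := part_unique (tau := tau) (x := lie x y)
    (u := lie (kp x) (kp y) + lie (pp x) (pp y)) (v := lie (kp x) (pp y) + lie (pp x) (kp y)).
  - have -> : lie x y = lie (kp x + pp x) (kp y + pp y) by rewrite !kp_sum.
    by rewrite lieDl !lieDr [lie (pp x) _ + _]addrC addrACA.
  - by rewrite linearD /= !(involution_lie tauP) !(tau_fixed_part tauP) !(tau_anti_part tauP)
      lieNl lieNr opprK.
  by rewrite linearD /= !(involution_lie tauP) !(tau_fixed_part tauP) !(tau_anti_part tauP)
      lieNl lieNr opprD.
rewrite (complexifyE X) (complexifyE Y) !(lieDl, lieDr, lieZl, lieZr).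
by rewrite !(dual_complexifyD, dual_complexifyZ) !real !(lieDl, lieDr, lieZl, lieZr).
Qed.

Definition dual_iso : 'Hom(gC, gdC) := linfun phi.

Lemma dual_isoE X : dual_iso X = phi X.
Proof. exact: (linear_linfun dual_complexify_linear). Qed.

Lemma dual_iso_lker0 : lker dual_iso == 0%VS.
Proof.
apply/eqP/vspaceP=> X; rewrite memv_ker memv0 dual_isoE; apply/eqP/eqP=> [|->]; last first.
  by apply: complexify_eqP; rewrite /= !linear0 ?subr0 ?addr0.
have tk := tau_fixed_part tauP; have tp := tau_anti_part tauP.
case: X => x y [] /= e1 e2.
have kx : kp x = 0 /\ pp y = 0.
  have [|<- /eqP] := part_unique (tau := tau) (esym e1) (tk x) (v := - pp y).
    by rewrite linearN /= tp.
  by rewrite !linear0 eq_sym oppr_eq0 => /eqP.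
have ky : kp y = 0 /\ pp x = 0.
  have [<- <-] := part_unique (tau := tau) (etrans (esym e2) (addrC _ _)) (tk y) (tp x).
  by rewrite !linear0.
apply: complexify_eqP; rewrite /= -[LHS](kp_sum tau).
  by rewrite kx.1 ky.2 addr0.
by rewrite kx.2 ky.1 addr0.
Qed.

Lemma dual_iso_limg : limg dual_iso = fullv.
Proof.
apply/eqP; rewrite eqEsubv subvf /=; apply/subvP=> -[u v] _.
have tk := tau_fixed_part tauP; have tp := tau_anti_part tauP.
pose X : gC := (kp u + pp v, kp v - pp u).
have <- : dual_iso X = (u, v); last by rewrite memv_img ?memvf.
rewrite dual_isoE /phi /X /=.
have [-> ->] := part_unique (erefl (kp u + pp v)) (tk u) (tp v).
have tp' : tau (- pp u) = - - pp u by rewrite linearN /= tp.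
have [-> ->] := part_unique (erefl (kp v - pp u)) (tk v) tp'.
by rewrite opprK (kp_sum tau) addrC (kp_sum tau).
Qed.

Lemma dual_complexify_simple : lie_simple gC -> lie_simple gdC.
Proof.
apply: lie_simple_isomorphic dual_iso_lker0 dual_iso_limg => X Y.
by rewrite !dual_isoE dual_complexify_lie.
Qed.

Lemma dual_complexify_inj X Y : phi X = phi Y -> X = Y.
Proof. by rewrite -!dual_isoE; move/lker0P: dual_iso_lker0; apply. Qed.

Lemma dual_complexify_surj (X' : gdC) : exists X, X' = phi X.
Proof.
have /memv_imgP[X _ ->] : X' \in limg dual_iso by rewrite dual_iso_limg memvf.
by exists X; rewrite dual_isoE.
Qed.

Section DualGradation.
Variables (K : gC) (Z : g).
Hypothesis tZ : tau Z = - Z.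
Hypothesis KZ : K = - cimag Z.
Hypothesis gr : (\sum_(k < 7) leigenspace (ad K) (k%:Z - 3)%:~R)%VS = fullv.
Local Notation E := (characteristic_gradation (Z : gd)).

Lemma dual_complexify_K : phi K = creal (Z : gd).
Proof.
rewrite KZ -scaleN1r dual_complexifyZ scaleN1r complexifyN /=.
rewrite (fixed_part_anti tZ) (anti_part_id tZ).
by apply: complexify_eqP; rewrite /= ?linear0 ?add0r ?opprK ?oppr0 ?addr0.
Qed.

Lemma dual_degreeP (p : int) X :
  X \in leigenspace (ad K) p%:~R <-> phi X \in leigenspace (ad (creal (Z : gd) : gdC)) p%:~R.
Proof.
split=> /leigenspaceP; rewrite adE => XE; apply/leigenspaceP; rewrite adE.
  by rewrite -dual_complexify_K -dual_complexify_lie XE dual_complexifyZ.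
apply: dual_complexify_inj.
by rewrite dual_complexify_lie dual_complexify_K XE dual_complexifyZ.
Qed.

(** The eigenvalues of [ad Z] in the dual are those of [ad K]. *)
Lemma dual_eigenvalue (c : R) (x : gd) : x <> 0 -> lie (Z : gd) x = c *: x ->
  exists2 p : int, (`|p| <= 3)%N & c = p%:~R.
Proof.
move=> x0 Zx; have [X xE] := dual_complexify_surj (creal x).
have KX : lie K X = c%:C%C *: X.
  apply: dual_complexify_inj; rewrite dual_complexify_lie dual_complexify_K -xE.
  by rewrite -creal_lie Zx crealZ dual_complexifyZ xE.
apply: contrapT => no; have [e [eE Xe]] := graded_span gr X.
have X0 : X = 0.
  rewrite Xe; apply: (@eigenvectors_separate _ _ (ad K) _ _ xpredT
    (fun k : 'I_7 => (k%:Z - 3)%:~R) e c%:C%C).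
  - move=> k _; apply/eqP => kc; apply: no; exists (k%:Z - 3).
      by have := ltn_ord k; lia.
    have : ((k%:Z - 3)%:~R : R)%:C%C = c%:C%C by rewrite rmorph_int.
    by case.
  - by move=> k _; apply/leigenspaceP.
  by rewrite -Xe adE.
apply: x0; move: xE; rewrite X0 => /(congr1 fst) /= ->.
by rewrite !linear0 addr0.
Qed.

Lemma dual_degree_neq0 (p : int) X : X <> 0 -> X \in leigenspace (ad K) p%:~R ->
  E p <> 0%VS.
Proof.
move=> X0 /dual_degreeP/creal_eigenP[X1 X2]; apply/vspace_neq0P.
case: (pselect ((phi X).1 = 0)) => e1; last first.
  by exists (phi X).1 => //; apply/leigenspaceP; rewrite adE.
case: (pselect ((phi X).2 = 0)) => e2; last first.
  by exists (phi X).2 => //; apply/leigenspaceP; rewrite adE.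
case: X0; apply: dual_complexify_inj.
have -> : phi 0 = 0 by rewrite -dual_isoE linear0.
exact: complexify_eqP.
Qed.

Lemma dual_gradation_tau p (x : gd) : x \in E p -> taud x \in E (- p).
Proof.
move=> /leigenspaceP; rewrite adE => xE; apply/leigenspaceP; rewrite adE.
have [_ tl] := dual_aut.
have ZE : (Z : gd) = - taud Z by rewrite [taud Z]tZ opprK.
rewrite {1}ZE lieNl -tl ?memvf // xE linearZ /= mulrNz scaleNr.
by [].
Qed.

Lemma dual_kind : E 1 <> 0%VS -> gradation_of_kind 3 E.
Proof.
move=> E1.
have zero (p : int) : (3 < `|p|)%N -> E p = 0%VS.
  move=> p3; apply/eqP; rewrite -subv0; apply/subvP=> x /leigenspaceP; rewrite adE memv0 => xE.
  apply/eqP; apply: contrapT => x0; have [r r3 /eqP] := dual_eigenvalue x0 xE.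
  by rewrite eqr_int => /eqP pr; move: p3; rewrite pr ltnNge r3.
split=> //.
- apply/directv_sum_independent => v vE v0 k _.
  apply: (@eigenvectors_independent _ _ (ad (Z : gd)) _
    (fun k : 'I_7 => (k%:Z - 3%:Z)%:~R) v) => //.
    by move=> j j' /eqP; rewrite eqr_int => /eqP jj; apply: val_inj => /=; lia.
  by move=> j; apply/leigenspaceP; apply: vE.
- have qP := cartan_formP dual_cartan.
  have Zp : (Z : gd) \in cartan_p taud by apply/cartan_pP.
  apply: (symmetric_eigenvectors_span qP (cartan_p_symmetric dual_cartan Zp)) => [x|c x xE].
    move=> /memv_sumP[e eE ->]; rewrite linear_sum; apply: memv_suml => k _ /=.
    have /leigenspaceP -> := eE k isT.
    by apply: memvZ; apply: (memv_sum_at (k := k)); apply: eE.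
  case: (pselect (x = 0)) => [->|x0]; first exact: mem0v.
  rewrite adE in xE; have [p p3 cp] := dual_eigenvalue x0 xE.
  have k7 : (absz (p + 3)%R < 7)%N by lia.
  apply: (memv_sum_at (k := Ordinal k7)) => /=.
  have -> : (absz (p + 3)%R)%:Z - 3 = p by lia.
  by apply/leigenspaceP; rewrite adE xE cp.
move=> p r x y /leigenspaceP xE /leigenspaceP yE; rewrite !adE in xE yE.
by apply/leigenspaceP; rewrite adE lie_der xE yE lieZl lieZr -scalerDl intrD.
Qed.

Lemma dual_reversing : grade_reversing E taud.
Proof.
move=> p; apply/eqP; rewrite eqEsubv; apply/andP; split; apply/subvP => x.
  by move=> /memv_imgP[y yE ->]; apply: dual_gradation_tau.
move=> /dual_gradation_tau; rewrite opprK => xE.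
by rewrite -[x](involutionK tauP); apply: (memv_img taud).
Qed.

End DualGradation.

End DualAlgebra.

(** * Existence of simple restricted roots and of a highest root *)

(** Take an abelian subspace of maximal dimension. *)
Lemma maximal_abelian_exists (F : fieldType) (g : lieAlgType F) (P : {vspace g}) z :
  z \in P -> exists2 a : {vspace g}, maximal_abelian_in P a & z \in a.
Proof.
move=> zP.
pose good (d : nat) := `[< exists a : {vspace g},
  [/\ z \in a, (a <= P)%VS, abelian_vs a & \dim a = d] >].
have ex : exists d, good d.
  exists (\dim <[z]>); apply/asboolP; exists <[z]>%VS; split=> //.
  - exact: memv_line.
  by move=> _ _ /vlineP[c ->] /vlineP[d ->]; rewrite lieZl lieZr liexx !scaler0.
have bound d : good d -> (d <= \dim {:g})%N.
  by move=> /asboolP[a [_ _ _ <-]]; rewrite dimvS ?subvf.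
case: (ex_maxnP ex bound) => d /asboolP[a [za aP aab ad]] dmax.
exists a => //; split=> // W aW WP Wab; apply/esym/eqP.
rewrite eqEdim aW ad dmax //; apply/asboolP; exists W; split=> //.
exact: (subvP aW).
Qed.

Lemma basis_extending (F : fieldType) (V : vectType F) (v : V) : v != 0 ->
  exists b : seq V, basis_of {:V} (v :: b).
Proof.
move=> v0; exists (vbasis (<[v]>^C)%VS).
have dir : directv (<[v]> + <[v]>^C) by apply/directv_addP; apply: capv_compl.
have := cat_basis dir (seq1_basis v0) (vbasisP _).
by rewrite addv_complf.
Qed.

Section RootSystem.
Variables (R : realType) (gs : lieAlgType R) (tau : 'End(gs)).
Hypothesis tauP : cartan_involution tau.
Variable (a : {vspace gs}).
Hypothesis aP : maximal_abelian_in (cartan_p tau) a.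
Variable (b : seq (subvs_of a)).
Hypothesis bP : basis_of {:subvs_of a} b.
Implicit Types mu nu : vdual a.
Local Notation q := (cartan_form tau).
Let qP := cartan_formP tauP.

Lemma simple_roots_enumeration : exists (l : nat) (lam : 'I_l -> vdual a),
  injective lam /\ forall mu, lex_simple_root b mu <-> exists j, mu = lam j.
Proof.
have [s us sP] := finite_roots tauP aP.
pose r := [seq mu <- s | `[< lex_simple_root b mu >]].
exists (size r), (fun j => r`_j); split=> [j k /eqP|mu].
  by rewrite nth_uniq ?filter_uniq // => /eqP/val_inj.
split=> [smu|[j ->]]; last first.
  by have := mem_nth 0 (ltn_ord j); rewrite mem_filter => /andP[/asboolP].
have mur : mu \in r.
  by rewrite mem_filter; apply/andP; split; [apply/asboolP | apply/sP; case: smu].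
have ir : (index mu r < size r)%N by rewrite index_mem.
by exists (Ordinal ir); rewrite /= nth_index.
Qed.

Variables (l : nat) (lam : 'I_l -> vdual a).
Hypothesis lam_inj : injective lam.
Hypothesis lamP : forall mu, lex_simple_root b mu <-> exists j, mu = lam j.

Lemma lam_simple j : lex_simple_root b (lam j).
Proof. by apply/lamP; exists j. Qed.

(** The Gram matrix of the independent simple roots is invertible, and its inverse
    gives the dual basis in terms of the coroots. *)
Lemma simple_roots_dual : exists h : 'I_l -> subvs_of a,
  forall j k, lam j (h k) = (j == k)%:R.
Proof.
have /choice[T TP] j : exists T, represents tau (lam j) T.
  by apply: (root_represented tauP aP); case: (lam_simple j).
pose G : 'M[R]_l := \matrix_(j, k) lam j (T k).
have : row_free G.
  apply: inj_row_free => u uG.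
  have uT k : (\sum_j u 0 j *: lam j) (T k) = 0.
    move/rowP: uG => /(_ k); rewrite [LHS]mxE [RHS]mxE vdual_sumE => uGk.
    by rewrite -[RHS]uGk; apply: eq_bigr => j _; rewrite mxE.
  have TT := represents_sum tauP (fun j => u 0 j) TP.
  have T0 : \sum_j u 0 j *: T j = 0.
    apply: (can_inj vsvalK); rewrite linear0; apply: (inner_eq0 qP).
    by rewrite TT linear_sum big1 // => k _; rewrite linearZ /= uT [_ *: _]mulr0.
  have u0 : \sum_j u 0 j *: lam j = 0.
    by apply/lfunP=> H; rewrite -TT T0 zero_lfunE linear0 (inner0l qP).
  apply/rowP=> j; rewrite mxE.
  exact: (simple_roots_independent tauP aP bP lam_inj lam_simple u0).
rewrite row_free_unit => Gu.
exists (fun k => \sum_j invmx G j k *: T j) => j k.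
have /matrixP/(_ j k) := mulmxV Gu; rewrite !mxE => <-.
by rewrite linear_sum; apply: eq_bigr => m _; rewrite linearZ /= mxE [_ *: _]mulrC.
Qed.

Definition is_natural_combination mu := exists k : 'I_l -> nat, mu = \sum_j (k j)%:R *: lam j.

Lemma natural_combinationD mu nu : is_natural_combination mu ->
  is_natural_combination nu -> is_natural_combination (mu + nu).
Proof.
move=> [k ->] [k' ->]; exists (fun j => (k j + k' j)%N).
by rewrite -big_split; apply: eq_bigr => j _; rewrite natrD scalerDl.
Qed.

Lemma natural_combination0 : is_natural_combination 0.
Proof. by exists (fun=> 0%N); rewrite big1 // => j _; rewrite scale0r. Qed.

Lemma positive_root_natural mu : lie_root mu -> lex_pos b mu -> is_natural_combination mu.
Proof. exact: (lex_simple_combination tauP aP lamP). Qed.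

(** The span is described by its minimality: a property of its elements that
    defines a subspace need only be checked on weight vectors. *)
Lemma span_weights (Q : vdual a -> Prop) : exists U : {vspace gs},
  (forall mu x, Q mu -> weight_vector mu x -> x \in U) /\
  (forall S : {vspace gs}, (forall mu x, Q mu -> weight_vector mu x -> x \in S) ->
    (U <= S)%VS).
Proof.
pose good (S : {vspace gs}) := forall mu x, Q mu -> weight_vector mu x -> x \in S.
have [U UE] : exists U : {vspace gs}, forall x, x \in U <-> forall S, good S -> x \in S.
  apply: vspace_of_pred => [S _|c x y xS yS S gS]; first exact: mem0v.
  by rewrite memvD ?memvZ ?xS ?yS.
exists U; split=> [mu x Qmu xmu|S gS].
  by apply/UE=> S gS; apply: gS xmu.
by apply/subvP=> x /UE; apply.
Qed.

(** The orthogonal complement of a span [U] of weight vectors is stable under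
    [a], so it contains a weight vector unless it is zero. *)
Lemma weight_vectors_span (U : {vspace gs}) :
  (forall mu x, weight_vector mu x -> x \in U) -> U = fullv.
Proof.
move=> UP; have [S [SP Smin]] := span_weights (fun=> True).
have SU : (S <= U)%VS by apply: Smin => mu x _; apply: UP.
have [N NE] : exists N : {vspace gs}, forall x, x \in N <-> forall e, e \in S -> q x e = 0.
  apply: vspace_of_pred => [e _|c x y xN yN e eS]; first exact: (inner0l qP).
  by rewrite (innerDl qP) (innerZl qP) xN // yN // mulr0 addr0.
have aS h x : h \in a -> x \in S -> lie h x \in S.
  move=> ha; have [Q QE] : exists Q : {vspace gs}, forall y, y \in Q <-> lie h y \in S.
    apply: vspace_of_pred => [|c y z yS zS]; first by rewrite lie0r mem0v.
    by rewrite lieDr lieZr memvD ?memvZ.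
  have /subvP/[apply]/QE // : (S <= Q)%VS.
  apply: Smin => mu y _ ymu; apply/QE; rewrite -(vsprojK ha) ymu memvZ //.
  exact: SP ymu.
have N0 : N = 0%VS.
  apply: contrapT => N0.
  have [|mu [x [/NE xN x0 xmu]]] := restricted_weight_exists tauP aP N0.
    move=> h x ha /NE xN; apply/NE=> e eS; rewrite -(vsprojK ha) -adE.
    rewrite (cartan_p_symmetric tauP (restricted_p aP _)) adE xN //.
    by rewrite vsprojK // aS.
  by apply: x0; apply: (inner_eq0 qP); apply: xN; apply: SP xmu.
apply/eqP; rewrite eqEsubv subvf /=; apply/subvP=> x _.
have [e eS eP] := orthogonal_projection qP S x.
have : x - e \in N by apply/NE.
by rewrite N0 memv0 subr_eq0 => /eqP ->; apply: (subvP SU).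
Qed.

(** Passing to a larger root decreases the number of roots above. *)
Lemma lex_maximal_root : (exists mu, lie_root mu) ->
  exists2 delta, lie_root delta & forall nu, lie_root nu -> ~ lex_pos b (nu - delta).
Proof.
have [s us sP] := finite_roots tauP aP.
pose above mu nu := `[< lex_pos b (nu - mu) >].
move=> [mu]; have [N] := ubnP (count (above mu) s).
elim: N mu => // N IH mu; rewrite ltnS => muN rmu.
case: (pselect (forall nu, lie_root nu -> ~ lex_pos b (nu - mu))) => [mx|]; first by exists mu.
move=> /existsNP[nu /not_implyP[rnu /contrapT pnu]]; apply: (IH nu _ rnu).
apply: leq_trans muN; apply: (@count_strict _ _ _ s nu).
- move=> x /asboolP px; apply/asboolP.
  by rewrite -[x](subrK nu) -addrA; apply: lex_posD.
- exact/sP.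
- exact/asboolP.
by apply/negP=> /asboolP; rewrite subrr => /lex_pos_neq0.
Qed.

(** [delta] is the highest weight of the adjoint representation: as [gs] is
    simple, it is generated from the root space of [delta] by the nonpositive
    weight spaces. *)
Lemma highest_root_exists : lie_simple gs -> (exists mu, lie_root mu) ->
  exists2 n : 'I_l -> nat, highest_root lam (\sum_j (n j)%:R *: lam j) &
    lex_pos b (\sum_j (n j)%:R *: lam j).
Proof.
move=> simg /lex_maximal_root[delta rdelta dmax].
have pdelta : lex_pos b delta.
  have [//|p] := root_lex_total bP rdelta.
  by case: (dmax _ (lie_root_opp tauP aP rdelta)); apply: lex_posD.
have [n dE] := positive_root_natural rdelta pdelta.
exists n; rewrite -dE //; split=> // mu rmu.
have [qq [qP1 qmin]] := span_weights (fun nu => ~ lex_pos b nu).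
have [nn [nP1 nmin]] := span_weights (fun nu => lex_pos b nu).
have [V [VP Vmin]] := span_weights (fun nu => nu = delta).
pose below nu := is_natural_combination (delta - nu).
have [P [PP Pmin]] := span_weights below.
(* [delta] plus a positive weight is not a weight, and subtracting a positive
   root from a weight below [delta] gives a weight below [delta]. *)
have Pfull : P = fullv.
  apply: (simple_top_generates (q := qq) (n := nn) (V := V)) => //.
  - apply: weight_vectors_span => nu x xnu.
    case: (pselect (lex_pos b nu)) => pnu.
      by apply: (subvP (addvSr _ _)); apply: nP1 xnu.
    by apply: (subvP (addvSl _ _)); apply: qP1 xnu.
  - have [_ [x x0 xd]] := rdelta.
    by apply/vspace_neq0P; exists x => //; apply: VP xd.
  - apply: Vmin => nu x -> xd; apply: PP xd; rewrite /below subrr.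
    exact: natural_combination0.
  - move=> y x yn xV.
    have [S SE] : exists S : {vspace gs}, forall u, u \in S <->
        forall v, v \in V -> lie u v = 0.
      apply: vspace_of_pred => [v _|c u v uV vV w wV]; first exact: lie0l.
      by rewrite lieDl lieZl uV // vV // scaler0 addr0.
    have /subvP/(_ y yn)/SE : (nn <= S)%VS; last by apply.
    apply: nmin => nu u pnu unu; apply/SE=> v vV.
    have /subvP/(_ v vV) : (V <= lker (ad u))%VS; last by rewrite memv_ker adE => /eqP.
    apply: Vmin => mu' w -> wd; rewrite memv_ker adE; apply/eqP; apply: contrapT => uw.
    have wt := weight_vector_lie unu wd.
    apply: (dmax (nu + delta)); last by rewrite addrK.
    apply: weight_vector_root uw wt.
    exact: lex_pos_neq0 (lex_posD pnu pdelta).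
  move=> y x yq xP.
  have [S SE] : exists S : {vspace gs}, forall u, u \in S <->
      forall v, v \in P -> lie u v \in P.
    apply: vspace_of_pred => [v _|c u v uV vV w wV]; first by rewrite lie0l mem0v.
    by rewrite lieDl lieZl memvD ?memvZ ?uV ?vV.
  have /subvP/(_ y yq)/SE : (qq <= S)%VS; last by apply.
  apply: qmin => nu u pnu unu; apply/SE=> v vP.
  have [S' SE'] : exists S' : {vspace gs}, forall w, w \in S' <-> lie u w \in P.
    apply: vspace_of_pred => [|c w z wP zP]; first by rewrite lie0r mem0v.
    by rewrite lieDr lieZr memvD ?memvZ.
  have /subvP/(_ v vP)/SE' // : (P <= S')%VS.
  apply: Pmin => mu' w bw wmu; apply/SE'.
  case: (pselect (u = 0)) => [->|u0]; first by rewrite lie0l mem0v.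
  apply: PP (weight_vector_lie unu wmu); rewrite /below opprD addrCA addrC.
  apply: natural_combinationD => //.
  case: (pselect (nu = 0)) => [->|nu0]; first by rewrite oppr0; exact: natural_combination0.
  have rnu := weight_vector_root nu0 u0 unu.
  have [//|p] := root_lex_total bP rnu.
  exact: positive_root_natural (lie_root_opp tauP aP rnu) p.
apply: contrapT => nb; have [_ [x x0 xmu]] := rmu.
apply: x0; apply: (inner_eq0 qP).
have [S SE] : exists S : {vspace gs}, forall w, w \in S <-> q w x = 0.
  apply: vspace_of_pred => [|c w z wP zP]; first exact: (inner0l qP).
  by rewrite (innerDl qP) (innerZl qP) wP zP mulr0 addr0.
have /subvP/(_ x) : (P <= S)%VS; last by rewrite Pfull memvf => /(_ isT)/SE.
apply: Pmin => nu w bw wnu; apply/SE.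
apply: (weight_vector_orthogonal tauP aP) wnu xmu.
by move=> e; apply: nb; rewrite -e.
Qed.

End RootSystem.

(** * Restricted roots of the noncompact dual *)

Section DualThirdKind.
Variables (R : realType) (g : lieAlgType R) (tau : 'End(g)).
Hypothesis tauP : lie_involution tau.
Local Notation gC := (complexify g).
Local Notation gd := (noncompact_dual tauP).
Let taud : 'End(gd) := tau.
Hypothesis cptg : lie_compact g.
Hypothesis simg : lie_simple g.
Variables (K : gC) (Z : g).
Hypothesis tZ : tau Z = - Z.
Hypothesis KZ : K = - cimag Z.
Hypothesis gr : (\sum_(k < 7) leigenspace (ad K) (k%:Z - 3)%:~R)%VS = fullv.
Hypothesis centerP : forall x, lie Z x = 0 ->
  (forall y, lie Z y = 0 -> lie x y = 0) -> x \in <[Z]>%VS.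
Hypothesis Z0 : Z <> 0.
Local Notation E := (characteristic_gradation (Z : gd)).
Hypothesis E1 : E 1 <> 0%VS.
Hypothesis E3 : E 3 <> 0%VS.
Let ctau := dual_cartan tauP cptg.

Let simgdC : lie_simple (complexify gd).
Proof. exact: dual_complexify_simple (compact_complexify_simple cptg simg). Qed.
Let simgd : lie_simple gd.
Proof. exact: complexify_simple_simple simgdC. Qed.

Lemma dual_lie_Z (H : gd) y : H \in cartan_p taud -> lie H (y : gd) = lie (H : g) (tau y) :> g.
Proof. by move=> /cartan_pP tH; apply: dual_lie_p. Qed.

(** Order the restricted roots lexicographically with [Z] first, so that every
    simple root is nonnegative on [Z]. An element of [a] on which the simple roots
    that vanish on [Z] vanish is central in degree 0, hence a multiple of [Z]:
    so exactly one simple root does not vanish on [Z]. It takes there the value 1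
    because degree 1 occurs, and its coefficient in the highest root is 3, the
    largest degree. *)
Lemma dual_third_kind : exists (a : {vspace gd}) (b : seq (subvs_of a)) (l : nat)
  (lam : 'I_l -> vdual a) (n : 'I_l -> nat) (h : 'I_l -> subvs_of a) (i : 'I_l),
  third_kind_graded taud b lam n h i /\ vsval (h i) = (Z : gd).
Proof.
have Zp : (Z : gd) \in cartan_p taud by apply/cartan_pP.
have [a aP Za] := maximal_abelian_exists Zp.
pose Zs := vsproj a (Z : gd).
have ZsE : vsval Zs = (Z : gd) by rewrite vsprojK.
have Zs0 : Zs != 0.
  by apply/eqP => e; apply: Z0; rewrite -[LHS]ZsE e linear0.
have [b' bP] := basis_extending Zs0.
pose b := Zs :: b'.
have [l [lam [lam_inj lamP]]] := simple_roots_enumeration ctau aP b.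
have [h' h'P] := simple_roots_dual ctau aP bP lam_inj lamP.
have pos_ge0 (mu : vdual a) : lex_pos b mu -> 0 <= mu Zs :> R.
  by move=> [[|j] [_ mj muj]]; [exact: ltW | have := muj 0%N isT => /= ->].
have lam_ge0 j : 0 <= lam j Zs :> R.
  by apply: pos_ge0; have [_ + _] := lam_simple lamP j.
have sumE (k : 'I_l -> nat) H : (\sum_j (k j)%:R *: lam j) H = \sum_j (k j)%:R * lam j H :> R.
  exact: vdual_sumE.
have root_comb (mu : vdual a) : lie_root mu -> exists k : 'I_l -> nat,
    mu = \sum_j (k j)%:R *: lam j \/ mu = - \sum_j (k j)%:R *: lam j.
  move=> rmu; have [p|p] := root_lex_total bP rmu.
    by have [k ->] := positive_root_natural ctau aP lamP rmu p; exists k; left.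
  have [k e] := positive_root_natural ctau aP lamP (lie_root_opp ctau aP rmu) p.
  by exists k; right; rewrite -e opprK.
have aE0 u : u \in a -> u \in E 0.
  have [_ aab _] := aP.
  by move=> ua; apply/leigenspaceP; rewrite adE (aab _ u) // scale0r.
have Elie (p r : int) (x y : gd) : x \in E p -> y \in E r -> lie x y \in E (p + r).
  by have [_ _ _ Elie _] := dual_kind cptg tZ KZ gr E1; apply: Elie.
have degree_weight (p : int) (mu : vdual a) (x : gd) : x \in E p -> x <> 0 ->
    weight_vector mu x -> mu Zs = p%:~R.
  move=> /leigenspaceP; rewrite adE => xp /eqP x0 /(_ Zs); rewrite ZsE xp => /eqP.
  by rewrite -subr_eq0 -scalerBl scaler_eq0 (negbTE x0) orbF subr_eq0 => /eqP.
have Eweight (p : int) : E p <> 0%VS -> exists mu : vdual a,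
    mu Zs = p%:~R /\ (p != 0 -> lie_root mu).
  move=> Ep; have [|mu [x [xE x0 xmu]]] := restricted_weight_exists ctau aP Ep.
    by move=> u x ua xE; have := Elie _ _ _ _ (aE0 _ ua) xE; rewrite add0r.
  have muE := degree_weight _ _ _ xE x0 xmu; exists mu; split=> // p0.
  apply: weight_vector_root x0 xmu => m0; case/eqP: p0; apply/eqP.
  by rewrite -(intr_eq0 R) -muE m0 vdual_0E.
have integral (mu : vdual a) : lie_root mu -> exists2 p : int, (`|p| <= 3)%N & mu Zs = p%:~R.
  move=> [mu0 [x x0 xmu]]; apply: (dual_eigenvalue tZ KZ gr x0).
  by have := xmu Zs; rewrite ZsE.
(* A weight of degree 0 is, up to sign, a natural combination of simple roots
   whose values on [Z] are nonnegative and add up to 0: only simple roots that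
   vanish on [Z] occur in it. *)
have inZ (H : subvs_of a) : (forall j, lam j Zs = 0 -> lam j H = 0) ->
    exists c : R, H = c *: Zs.
  move=> lamH.
  have H0 (x : gd) : x \in E 0 -> lie (vsval H) x = 0.
    apply: (weights_vanish ctau aP) => [u y ua yE|mu y yE y0 ymu].
      by have := Elie _ _ _ _ (aE0 _ ua) yE; rewrite add0r.
    have muZ := degree_weight _ _ _ yE y0 ymu.
    case: (pselect (mu = 0)) => [->|mu0]; first exact: vdual_0E.
    have sum0 (k : 'I_l -> nat) : \sum_j (k j)%:R * lam j Zs = 0 :> R ->
        (\sum_j (k j)%:R *: lam j) H = 0 :> R.
      move=> /psumr_eq0P k0; rewrite sumE big1 // => j _.
      have /eqP : (k j)%:R * lam j Zs = 0 :> R.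
        by apply: k0 => // m _; apply: mulr_ge0.
      by rewrite mulf_eq0 => /orP[/eqP ->|/eqP/lamH ->]; rewrite ?mul0r ?mulr0.
    have [k [e|e]] := root_comb _ (weight_vector_root mu0 y0 ymu);
      move: muZ; rewrite e ?vdual_oppE sumE; first exact: sum0.
    by move=> /eqP; rewrite oppr_eq0 => /eqP/sum0 ->; rewrite oppr0.
  have Hp := restricted_p aP H; have /cartan_pP tH := Hp.
  have /vlineP[c Hc] : (vsval H : g) \in <[Z]>%VS.
    apply: centerP => [|y Zy].
      have [_ aab _] := aP; have := aab _ _ Za (subvsP H).
      rewrite [LHS](dual_lie_p tauP (vsval H : g) tZ).
      by rewrite [tau _]tH lieNr => /eqP; rewrite oppr_eq0 => /eqP.
    have tyE : (tau y : gd) \in E 0.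
      apply/leigenspaceP; rewrite adE scale0r.
      by rewrite [LHS](dual_lie_p tauP (tau y) tZ) (involutionK tauP).
    by have := H0 _ tyE; rewrite [LHS](dual_lie_Z (tau y) Hp) (involutionK tauP).
  by exists c; apply: (can_inj vsvalK); rewrite vsvalZ ZsE.
have [i0 lami0] : exists i, lam i Zs <> 0 :> R.
  apply: contrapT => no; have [mu [muZ /(_ isT)/root_comb[k ke]]] := Eweight 1 E1.
  have s0 : (\sum_j (k j)%:R *: lam j) Zs = 0 :> R.
    rewrite sumE big1 // => j _; apply/eqP; rewrite mulf_eq0; apply/orP; right.
    by apply/eqP; apply: contrapT => lj; apply: no; exists j.
  have /eqP : (1 : int)%:~R = 0 :> R by rewrite -muZ; case: ke => ->; rewrite ?vdual_oppE s0 ?oppr0.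
  by rewrite oner_eq0.
(* The dual vector of [lam j] would be a multiple of [Z] killed by [lam i0]. *)
have others j : j != i0 -> lam j Zs = 0 :> R.
  move=> ji; apply: contrapT => lj.
  have [m lm|c hc] := inZ (h' j).
    by rewrite h'P; case: (eqVneq m j) => // mj; rewrite mj in lm.
  have c0 : c = 0.
    have := h'P i0 j; rewrite eq_sym (negbTE ji) hc linearZ /= => /eqP.
    by rewrite scaler_eq0 => /orP[/eqP //|/eqP/lami0].
  by have := h'P j j; rewrite eqxx hc c0 scale0r linear0 => /eqP; rewrite eq_sym oner_eq0.
(* The value is a nonnegative integer, and an integral multiple of it is 1. *)
have lam1 : lam i0 Zs = 1 :> R.
  have [mu [muZ /(_ isT)/root_comb[k ke]]] := Eweight 1 E1.
  have kE : (\sum_j (k j)%:R *: lam j) Zs = (k i0)%:R * lam i0 Zs :> R.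
    rewrite sumE (bigD1 i0) //= big1 ?addr0 // => j /others ->.
    by rewrite mulr0.
  have [rl _ _] := lam_simple lamP i0; have [p _ pE] := integral _ rl.
  have p_ge0 : 0 <= p by rewrite -(ler0z R) -pE.
  have kp : (k i0)%:Z * p = 1 \/ (k i0)%:Z * p = - 1.
    have toZ : (k i0)%:R * lam i0 Zs = ((k i0)%:Z * p)%:~R :> R by rewrite intrM pE.
    by case: ke => e; [left | right]; apply/eqP; rewrite -(eqr_int R) -toZ -kE ?mulrNz -muZ e
      ?vdual_oppE ?opprK.
  case: p p_ge0 pE kp => // m _ -> [|]; rewrite -PoszM // => -[] /eqP.
  by rewrite muln_eq1 => /andP[_ /eqP ->].
pose h k := if k == i0 then Zs else h' k.
have hP j k : lam j (h k) = (j == k)%:R.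
  rewrite /h; case: (eqVneq k i0) => [->|ki]; last exact: h'P.
  by case: (eqVneq j i0) => [->|/others ->].
have [n highP nb] := highest_root_exists ctau aP bP lamP simgd
  (let: ex_intro mu (conj _ r) := Eweight 1 E1 in ex_intro _ mu (r isT)).
exists a, b, l, lam, n, h, i0.
have hi : vsval (h i0) = (Z : gd) by rewrite /h eqxx.
split=> //; split=> //.
- exact (dual_noncompact (tauP := tauP) cptg Z0 tZ).
- by rewrite hi; apply: (dual_kind cptg tZ KZ gr E1).
- rewrite hi; exact (dual_reversing tauP tZ).
have hsum (k : 'I_l -> nat) : (\sum_j (k j)%:R *: lam j) Zs = (k i0)%:R :> R.
  rewrite sumE (bigD1 i0) //= lam1 mulr1 big1 ?addr0 // => j /others ->.
  by rewrite mulr0.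
have [rdelta dmax] := highP.
have [p p3 pE] := integral _ rdelta.
have np : (n i0)%:Z = p by apply/eqP; rewrite -(eqr_int R) -pE hsum.
have [mu [mu3 /(_ isT)/dmax[k ke]]] := Eweight 3 E3.
have : (n i0)%:R - 3%:R = (k i0)%:R :> R.
  by rewrite -(hsum n) -(hsum k) -ke vdual_addE vdual_oppE mu3.
move=> /eqP; rewrite subr_eq -natrD eqr_nat => /eqP.
lia.
Qed.

End DualThirdKind.

(** * The compact algebra as the dual of its noncompact dual *)

Section CompactAsDual.
Variables (R : realType) (g : lieAlgType R) (tau : 'End(g)).
Hypothesis tauP : lie_involution tau.
Local Notation gC := (complexify g).
Local Notation gd := (noncompact_dual tauP).
Local Notation gdC := (complexify (noncompact_dual tauP)).
Let taud : 'End(gd) := tau.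
Variables (K : gC) (Z : g).
Hypothesis tZ : tau Z = - Z.
Hypothesis KZ : K = - cimag Z.
Hypothesis gr : (\sum_(k < 7) leigenspace (ad K) (k%:Z - 3)%:~R)%VS = fullv.
Hypothesis grd :
  (\sum_(k < 7) leigenspace (ad (creal (Z : gd) : gdC)) (k%:Z - 3)%:~R)%VS = fullv.

(** The isomorphism maps [K] to [Z], hence degree [p] to degree [p]. *)
Lemma dual_complexify_quarter_turn (X : gC) :
  dual_complexify tauP (Ad_exp (half_pi_i K) X)
  = Ad_exp (half_pi_i (creal (Z : gd))) (dual_complexify tauP X) :> gdC.
Proof.
elim/(homogeneous_ind gr): X => [|X Y IX IY|p X XE].
- rewrite [Ad_exp _ 0]linear0.
  by rewrite -dual_isoE linear0 [RHS]linear0.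
- by rewrite quarter_turnD !dual_complexifyD quarter_turnD IX IY.
rewrite (quarter_turnE gr XE) dual_complexifyZ.
have [/(_ XE) phiX _] := dual_degreeP tauP tZ KZ p X.
by rewrite (quarter_turnE grd phiX).
Qed.

(** The map [x + y |-> x + i y] for [x] in [k] and [y] in [p]: the dual of the dual
    of [g] is [g]. *)
Definition compact_embed : 'Hom(g, realify gdC) :=
  linfun (fun x => dual_complexify tauP (creal x) : realify gdC).

Lemma compact_embedE x : compact_embed x = dual_complexify tauP (creal x).
Proof.
apply: linear_linfun => c y z.
by rewrite crealD crealZ dual_complexifyD dual_complexifyZ.
Qed.

Lemma compact_embed_lker0 : lker compact_embed = 0%VS.
Proof.
apply/eqP/lker0P => x y; rewrite !compact_embedE => /dual_complexify_inj.
by case.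
Qed.

Lemma compact_embed_limg : limg compact_embed = compact_dual taud.
Proof.
apply/vspaceP=> X; apply/idP/idP => [/memv_imgP[x _ ->]|/compact_dualP[X1 X2]].
  rewrite compact_embedE dual_complexify_creal; apply/compact_dualP; split.
    by apply/cartan_kP; apply: (tau_fixed_part tauP).
  by apply/cartan_pP; apply: (tau_anti_part tauP).
move: X1 X2 => /cartan_kP X1 /cartan_pP X2.
have [e1 e2] := part_unique (tau := tau) (erefl (X.1 + X.2 : g)) X1 X2.
have <- : compact_embed (X.1 + X.2 : g) = X; last by rewrite memv_img ?memvf.
by rewrite compact_embedE dual_complexify_creal e1 e2; case: (X).
Qed.

Lemma compact_embed_lie : lie_hom compact_embed.
Proof.
move=> x y; rewrite !compact_embedE creal_lie.
exact: dual_complexify_lie.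
Qed.

Lemma compact_embed_tau x :
  compact_embed (tau x) = complexify_lfun taud (compact_embed x).
Proof.
rewrite [RHS]complexify_lfunE !compact_embedE !dual_complexify_creal /=.
have -> : taud (fixed_part tau x) = fixed_part tau x := tau_fixed_part tauP x.
have -> : taud (anti_part tau x) = - anti_part tau x := tau_anti_part tauP x.
have -> : fixed_part tau (tau x) = fixed_part tau x.
  by rewrite !fixed_partE (involutionK tauP) addrC.
have -> // : anti_part tau (tau x) = - anti_part tau x.
by rewrite !anti_partE (involutionK tauP) -scalerN opprB.
Qed.

End CompactAsDual.

(** * Automorphisms of order four and gradations of the third kind *)

Theorem proposition6p1 (R : realType) :
  (forall (gs : lieAlgType R) (tau : 'End(gs)) (a : {vspace gs})
      (b : seq (subvs_of a)) (l : nat) (lam : 'I_l -> vdual a)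
      (n : 'I_l -> nat) (h : 'I_l -> subvs_of a) (i : 'I_l),
    third_kind_graded tau b lam n h i ->
    let g := compact_dual tau in
    let sigma := Ad_exp (half_pi_i (creal (vsval (h i)))) in
    [/\ lie_aut_on g sigma,
        order_on g sigma 4,
        \dim (lie_center (g :&: fixedSpace sigma)) = 1%N &
        {in g, forall x, (complexify_lfun tau \o sigma)%VF x
                         = (sigma^-1 \o complexify_lfun tau)%VF x}])
  /\
  (forall (g : lieAlgType R) (t : {vspace g}) (n : nat)
      (alpha : 'I_n -> vdual (complexify_vs t)) (m : 'I_n -> nat) (i : 'I_n)
      (K : 'I_n -> subvs_of (complexify_vs t)) (sigma : 'End(g)),
    lie_compact g ->
    lie_simple g ->
    maximal_abelian_in fullv t ->
    root_base alpha ->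
    highest_root alpha (\sum_j (m j)%:R *: alpha j) ->
    (forall j k, alpha j (K k) = (j == k)%:R) ->
    m i = 3%N ->
    (forall x : g, (creal (sigma x) : realify (complexify g))
                   = Ad_exp (half_pi_i (vsval (K i))) (creal x)) ->
    forall tau : 'End(g),
      lie_involution tau ->
      (tau \o sigma)%VF = (sigma^-1 \o tau)%VF ->
      exists theta : 'End(g),
        lie_aut theta /\
        obtained_from_graded (theta \o sigma \o theta^-1)%VF
                             (theta \o tau \o theta^-1)%VF).
Proof.
split=> [gs tau a b l lam n h i tkg g sigma|].
  split; [exact: (sigma_aut tkg) | exact: (sigma_order tkg) | |].
    exact: (sigma_center_dim tkg).
  by move=> X _; rewrite !comp_lfunE; apply: (sigma_reversed tkg).
move=> g t n alpha m i K sigma cptg simg tP alphaP highP dualP mi sigmaP tau tauP ts.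
have [Z [Zt KZ _]] := characteristic_element cptg simg tP i alphaP dualP.
have gr := characteristic_graded cptg simg tP alphaP highP dualP mi.
have tZ := involution_reverses cptg simg tP alphaP highP dualP mi Zt KZ sigmaP tauP ts.
have Z0 := characteristic_neq0 dualP Zt KZ.
have centerP := characteristic_center cptg simg tP alphaP dualP Zt KZ.
have E1 : characteristic_gradation (Z : noncompact_dual tauP) 1 <> 0%VS.
  have [X X0 Xa] := alpha_root_vector alphaP i.
  apply: (dual_degree_neq0 tZ KZ X0); apply/leigenspaceP.
  by rewrite adE (Xa (K i)) dualP eqxx.
have E3 : characteristic_gradation (Z : noncompact_dual tauP) 3 <> 0%VS.
  have [[_ [X X0 Xa]] _] := highP.
  apply: (dual_degree_neq0 tZ KZ X0); apply/leigenspaceP.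
  by rewrite adE (Xa (K i)) (sum_alphaK i dualP) mi.
have [a [b [l [lam [n' [h [i' [tkg hZ]]]]]]]] :=
  dual_third_kind cptg simg tZ KZ gr centerP Z0 E1 E3.
have thE (f : 'End(g)) : (\1 \o f \o \1^-1)%VF = f.
  have id0 : lker (\1 : 'End(g))%VF == 0%VS by apply/lker0P => x y; rewrite !id_lfunE.
  by apply/lfunP=> x; rewrite !comp_lfunE id_lfunE -{1}[x]id_lfunE lker0_lfunK.
exists \1%VF; split; first by split=> [|x y _ _]; rewrite ?lim1g // !id_lfunE.
rewrite !thE; exists (noncompact_dual tauP), tau, a, b, l, lam, n', h, i'; split=> //.
exists (compact_embed tauP); split.
- exact: compact_embed_lker0.
- exact: compact_embed_limg.
- exact: compact_embed_lie.
- move=> x; rewrite /graded_sigma hZ !compact_embedE sigmaP.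
  apply: (dual_complexify_quarter_turn tZ KZ gr).
  by have := third_kind_graded_sum tkg; rewrite hZ.
- exact: compact_embed_tau.
Qed.
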